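(* Let $\mathbb{K}$ be an algebraically closed field of characteristic zero, $X$ a smooth projective variety over $\mathbb{K}$ with $H^i(X,\mathcal{O}_X)=0$ for $i=1,2$, $\mathcal{E}$ a locally free sheaf of $\mathcal{O}_X$-modules on $X$ and $U\subseteq H^0(X,\mathcal{E})$ a linear subspace of dimension $m$. Then $$\dim t_{\mathrm{Def}_{(\mathcal{E},U)}}\ \ge\ \dim t_{\mathrm{Def}_{\mathcal{E}}}-m\cdot\dim H^1(X,\mathcal{E}).$$
   Context: $\mathbf{Art}_{\mathbb{K}}$ is the category of local Artinian $\mathbb{K}$-algebras with residue field $\mathbb{K}$. For a deformation functor $F:\mathbf{Art}_{\mathbb{K}}\to\mathbf{Sets}$, $t_F=F(\mathbb{K}[\epsilon])$, $\epsilon^2=0$, is its tangent space. A deformation of $\mathcal{E}$ over $A\in\mathbf{Art}_{\mathbb{K}}$ is a locally free sheaf $\mathcal{E}_A$ of $\mathcal{O}_X\otimes A$-modules on $X\times\mathrm{Spec}\,A$ with a morphism $\pi_A:\mathcal{E}_A\to\mathcal{E}$ inducing $\mathcal{E}_A\otimes_A\mathbb{K}\cong\mathcal{E}$; isomorphisms commute with the maps to $\mathcal{E}$. A deformation of $(\mathcal{E},U)$ over $A$ is $(\mathcal{E}_A,\pi_A,i_A)$ with $(\mathcal{E}_A,\pi_A)$ a deformation of $\mathcal{E}$ and $i_A:U\otimes A\to H^0(X\times\mathrm{Spec}\,A,\mathcal{E}_A)$ a morphism (of $A$-modules) with $\pi_A\circ i_A=i\circ\pi$, where $\pi:U\otimes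 A\to U$ is the reduction and $i:U\hookrightarrow H^0(X,\mathcal{E})$ the inclusion. Two such are isomorphic if there are an isomorphism $\phi:\mathcal{E}_A\to\mathcal{E}'_A$ of $\mathcal{O}_X\otimes A$-modules with $\pi'_A\phi=\pi_A$ and an isomorphism $\psi:U\otimes A\to U\otimes A$ with $\phi\circ i_A=i'_A\circ\psi$. $\mathrm{Def}_{\mathcal{E}}$ and $\mathrm{Def}_{(\mathcal{E},U)}$ are the functors of isomorphism classes of these deformations. *)

(* Defs.v *)
From HB Require Import structures.
From mathcomp Require Import all_boot all_order all_algebra.
From mathcomp Require Import boolp classical_sets functions.
From mathcomp Require Import topology_structure initial_topology
  subtype_topology constructive_ereal.
(* Its notations clash with those of the preceding files. *)
From mathcomp Require Import -(notations) mpoly.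

Set Implicit Arguments.
Unset Strict Implicit.
Unset Printing Implicit Defensive.
Import GRing.Theory.

Local Open Scope classical_set_scope.
Local Open Scope ring_scope.

(** * Vector spaces presented by raw operations, and their dimension *)

(* [vin] is the subset of elements and [veq] the equality: the space meant is
   [vin] modulo [veq].  It is used for tangent spaces and cohomology groups. *)
Record rawspace (K : fieldType) := RawSpace {
  vcar : Type;
  vin : vcar -> Prop;
  veq : vcar -> vcar -> Prop;
  vzero : vcar;
  vadd : vcar -> vcar -> vcar;
  vscale : K -> vcar -> vcar }.

Section Dimension.
Variables (K : fieldType) (V : rawspace K).

Definition lincomb n (c : 'I_n -> K) (v : 'I_n -> vcar V) : vcar V :=
  \big[@vadd K V/@vzero K V]_(i < n) vscale (c i) (v i).

Definition is_basis n (v : 'I_n -> vcar V) : Prop :=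
  [/\ forall i, vin (v i),
      forall c : 'I_n -> K, veq (lincomb c v) (vzero V) -> forall i, c i = 0
    & forall w, vin w -> exists c : 'I_n -> K, veq w (lincomb c v)].

Definition has_dim (n : nat) : Prop := exists v : 'I_n -> vcar V, is_basis v.

(* The dimension in {0, 1, 2, ..., +oo}. *)
Definition edim : \bar int :=
  if `[< exists n, has_dim n >] then (xget 0%N has_dim)%:Z%:E else +oo%E.

Definition is_zero_space : Prop := forall w, vin w -> veq w (vzero V).

End Dimension.

(** * Projective varieties over an algebraically closed field *)

Definition pspace (K : fieldType) (n : nat) :=
  {L : {vspace 'rV[K]_n.+1} | \dim L == 1%N}.

HB.instance Definition _ K n := Choice.copy (pspace K n)
  {L : {vspace 'rV[K]_n.+1} | \dim L == 1%N}.

Section ProjectiveSpace.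
Variables (K : fieldType) (n : nat).

Definition homog (d : nat) (p : mpoly n.+1 K) : Prop :=
  p \is ishomog1 d mdeg.

Definition hcoord (x : pspace K n) (i : 'I_n.+1) : K := vpick (val x) 0 i.

(* Evaluation at a fixed nonzero vector of the line [x]: only the vanishing of
   a form and the quotient of two forms of the same degree are used. *)
Definition heval (p : mpoly n.+1 K) (x : pspace K n) : K :=
  meval (hcoord x) p.

Definition zariski_open (U : set (pspace K n)) : Prop :=
  exists Q : set (mpoly n.+1 K),
    (forall q, Q q -> exists d, homog d q) /\
    U = [set x | exists2 q, Q q & heval q x != 0].

Lemma zariski_openT : zariski_open setT.
Proof.
exists [set 1]; split; first by move=> q ->; exists 0%N; exact: dhomog1.
apply/seteqP; split => x //= _; exists 1 => //.
by rewrite /heval meval1 oner_neq0.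
Qed.

Lemma zariski_openI : setI_closed zariski_open.
Proof.
move=> _ _ [P [hP ->]] [Q [hQ ->]].
exists [set r | exists p q, [/\ P p, Q q & r = p * q]]; split.
  move=> _ [p [q [/hP[d hd] /hQ[e he] ->]]]; exists (d + e)%N.
  exact: dhomogM.
apply/seteqP; split => x /=.
  move=> [[p Pp px] [q Qq qx]]; exists (p * q); first by exists p, q.
  by rewrite /heval mevalM mulf_neq0.
move=> [_ [p [q [Pp Qq ->]]]]; rewrite /heval mevalM mulf_eq0 negb_or.
by move=> /andP[px qx]; split; [exists p|exists q].
Qed.

Lemma zariski_open_bigU (I : Type) (f : I -> set (pspace K n)) :
  (forall i, zariski_open (f i)) -> zariski_open (\bigcup_i f i).
Proof.
move=> /choice[Q hQ]; exists (\bigcup_i Q i); split.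
  by move=> q [i _]; exact: (hQ i).1.
apply/seteqP; split => x /=.
  by move=> [i _]; rewrite (hQ i).2 => -[q Qq qx]; exists q => //; exists i.
by move=> [q [i _ Qq] qx]; exists i => //; rewrite (hQ i).2; exists q.
Qed.

HB.instance Definition _ := @isOpenTopological.Build (pspace K n)
  zariski_open zariski_openT zariski_openI zariski_open_bigU.

End ProjectiveSpace.

Definition irreducible (T : topologicalType) (Z : set T) : Prop :=
  Z !=set0 /\ forall A B, closed A -> closed B -> Z `<=` A `|` B ->
    Z `<=` A \/ Z `<=` B.

(* Points are closed points; over an algebraically closed field the open
   subsets, the structure sheaf and hence the sheaves of modules are the same
   as on the scheme. *)
Record projvar (K : fieldType) := ProjVar {
  pv_n : nat;
  pv_set : set (pspace K pv_n);
  pv_closed : closed pv_set;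
  pv_irreducible : irreducible pv_set }.
Arguments pv_set {K} p _.

Definition pts (K : fieldType) (X : projvar K) : topologicalType :=
  set_type (pv_set X).

Definition krull_chain (T : topologicalType) (d : nat) : Prop :=
  exists Z : nat -> set T,
    (forall i, (i <= d)%N -> closed (Z i) /\ irreducible (Z i)) /\
    (forall i, (i < d)%N -> Z i `<` Z i.+1).

Definition krull_dim (T : topologicalType) (d : nat) : Prop :=
  krull_chain T d /\ ~ krull_chain T d.+1.

Section Smooth.
Variables (K : fieldType) (X : projvar K).

Definition pv_ideal : set (mpoly (pv_n X).+1 K) :=
  [set p | (exists d, homog d p) /\ forall x, pv_set X x -> heval p x = 0].

(* The kernel at [x] of the Jacobian matrix of the homogeneous ideal. *)
Definition jacobian_ker (x : pspace K (pv_n X)) : set 'rV[K]_(pv_n X).+1 :=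
  [set v | forall p, pv_ideal p ->
     \sum_i heval (mderiv i p) x * v 0 i = 0].

(* Jacobian criterion: the rank is n - dim X at every point, that is, the
   kernel in K^(n+1) has dimension dim X + 1. *)
Definition smooth : Prop :=
  exists d, krull_dim (pts X) d /\
    forall x, pv_set X x -> exists W : {vspace 'rV[K]_(pv_n X).+1},
      \dim W = d.+1 /\ forall v, v \in W <-> jacobian_ker x v.

End Smooth.

(** * Local Artinian K-algebras with residue field K *)

Definition is_ideal (A : comPzRingType) (I : set A) : Prop :=
  [/\ I 0, forall a b, I a -> I b -> I (a + b)
    & forall c a, I a -> I (c * a)].

(* The residue map [aug] is determined by the algebra: elements outside its
   kernel are units, so that the kernel is the only maximal ideal. *)
Record artType (K : fieldType) := Art {
  art_alg :> comAlgType K;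
  aug : {lrmorphism art_alg -> K^o};
  art_local : forall a, aug a != 0 -> exists b, a * b = 1;
  artinian : forall I : nat -> set art_alg,
    (forall k, is_ideal (I k)) -> (forall k, I k.+1 `<=` I k) ->
    exists N, forall k, (N <= k)%N -> I k = I N }.

(* [sqz K r] is the algebra K (+) K^r, with K^r an ideal of square zero: for
   r = 0 it is K, for r = 1 it is K[e]/(e^2), and for r = 2 it is
   K[e1,e2]/(e1,e2)^2, the fibre product over K of two copies of K[e]. *)
Definition sqz (K : fieldType) (r : nat) : Type := (K^o * 'rV[K]_r)%type.

Section SquareZero.
Variables (K : fieldType) (r : nat).

HB.instance Definition _ := GRing.Lmodule.copy (sqz K r) (K^o * 'rV[K]_r)%type.

Definition sqz_one : sqz K r := (1, 0).
Definition sqz_mul (a b : sqz K r) : sqz K r :=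
  (a.1 * b.1, a.1 *: b.2 + b.1 *: a.2).

Lemma sqz_mulA : associative sqz_mul.
Proof.
move=> [a u] [b v] [c w]; congr pair => /=; first exact: mulrA.
by rewrite !scalerDr !scalerA addrA (mulrC c a) (mulrC c b).
Qed.

Lemma sqz_mulC : commutative sqz_mul.
Proof. by move=> [a u] [b v]; congr pair => /=; rewrite (mulrC, addrC). Qed.

Lemma sqz_mul1 : left_id sqz_one sqz_mul.
Proof.
by move=> [a u]; congr pair => /=; rewrite ?mul1r // scale1r scaler0 addr0.
Qed.

Lemma sqz_mulDl : left_distributive sqz_mul +%R.
Proof.
move=> [a u] [b v] [c w]; congr pair => /=; first exact: mulrDl.
by rewrite scalerDl scalerDr addrACA.
Qed.

Lemma sqz_one_neq0 : sqz_one != 0 :> sqz K r.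
Proof. by apply/eqP => -[/eqP]; rewrite oner_eq0. Qed.

HB.instance Definition _ := GRing.Zmodule_isComNzRing.Build (sqz K r)
  sqz_mulA sqz_mulC sqz_mul1 sqz_mulDl sqz_one_neq0.

Lemma sqz_scaleAl (k : K) (a b : sqz K r) : k *: (a * b) = k *: a * b.
Proof.
case: a b => [a u] [b v]; congr pair => /=; first exact: mulrA.
by rewrite scalerDr !scalerA (mulrC b k).
Qed.

HB.instance Definition _ := GRing.Lmodule_isLalgebra.Build K (sqz K r)
  sqz_scaleAl.

Lemma sqz_scaleAr (k : K) (a b : sqz K r) : k *: (a * b) = a * (k *: b).
Proof. by rewrite mulrC sqz_scaleAl mulrC. Qed.

HB.instance Definition _ := GRing.Lalgebra_isAlgebra.Build K (sqz K r)
  sqz_scaleAr.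

Definition sqz_aug : sqz K r -> K^o := fst.

Lemma sqz_aug_is_linear : linear sqz_aug.
Proof. by []. Qed.

Lemma sqz_aug_is_monoid_morphism : monoid_morphism sqz_aug.
Proof. by []. Qed.

HB.instance Definition _ := GRing.isLinear.Build K (sqz K r) K^o *:%R sqz_aug
  sqz_aug_is_linear.
HB.instance Definition _ := GRing.isMonoidMorphism.Build (sqz K r) K^o sqz_aug
  sqz_aug_is_monoid_morphism.

Lemma sqz_local (a : sqz K r) : sqz_aug a != 0 -> exists b, a * b = 1.
Proof.
case: a => a u /= a0; exists (a^-1, - (a^-1 * a^-1) *: u); congr pair => /=.
  exact: mulfV.
by rewrite scalerA mulrN mulrA mulfV // mul1r -scalerDl addNr scale0r.
Qed.

End SquareZero.

Section Chains.
Variables (K : fieldType) (V : vectType K).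

Lemma vspace_of_set (I : set V) : I 0 ->
  (forall a u v, I u -> I v -> I (a *: u + v)) ->
  exists W : {vspace V}, forall v, v \in W <-> I v.
Proof.
move=> I0 IP.
pose sub (W : {vspace V}) := forall v, v \in W -> I v.
pose P k := `[< exists2 W : {vspace V}, sub W & \dim W = k >].
have exP : exists k, P k.
  exists 0%N; apply/asboolP; exists 0%VS; last exact: dimv0.
  by move=> v; rewrite memv0 => /eqP ->.
have ubP k : P k -> (k <= \dim {:V})%N.
  by move=> /asboolP[W _ <-]; exact/dimvS/subvf.
have [k /asboolP[W sW dW] maxk] := ex_maxnP exP ubP.
exists W => v; split; first exact: sW.
move=> Iv; apply/negPn/negP => vW.
have sWv : sub (W + <[v]>)%VS.
  move=> _ /memv_addP[w wW [_ /vlineP[a ->] ->]].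
  by rewrite addrC; apply: IP => //; exact: sW.
have : P (\dim (W + <[v]>)) by apply/asboolP; exists (W + <[v]>)%VS.
move=> /maxk; rewrite -dW => le.
have : (W == W + <[v]>)%VS by rewrite eqEdim addvSl.
move=> /eqP WE; move: vW; rewrite WE => /negP; apply.
by apply: (subvP (addvSr W <[v]>)); exact: memv_line.
Qed.

Lemma chain_stab (I : nat -> set V) : (forall k, I k 0) ->
  (forall k a u v, I k u -> I k v -> I k (a *: u + v)) ->
  (forall k, I k.+1 `<=` I k) -> exists N, forall k, (N <= k)%N -> I k = I N.
Proof.
move=> I0 IP Idec.
have /choice[W hW] k := vspace_of_set (I0 k) (IP k).
have Wdec N k : (N <= k)%N -> (W k <= W N)%VS.
  move=> /subnK <-; elim: (k - N)%N => [|j IH]; first exact: subvv.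
  apply: subv_trans IH; apply/subvP => v; rewrite addSn => /hW /Idec.
  by move/hW.
pose P d := `[< exists N, \dim (W N) = d >].
have exP : exists d, P d by exists (\dim (W 0)); apply/asboolP; exists 0%N.
have [d /asboolP[N dN] mind] := ex_minnP exP.
exists N => k Nk; have : W k = W N.
  apply/eqP; rewrite eqEdim Wdec //= dN; apply: mind.
  by apply/asboolP; exists k.
by move=> WE; apply/seteqP; split => v; rewrite -!hW WE.
Qed.

End Chains.

Lemma sqz_artinian (K : fieldType) (r : nat) (I : nat -> set (sqz K r)) :
  (forall k, is_ideal (I k)) -> (forall k, I k.+1 `<=` I k) ->
  exists N, forall k, (N <= k)%N -> I k = I N.
Proof.
move=> hI; apply: (@chain_stab K (K^o * 'rV[K]_r)%type I).
  by move=> k; case: (hI k).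
move=> k a u v Iu Iv; case: (hI k) => _ ID IM; apply: ID => //.
by have := IM ((a, 0) : sqz K r) _ Iu; congr (I k _); congr pair => /=;
  rewrite scaler0 addr0.
Qed.

Definition sqz_art (K : fieldType) (r : nat) : artType K :=
  @Art K (sqz K r) (@sqz_aug K r) (@sqz_local K r) (@sqz_artinian K r).

(* A linear map K^r -> K^s induces a morphism of algebras. *)
Section SquareZeroMap.
Variables (K : fieldType) (r s : nat) (M : 'M[K]_(r, s)).

Definition sqz_map (a : sqz K r) : sqz K s := (a.1, a.2 *m M).

Lemma sqz_map_is_linear : linear sqz_map.
Proof.
by move=> k [a u] [b v]; congr pair => /=; rewrite mulmxDl -scalemxAl.
Qed.

Lemma sqz_map_is_monoid_morphism : monoid_morphism sqz_map.
Proof.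
split; first by congr pair; exact: mul0mx.
by move=> [a u] [b v]; congr pair => /=; rewrite mulmxDl -!scalemxAl.
Qed.

HB.instance Definition _ := GRing.isLinear.Build K (sqz K r) (sqz K s) *:%R
  sqz_map sqz_map_is_linear.
HB.instance Definition _ := GRing.isMonoidMorphism.Build (sqz K r) (sqz K s)
  sqz_map sqz_map_is_monoid_morphism.

Definition sqz_mor : {lrmorphism sqz_art K r -> sqz_art K s} := sqz_map.

End SquareZeroMap.

(** * The sheaf of algebras O_X (x) A *)

Record opens (T : topologicalType) := Opens {
  oset :> set T;
  oopen : open oset }.

Definition opens_full (T : topologicalType) : opens T := Opens openT.

Definition opensI (T : topologicalType) (U V : opens T) : opens T :=
  Opens (openI (oopen U) (oopen V)).

Lemma open_forall (T : topologicalType) n (U : 'I_n -> opens T) :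
  open [set y | forall i, oset (U i) y].
Proof.
elim: n U => [|n IH] U.
  suff -> : [set y | forall i, oset (U i) y] = setT by exact: openT.
  by apply/seteqP; split => // y _ [].
have -> : [set y | forall i, oset (U i) y] =
    oset (U ord0) `&` [set y | forall i, oset (U (lift ord0 i)) y].
  apply/seteqP; split => y /=; first by [].
  by move=> [y0 yS] i; case: (unliftP ord0 i) => [j|] ->.
by apply: openI; [exact: oopen|exact: IH].
Qed.

Definition opens_bigcap (T : topologicalType) n (U : 'I_n -> opens T) :=
  Opens (open_forall U).

Section RegularFunctions.
Variables (K : fieldType) (X : projvar K).

Definition regular (U : opens (pts X)) (f : U -> K) : Prop :=
  forall x : U, exists V : opens (pts X), oset V (val x) /\
    exists d p q, [/\ homog d p, homog d q &
      forall y : U, oset V (val y) -> let z := val (val y) in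
        heval q z != 0 /\ f y = heval p z / heval q z].

Variable A : comAlgType K.

(* O_X(U) (x) A is identified with the A-valued functions sum_i g_i a_i on U,
   with g_i regular and a_i in A. *)
Definition regularA (U : opens (pts X)) (f : U -> A) : bool :=
  `[< exists n (g : 'I_n -> U -> K) (a : 'I_n -> A),
        (forall i, regular (g i)) /\ forall x, f x = \sum_i g i x *: a i >].


Lemma regular1 (U : opens (pts X)) : regular (fun _ : U => 1).
Proof.
move=> x; exists (opens_full _); split => //; exists 0%N, 1, 1.
split; [exact: dhomog1|exact: dhomog1|move=> y _ /=].
by rewrite /heval meval1 oner_neq0 divr1.
Qed.

Lemma regularM (U : opens (pts X)) (f g : U -> K) :
  regular f -> regular g -> regular (fun x => f x * g x).
Proof.
move=> rf rg x.
have [V [Vx [d [p [q [hp hq Vpq]]]]]] := rf x.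
have [W [Wx [e [p' [q' [hp' hq' Wpq]]]]]] := rg x.
exists (opensI V W); split => //; exists (d + e)%N, (p * p'), (q * q').
split; [exact: dhomogM|exact: dhomogM|move=> y [Vy Wy] /=].
have [q0 ->] := Vpq y Vy; have [q'0 ->] := Wpq y Wy.
by rewrite /heval !mevalM mulf_neq0 // mulf_div.
Qed.

Lemma regularA_fin (U : opens (pts X)) (f : U -> A) (I : finType)
    (g : I -> U -> K) (a : I -> A) : (forall i, regular (g i)) ->
  (forall x, f x = \sum_i g i x *: a i) -> regularA f.
Proof.
move=> rg fE; apply/asboolP; exists #|I|, (g \o enum_val), (a \o enum_val).
split=> [i|x /=]; first exact: rg.
rewrite fE (reindex (@enum_val I predT)) //=.
exact/onW_bij/enum_val_bij.
Qed.

Lemma regularA_subring U : subring_closed (@regularA U).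
Proof.
split.
- apply: (@regularA_fin _ _ 'I_1 (fun _ _ => 1) (fun _ => 1)) => [_|x].
    exact: regular1.
  by rewrite big_ord1 scale1r.
- move=> f g /asboolP[n [u [a [ru fE]]]] /asboolP[m [v [b [rv gE]]]].
  apply: (@regularA_fin _ _ ('I_n + 'I_m)%type
    (fun i => match i with inl i => u i | inr i => v i end)
    (fun i => match i with inl i => a i | inr i => - b i end)) => [[]//|x].
  rewrite big_sumType /= -fE; congr (_ + _).
  by under eq_bigr do rewrite scalerN; rewrite sumrN -gE.
- move=> f g /asboolP[n [u [a [ru fE]]]] /asboolP[m [v [b [rv gE]]]].
  apply: (@regularA_fin _ _ ('I_n * 'I_m)%type
    (fun i x => u i.1 x * v i.2 x) (fun i => a i.1 * b i.2)) => [i|x].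
    exact: regularM.
  rewrite -(pair_big predT predT
    (fun i j => (u i x * v j x) *: (a i * b j))) /=.
  have -> : (f * g) x = f x * g x by [].
  rewrite fE gE big_distrl /=; apply: eq_bigr => i _.
  by rewrite big_distrr /=; apply: eq_bigr => j _;
    rewrite -scalerAl -scalerAr scalerA.
Qed.

(* The ring of sections of O_X (x) A over U. *)
Definition OA (U : opens (pts X)) : Type := {f : U -> A | @regularA U f}.

HB.instance Definition _ (U : opens (pts X)) :=
  SubChoice.copy (OA U) {f : U -> A | @regularA U f}.
HB.instance Definition _ (U : opens (pts X)) :=
  GRing.SubChoice_isSubComPzRing.Build (U -> A) (@regularA U) (OA U)
    (@regularA_subring U).


Definition cstA (U : opens (pts X)) (a : A) : U -> A := fun _ => a.

Lemma cstA_subproof U a : @regularA U (cstA a).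
Proof.
apply: (@regularA_fin _ _ 'I_1 (fun _ _ => 1) (fun _ => a)) => [_|x].
  exact: regular1.
by rewrite big_ord1 scale1r.
Qed.

Definition cst (U : opens (pts X)) (a : A) : OA U := Sub _ (cstA_subproof U a).

Definition incl (T : Type) (U V : set T) (VU : V `<=` U) (x : V) : U :=
  SigSub (mem_set (VU _ (set_valP x))).

Lemma resA_subproof (U V : opens (pts X)) (VU : V `<=` U) (f : OA U) :
  @regularA V (fun x => val f (incl VU x)).
Proof.
have /asboolP[n [g [a [rg fE]]]] := valP f; apply/asboolP.
exists n, (fun i x => g i (incl VU x)), a; split => [i x|x]; last exact: fE.
have [W [Wx [d [p [q [hp hq Wpq]]]]]] := rg i (incl VU x).
exists W; split => //; exists d, p, q; split => // y Wy.
exact: (Wpq (incl VU y)).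
Qed.

Definition resA (U V : opens (pts X)) (VU : V `<=` U) (f : OA U) : OA V :=
  Sub _ (resA_subproof VU f).

End RegularFunctions.

Section PushA.
Variables (K : fieldType) (X : projvar K) (A B : comAlgType K).
Variable phi : {lrmorphism A -> B}.

Lemma pushA_subproof (U : opens (pts X)) (f : OA A U) :
  @regularA K X B U (fun x => phi (val f x)).
Proof.
have /asboolP[n [g [a [rg fE]]]] := valP f; apply/asboolP.
exists n, g, (phi \o a); split => // x.
by rewrite fE linear_sum; apply: eq_bigr => i _; rewrite linearZ.
Qed.

Definition pushA (U : opens (pts X)) (f : OA A U) : OA B U :=
  Sub _ (pushA_subproof f).

End PushA.

(** * Sheaves of O_X (x) A-modules *)

Section Modules.
Variables (K : fieldType) (X : projvar K).

Record opsh (A : comAlgType K) := Opsh {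
  sec :> forall U : opens (pts X), lmodType (@OA K X A U);
  res : forall U V : opens (pts X), V `<=` U -> sec U -> sec V;
  resD : forall (U V : opens (pts X)) (VU : V `<=` U) (s t : sec U),
    res VU (s + t) = res VU s + res VU t;
  resZ : forall (U V : opens (pts X)) (VU : V `<=` U) (f : OA A U) (s : sec U),
    res VU (f *: s) = resA VU f *: res VU s;
  res_id : forall (U : opens (pts X)) (UU : U `<=` U) (s : sec U), res UU s = s;
  res_comp : forall (U V W : opens (pts X)) (VU : V `<=` U) (WV : W `<=` V) (WU : W `<=` U)
    (s : sec U), res WV (res VU s) = res WU s }.

Definition is_sheaf (A : comAlgType K) (M : opsh A) : Prop :=
  forall (I : Type) (U : opens (pts X)) (W : I -> opens (pts X))
    (WU : forall i, W i `<=` U), oset U = \bigcup_i oset (W i) ->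
    (forall s t : M U, (forall i, res (WU i) s = res (WU i) t) -> s = t) /\
    (forall s : forall i, M (W i),
      (forall i j, res (V := opensI (W i) (W j)) (@subIsetl _ _ _) (s i) =
                   res (V := opensI (W i) (W j)) (@subIsetr _ _ _) (s j)) ->
      exists t : M U, forall i, res (WU i) t = s i).

(* Locally isomorphic to (O_X (x) A)^r; such an isomorphism over W is given by
   the images e_1, ..., e_r in M(W) of the canonical basis. *)
Definition locally_free (A : comAlgType K) (M : opsh A) : Prop :=
  forall x : pts X, exists (W : opens (pts X)) (r : nat) (e : 'I_r -> M W),
    oset W x /\
    forall (V : opens (pts X)) (VW : V `<=` W) (s : M V),
      exists! c : {ffun 'I_r -> OA A V}, s = \sum_i c i *: res VW (e i).

(* Morphisms of sheaves of modules along O_X (x) A -> O_X (x) B; for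
   [phi = idfun] these are the morphisms of O_X (x) A-modules. *)
Record omor (A B : comAlgType K) (phi : {lrmorphism A -> B})
    (M : opsh A) (N : opsh B) := Omor {
  ofun :> forall U, M U -> N U;
  ofunD : forall U (s t : M U), ofun (s + t) = ofun s + ofun t;
  ofunZ : forall U (f : OA A U) (s : M U),
    ofun (f *: s) = pushA phi f *: ofun s;
  ofun_res : forall (U V : opens (pts X)) (VU : V `<=` U) (s : M U),
    ofun (res VU s) = res VU (ofun s) }.

Definition omor_lin (A : comAlgType K) (M N : opsh A) :=
  omor (idfun : {lrmorphism A -> A}) M N.

(* [theta] induces an isomorphism M (x)_A B = N: it has the universal property
   of the extension of scalars among sheaves of O_X (x) B-modules. *)
Definition is_base_change (A B : comAlgType K) (phi : {lrmorphism A -> B})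
    (M : opsh A) (N : opsh B) (theta : omor phi M N) : Prop :=
  forall (P : opsh B) (g : omor phi M P), is_sheaf P ->
    exists h : omor_lin N P, (forall U s, h U (theta U s) = g U s) /\
      forall h' : omor_lin N P, (forall U s, h' U (theta U s) = g U s) ->
        forall U s, h' U s = h U s.

Definition gsec (A : comAlgType K) (M : opsh A) := M (opens_full (pts X)).

(* The action of A on the sections of an O_X (x) A-module. *)
Definition ascale (A : comAlgType K) (M : opsh A) U (a : A) (s : M U) : M U :=
  @cst K X A U a *: s.

End Modules.

Section StructureSheaf.
Variables (K : fieldType) (X : projvar K).

Definition structure_sec (U : opens (pts X)) : lmodType (@OA K X K^o U) :=
  (@OA K X K^o U)^o.

Definition structure_res (U V : opens (pts X)) (VU : V `<=` U)
  (f : structure_sec U) : structure_sec V := resA VU f.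

Lemma structure_resD (U V : opens (pts X)) (VU : V `<=` U) (f g : structure_sec U) :
  structure_res VU (f + g) = structure_res VU f + structure_res VU g.
Proof. exact: val_inj. Qed.

Lemma structure_resZ (U V : opens (pts X)) (VU : V `<=` U) (f : OA K^o U) (g : structure_sec U) :
  structure_res VU (f *: g) = resA VU f *: structure_res VU g.
Proof. exact: val_inj. Qed.

Lemma structure_res_id (U : opens (pts X)) (UU : U `<=` U) (f : structure_sec U) :
  structure_res UU f = f.
Proof.
by apply: val_inj; apply/funext => x /=; congr (val f _); exact: val_inj.
Qed.

Lemma structure_res_comp (U V W : opens (pts X)) (VU : V `<=` U)
    (WV : W `<=` V) (WU : W `<=` U) (f : structure_sec U) :
  structure_res WV (structure_res VU f) = structure_res WU f.
Proof.
by apply: val_inj; apply/funext => x /=; congr (val f _); exact: val_inj.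
Qed.

Definition structure_sheaf : opsh X K^o :=
  Opsh structure_resD structure_resZ structure_res_id structure_res_comp.

End StructureSheaf.

(** * Cech cohomology *)

(* The limit over all open covers.  Every cover is refined by one indexed by
   the points, (U_x) with x in U_x, and for two such covers the inclusions
   V_x <= U_x are a canonical refinement, so these covers suffice. *)
Section Cech.
Variables (K : fieldType) (X : projvar K) (F : opsh X K^o).

Record cover := Cover {
  cov :> pts X -> opens (pts X);
  covP : forall x, oset (cov x) x }.

Definition refines (V U : cover) : Prop := forall x, V x `<=` U x.

Definition cover_full : cover := @Cover (fun=> opens_full (pts X)) (fun=> I).

Definition coverI (U V : cover) : cover :=
  @Cover (fun x => opensI (U x) (V x)) (fun x => conj (covP U x) (covP V x)).

Lemma coverIl U V : refines (coverI U V) U.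
Proof. by move=> x y []. Qed.

Lemma coverIr U V : refines (coverI U V) V.
Proof. by move=> x y []. Qed.

Definition capU (U : cover) p (s : 'I_p.+1 -> pts X) : opens (pts X) :=
  opens_bigcap (fun i => U (s i)).

Definition cochain (U : cover) p := forall s : 'I_p.+1 -> pts X, F (capU U s).

Lemma capU_face (U : cover) p (s : 'I_p.+2 -> pts X) (j : 'I_p.+2) :
  capU U s `<=` capU U (s \o lift j).
Proof. by move=> y ys i; exact: ys. Qed.

Definition cdiff (U : cover) p (c : cochain U p) : cochain U p.+1 :=
  fun s => \sum_(j < p.+2) (-1) ^+ j *: res (@capU_face U p s j) (c (s \o lift j)).

Definition is_coboundary (U : cover) p : cochain U p -> Prop :=
  match p with
  | 0%N => fun c => forall s, c s = 0
  | q.+1 => fun c => exists b : cochain U q, forall s, c s = cdiff b s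
  end.

Lemma capU_refines (V U : cover) (VU : refines V U) p (s : 'I_p.+1 -> pts X) :
  capU V s `<=` capU U s.
Proof. by move=> y ys i; exact/VU/ys. Qed.

Definition cres (V U : cover) (VU : refines V U) p (c : cochain U p) :
  cochain V p := fun s => res (@capU_refines V U VU p s) (c s).

Record cech_elt p := CechElt {
  ccov : cover;
  ccoch : cochain ccov p }.

Definition cech_eq p (c c' : cech_elt p) : Prop :=
  exists (W : cover) (WU : refines W (ccov c)) (WU' : refines W (ccov c')),
    is_coboundary (fun s => cres WU (ccoch c) s - cres WU' (ccoch c') s).

Definition cech_add p (c c' : cech_elt p) : cech_elt p :=
  @CechElt p (coverI (ccov c) (ccov c'))
    (fun s => cres (@coverIl (ccov c) (ccov c')) (ccoch c) s +
              cres (@coverIr (ccov c) (ccov c')) (ccoch c') s).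

Definition cech_scale p (a : K) (c : cech_elt p) : cech_elt p :=
  @CechElt p (ccov c) (fun s => @ascale K X K^o F _ a (ccoch c s)).

Definition cohomology (p : nat) : rawspace K := {|
  vcar := cech_elt p;
  vin := fun c : cech_elt p => forall s, cdiff (ccoch c) s = 0;
  veq := @cech_eq p;
  vzero := @CechElt p cover_full (fun=> 0);
  vadd := @cech_add p;
  vscale := @cech_scale p |}.

End Cech.

(** * Functors of isomorphism classes and their tangent spaces *)

(* A functor from local Artinian algebras to sets, presented by the objects
   over A whose isomorphism classes are its values, and by the relation: the
   second object is obtained from the first by extension of scalars. *)
Record defun (K : fieldType) := Defun {
  dob : artType K -> Type;
  diso : forall A : artType K, dob A -> dob A -> Prop;
  dext : forall A B : artType K, {lrmorphism A -> B} -> dob A -> dob B -> Prop }.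

Section Tangent.
Variables (K : fieldType) (F : defun K).

Definition iso_class (A : artType K) (D : dob F A) : dob F A -> Prop :=
  fun D' => diso D D'.

(* An element of F(A) is an isomorphism class, a predicate on objects. *)
Definition same_class (A : artType K) (C C' : dob F A -> Prop) : Prop :=
  forall D, C D <-> C' D.

Definition fmap (A B : artType K) (phi : {lrmorphism A -> B})
    (C : dob F A -> Prop) : dob F B -> Prop :=
  fun D' => exists D D1, [/\ C D, dext phi D D1 & diso D1 D'].

Definition proj1_mx : 'M[K]_(2, 1) := \col_i (i == 0)%:R.
Definition proj2_mx : 'M[K]_(2, 1) := \col_i (i == 1)%:R.
Definition sum_mx : 'M[K]_(2, 1) := \col_i 1.

Let tan_car : Type := dob F (sqz_art K 1) -> Prop.

(* The image in F(K[e]) of the only element of F(K). *)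
Definition tan_zero : tan_car :=
  fmap (sqz_mor (0 : 'M[K]_(0, 1))) (fun=> True).

(* F(K[e]) x F(K[e]) <-- F(K[e1,e2]) --> F(K[e]), where the left map, which is
   bijective for the functors considered, is induced by the two projections and
   the right one by e1, e2 |-> e. *)
Definition tan_add (C1 C2 : tan_car) : tan_car :=
  fmap (sqz_mor sum_mx)
    (fun D => same_class (fmap (sqz_mor proj1_mx) (iso_class D)) C1 /\
              same_class (fmap (sqz_mor proj2_mx) (iso_class D)) C2).

(* Induced by e |-> a e. *)
Definition tan_scale (a : K) (C : tan_car) : tan_car := fmap (sqz_mor a%:M) C.

Definition tangent : rawspace K := {|
  vcar := tan_car;
  vin := fun C => exists D, same_class C (iso_class D);
  veq := @same_class (sqz_art K 1);
  vzero := tan_zero;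
  vadd := tan_add;
  vscale := tan_scale |}.

End Tangent.

(** * Deformations of a sheaf, and of a sheaf with a space of sections *)

Section Deformations.
Variables (K : fieldType) (X : projvar K) (E : opsh X K^o).

Record deformation (A : artType K) := Deformation {
  dsh : opsh X A;
  dsheaf : is_sheaf dsh;
  dfree : locally_free dsh;
  dpi : omor (aug A) dsh E;
  dred : is_base_change dpi }.

(* [f] is an isomorphism of deformations. *)
Definition is_def_iso (A : artType K) (D D' : deformation A)
    (f : omor_lin (dsh D) (dsh D')) : Prop :=
  (forall U, bijective (f U)) /\ forall U s, dpi D' U (f U s) = dpi D U s.

(* [theta] makes [D'] the extension of scalars of [D] along [phi]. *)
Definition is_def_ext (A B : artType K) (phi : {lrmorphism A -> B})
    (D : deformation A) (D' : deformation B)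
    (theta : omor phi (dsh D) (dsh D')) : Prop :=
  is_base_change theta /\ forall U s, dpi D' U (theta U s) = dpi D U s.

Definition Def : defun K := {|
  dob := deformation;
  diso := fun A D D' => exists f, @is_def_iso A D D' f;
  dext := fun A B phi D D' => exists theta, @is_def_ext A B phi D D' theta |}.

(* The space U of sections and its embedding in H^0(X, E). *)
Variables (U : vectType K) (i : U -> gsec E).

(* U (x) A, written in coordinates over the A-basis u_j (x) 1, where (u_j) is the
   basis [vbasis fullv] of U. *)
Definition tensU (A : pzRingType) := 'rV[A]_(\dim {:U}).

Definition tensU_red (A : artType K) (w : tensU A) : U :=
  \sum_j aug A (w 0 j) *: (vbasis {:U})`_j.

Record pair_deformation (A : artType K) := PairDeformation {
  pd_def :> deformation A;
  pd_i : tensU A -> gsec (dsh pd_def);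
  pd_iD : forall v w, pd_i (v + w) = pd_i v + pd_i w;
  pd_iZ : forall a w, pd_i (a *: w) = ascale a (pd_i w);
  pd_red : forall w, dpi pd_def _ (pd_i w) = i (tensU_red w) }.

Definition PairDef : defun K := {|
  dob := pair_deformation;
  diso := fun A D D' => exists (f : omor_lin (dsh D) (dsh D'))
      (psi : {linear tensU A -> tensU A}),
    [/\ is_def_iso f, bijective psi
      & forall w, f _ (pd_i D w) = pd_i D' (psi w)];
  dext := fun A B phi D D' => exists theta : omor phi (dsh D) (dsh D'),
    is_def_ext theta /\
    forall w, theta _ (pd_i D w) = pd_i D' (map_mx phi w) |}.

End Deformations.

(* Main.v *)
(* Over A = K (+) K^r a deformation of E is, locally on X, the trivial one, so it is
   glued from a Cech 1-cocycle g = (g_xy) with values in Hom(E, E)^r; extension of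
   scalars along a linear map K^r -> K^s multiplies g by its matrix.  A section u of
   E lifts to the deformation given by g exactly when the class of (g_xy u) in
   H^1(X, E)^r vanishes.  Hence the image of t_Def(E,U) -> t_Def(E) is the kernel of
   a linear map t_Def(E) -> Hom(U, H^1(X, E)), which gives the inequality.

   The dimension of t_Def(E) is bounded through its finite independent families,
   so no finiteness of cohomology is needed: if t_Def(E,U) or, for m > 0, H^1(X, E)
   is infinite-dimensional, the inequality holds by the conventions in \bar int. *)
From HB Require Import structures.
From mathcomp Require Import all_boot all_order all_algebra.
From mathcomp Require Import boolp classical_sets.
From mathcomp Require Import topology_structure constructive_ereal.
Require Import Defs.

Set Implicit Arguments.
Unset Strict Implicit.
Unset Printing Implicit Defensive.
Import GRing.Theory.
Local Open Scope classical_set_scope.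
Local Open Scope ring_scope.

(** * Sheaves of modules and base change *)

(** The operations of [tangent] act on predicates and come without any vector space laws, and
    extension of scalars is known only through a universal property. Linear algebra is therefore
    carried by matrices: one deformation over K (+) K^r stands for r tangent vectors, and its
    extension along a column c for their combination with coefficients c. This works because
    extensions along matrices exist, are unique up to isomorphism and compose, and because
    deformations over K (+) K^r amount to r-tuples of deformations over K[e]. Uniqueness is formal;
    the rest is read off cocycles. For pairs no such calculus is set up: it suffices that forgetting
    the sections sends a member of a raw linear combination to a member of the corresponding one in
    t_Def(E). To reach cocycles from the universal property, one tests it on suitable sheaves. The
    sheaf of locally liftable sections of E gives surjectivity of the reduction D -> E, and D
    itself, regarded as an O_X-module, leads to the identification of the kernel with E^r. *)

Section Sheaves.
Variables (K : fieldType) (X : projvar K).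
Notation open := (opens (pts X)).

Lemma opensIl (V W : open) : opensI V W `<=` V.
Proof. by move=> x []. Qed.

Lemma opensIr (V W : open) : opensI V W `<=` W.
Proof. by move=> x []. Qed.

Section OneModule.
Variables (A : comAlgType K) (M : opsh X A).

Lemma res0 (U V : open) (VU : V `<=` U) : res VU (0 : M U) = 0.
Proof. by apply: (addrI (res VU 0)); rewrite -resD !addr0. Qed.

Lemma resN (U V : open) (VU : V `<=` U) (s : M U) : res VU (- s) = - res VU s.
Proof. by apply/eqP; rewrite -addr_eq0 -resD addNr res0. Qed.

Lemma resB (U V : open) (VU : V `<=` U) (s t : M U) :
  res VU (s - t) = res VU s - res VU t.
Proof. by rewrite resD resN. Qed.

Lemma res_sum (U V : open) (VU : V `<=` U) I (r : seq I) (P : pred I) (F : I -> M U) :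
  res VU (\sum_(i <- r | P i) F i) = \sum_(i <- r | P i) res VU (F i).
Proof. exact: (big_morph _ (resD VU) (res0 VU)). Qed.

Lemma resK (U V W : open) (VU : V `<=` U) (WV : W `<=` V) (s : M U) :
  res WV (res VU s) = res (subset_trans WV VU) s.
Proof. exact: res_comp. Qed.

Lemma res_irr (U V : open) (VU VU' : V `<=` U) (s : M U) : res VU s = res VU' s.
Proof. by rewrite (Prop_irrelevance VU VU'). Qed.

(** No cover is chosen: the family is indexed by all pairs of an open subset of U and a section
    there satisfying [R]. Stability under restriction and uniqueness make it compatible. *)
Lemma sheaf_glue (sM : is_sheaf M) (U : open) (R : forall V : open, M V -> Prop) :
  (forall (V V' : open) (V'V : V' `<=` V) t, R V t -> R V' (res V'V t)) ->
  (forall (V : open) (t t' : M V), V `<=` U -> R V t -> R V t' -> t = t') ->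
  (forall x, oset U x -> exists V : open, [/\ oset V x, V `<=` U & exists t, R V t]) ->
  exists T : M U, forall (V : open) (VU : V `<=` U) (t : M V), R V t -> res VU T = t.
Proof.
move=> Rres Runi Rex.
pose I := {V : open & {t : M V | R V t /\ V `<=` U}}.
pose W (i : I) := projT1 i.
have WU (i : I) : W i `<=` U by case: i => V [t []].
have UE : oset U = \bigcup_i oset (W i).
  apply/seteqP; split=> [x Ux|x [i _ /WU //]].
  have [V [Vx VU [t Rt]]] := Rex x Ux.
  by exists (existT _ V (exist _ t (conj Rt VU))).
have [_ glue] := sM I U W WU UE.
have [|T TE] := glue (fun i => sval (projT2 i)).
  move=> [V [t [Rt VU]]] [V' [t' [Rt' VU']]] /=.
  apply: Runi; [by move=> y [/VU]|exact: Rres|exact: Rres].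
exists T => V VU t Rt.
have /= <- := TE (existT _ V (exist _ t (conj Rt VU))); exact: res_irr.
Qed.

Lemma sheaf_eq (sM : is_sheaf M) (U : open) (s t : M U) :
  (forall x, oset U x -> exists (V : open) (VU : V `<=` U),
     oset V x /\ res VU s = res VU t) -> s = t.
Proof.
move=> st.
pose I := {V : open | exists VU : V `<=` U, res VU s = res VU t}.
have WU (i : I) : sval i `<=` U by case: i => V [].
have UE : oset U = \bigcup_i oset (sval (i : I)).
  apply/seteqP; split=> [x Ux|x [i _ /WU //]].
  have [V [VU [Vx e]]] := st x Ux.
  by exists (exist _ V (ex_intro _ VU e)).
have [sep _] := sM I U _ WU UE.
apply: sep => -[V /= [VU e]]; rewrite (res_irr _ VU) e; exact: res_irr.
Qed.

End OneModule.

Section Morphisms.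
Variables (A B : comAlgType K) (phi : {lrmorphism A -> B}).
Variables (M : opsh X A) (N : opsh X B) (f : omor phi M N).

Lemma ofun0 U : f U 0 = 0.
Proof. by apply: (addrI (f U 0)); rewrite -ofunD !addr0. Qed.

Lemma ofunN U s : f U (- s) = - f U s.
Proof. by apply/eqP; rewrite -addr_eq0 -ofunD addNr ofun0. Qed.

Lemma ofunB U s t : f U (s - t) = f U s - f U t.
Proof. by rewrite ofunD ofunN. Qed.

Lemma ofun_sum U I (r : seq I) (P : pred I) (F : I -> M U) :
  f U (\sum_(i <- r | P i) F i) = \sum_(i <- r | P i) f U (F i).
Proof. exact: (big_morph _ (@ofunD _ _ _ _ _ _ _ f U) (ofun0 U)). Qed.

End Morphisms.

End Sheaves.
Arguments opensIl {K X} V W [t] _.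
Arguments opensIr {K X} V W [t] _.

Section PushA.
Variables (K : fieldType) (X : projvar K).
Notation open := (opens (pts X)).

Lemma OA_eq (A : comAlgType K) (U : open) (f g : @OA K X A U) :
  val f =1 val g -> f = g.
Proof. by move=> fg; apply: val_inj; apply/funext. Qed.

Lemma OA_addE (A : comAlgType K) (U : open) (f g : @OA K X A U) x :
  val (f + g) x = val f x + val g x.
Proof. by []. Qed.

Lemma OA_mulE (A : comAlgType K) (U : open) (f g : @OA K X A U) x :
  val (f * g) x = val f x * val g x.
Proof. by []. Qed.

Variables (A B C : comAlgType K) (phi : {lrmorphism A -> B}).

Lemma pushAD (U : open) : {morph @pushA K X A B phi U : f g / f + g}.
Proof. by move=> f g; apply: OA_eq => x /=; rewrite raddfD. Qed.

Lemma pushAM (U : open) : {morph @pushA K X A B phi U : f g / f * g}.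
Proof. by move=> f g; apply: OA_eq => x /=; rewrite rmorphM. Qed.

Lemma pushA0 (U : open) : @pushA K X A B phi U 0 = 0.
Proof. by apply: OA_eq => x /=; rewrite raddf0. Qed.

Lemma pushA1 (U : open) : @pushA K X A B phi U 1 = 1.
Proof. by apply: OA_eq => x /=; rewrite rmorph1. Qed.

Lemma pushA_sum (U : open) I (r : seq I) (P : pred I) (F : I -> @OA K X A U) :
  pushA phi (\sum_(i <- r | P i) F i) = \sum_(i <- r | P i) pushA phi (F i).
Proof. exact: (big_morph _ (@pushAD U) (pushA0 U)). Qed.

Lemma pushA_res (U V : open) (VU : V `<=` U) (f : OA A U) :
  pushA phi (resA VU f) = resA VU (pushA phi f).
Proof. exact: OA_eq. Qed.

Lemma pushA_cst (U : open) (a : A) : pushA phi (@cst K X A U a) = cst U (phi a).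
Proof. exact: OA_eq. Qed.

Lemma pushA_comp (psi : {lrmorphism B -> C}) (chi : {lrmorphism A -> C})
    (chiE : forall a, chi a = psi (phi a)) (U : open) (f : @OA K X A U) :
  pushA chi f = pushA psi (pushA phi f).
Proof. by apply: OA_eq => x /=; rewrite chiE. Qed.

Lemma pushA_id (idA : {lrmorphism A -> A}) (idE : forall a, idA a = a)
    (U : open) (f : @OA K X A U) : pushA idA f = f.
Proof. by apply: OA_eq => x /=; rewrite idE. Qed.

Lemma resA_cst (U V : open) (VU : V `<=` U) (a : A) : resA VU (cst U a) = cst V a.
Proof. exact: OA_eq. Qed.

Lemma cstD (U : open) (a b : A) : @cst K X A U (a + b) = cst U a + cst U b.
Proof. exact: OA_eq. Qed.

Lemma cstM (U : open) (a b : A) : @cst K X A U (a * b) = cst U a * cst U b.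
Proof. exact: OA_eq. Qed.

Lemma cst0 (U : open) : @cst K X A U 0 = 0.
Proof. exact: OA_eq. Qed.

Lemma cst1 (U : open) : @cst K X A U 1 = 1.
Proof. exact: OA_eq. Qed.

Lemma resA_ring (U V : open) (VU : V `<=` U) :
  (forall f g, resA VU (f + g) = resA VU f + resA VU g :> OA A V) *
  (forall f g, resA VU (f * g) = resA VU f * resA VU g :> OA A V) *
  (resA VU 0 = 0 :> OA A V) * (resA VU 1 = 1 :> OA A V).
Proof. by do ! split; move=> *; exact: OA_eq. Qed.

End PushA.

Section Composition.
Variables (K : fieldType) (X : projvar K) (A B C : comAlgType K).
Variables (phi : {lrmorphism A -> B}) (psi : {lrmorphism B -> C}).
Variables (chi : {lrmorphism A -> C}) (chiE : forall a, chi a = psi (phi a)).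
Variables (M : opsh X A) (N : opsh X B) (P : opsh X C).
Variables (g : omor psi N P) (f : omor phi M N).

Definition ocomp_fun U (s : M U) : P U := g U (f U s).

Lemma ocomp_funD U s t : ocomp_fun (s + t : M U) = ocomp_fun s + ocomp_fun t.
Proof. by rewrite /ocomp_fun !ofunD. Qed.

Lemma ocomp_funZ U (a : OA A U) s :
  ocomp_fun (a *: s : M U) = pushA chi a *: ocomp_fun s.
Proof. by rewrite /ocomp_fun !ofunZ -(pushA_comp chiE). Qed.

Lemma ocomp_fun_res (U V : opens (pts X)) (VU : V `<=` U) (s : M U) :
  ocomp_fun (res VU s) = res VU (ocomp_fun s).
Proof. by rewrite /ocomp_fun !ofun_res. Qed.

Definition ocomp : omor chi M P := Omor ocomp_funD ocomp_funZ ocomp_fun_res.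

End Composition.

Section Linear.
Variables (K : fieldType) (X : projvar K) (A : comAlgType K).

Lemma omor_linZ (M N : opsh X A) (f : omor_lin M N) U (a : OA A U) (s : M U) :
  f U (a *: s) = a *: f U s.
Proof. by rewrite ofunZ pushA_id. Qed.

Definition omor_lin_of (M N : opsh X A) (f : forall U, M U -> N U)
    (fD : forall U s t, f U (s + t) = f U s + f U t)
    (fZ : forall U (a : OA A U) s, f U (a *: s) = a *: f U s)
    (fr : forall (U V : opens (pts X)) (VU : V `<=` U) (s : M U),
      f V (res VU s) = res VU (f U s)) : omor_lin M N.
Proof.
by exists f => // U a s; rewrite fZ pushA_id.
Defined.

Definition oid (M : opsh X A) : omor_lin M M.
Proof. by apply: (@omor_lin_of M M (fun U s => s)). Defined.

Lemma omor_lin_inv (M N : opsh X A) (f : omor_lin M N) :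
  (forall U, bijective (f U)) ->
  exists g : omor_lin N M, forall U, cancel (f U) (g U) /\ cancel (g U) (f U).
Proof.
move=> bf.
have exg (U : opens (pts X)) : exists g, cancel (f U) g /\ cancel g (f U).
  by have [g] := bf U; exists g.
pose g U := sval (cid (exg U)).
have gE U : cancel (f U) (g U) /\ cancel (g U) (f U) by exact: svalP (cid (exg U)).
have fI U : injective (f U) by exact: bij_inj.
have gD U s t : g U (s + t) = g U s + g U t.
  by apply: (fI); rewrite ofunD !(gE U).2.
have gZ U (a : OA A U) s : g U (a *: s) = a *: g U s.
  by apply: (fI); rewrite omor_linZ !(gE U).2.
have gr (U V : opens (pts X)) (VU : V `<=` U) s : g V (res VU s) = res VU (g U s).
  by apply: (fI); rewrite ofun_res (gE U).2 (gE V).2.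
by exists (omor_lin_of gD gZ gr).
Qed.

End Linear.

(** * Recognizing base changes locally *)

Section BaseChange.
Variables (K : fieldType) (X : projvar K) (A B : comAlgType K).
Variable phi : {lrmorphism A -> B}.
Notation open := (opens (pts X)).

Section Criterion.
Variables (M : opsh X A) (N : opsh X B) (theta : omor phi M N).

Hypothesis gen : forall (U : open) (s : N U) x, oset U x ->
  exists (V : open) (VU : V `<=` U), oset V x /\
    exists zs : seq (OA B V * M V), res VU s = \sum_(z <- zs) z.1 *: theta V z.2.

(** Relations are tested in every sheaf [P] that receives M, so that no tensor product sheaf has to
    be constructed. *)
Hypothesis rel : forall (P : opsh X B) (g : omor phi M P) (U : open)
    (zs : seq (OA B U * M U)), is_sheaf P ->
  \sum_(z <- zs) z.1 *: theta U z.2 = 0 -> \sum_(z <- zs) z.1 *: g U z.2 = 0.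

(* A morphism out of N is determined by its values on the image of theta, is
   defined locally by linear combinations of them, and glues. *)
Lemma base_change_of_presentation : is_base_change theta.
Proof.
move=> P g sP.
(* The graph of the desired morphism on combinations of values of [theta]; [rel] makes it
   single-valued. *)
pose R (V : open) s p := exists zs : seq (OA B V * M V),
  s = \sum_(z <- zs) z.1 *: theta V z.2 /\ p = \sum_(z <- zs) z.1 *: g V z.2.
have RD V s p s' p' : R V s p -> R V s' p' -> R V (s + s') (p + p').
  by move=> [zs [-> ->]] [zs' [-> ->]]; exists (zs ++ zs'); rewrite !big_cat.
have RZ V a s p : R V s p -> R V (a *: s) (a *: p).
  move=> [zs [-> ->]]; exists [seq (a * z.1, z.2) | z <- zs].
  by rewrite !big_map !scaler_sumr; split; apply: eq_bigr => z _; rewrite scalerA.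
have Rfun V s p p' : R V s p -> R V s p' -> p = p'.
  move=> Rp /(RZ _ (-1)) /(RD _ _ _ _ _ Rp).
  rewrite !scaleN1r subrr => -[zs [/esym z0 pE]].
  by apply/eqP; rewrite -subr_eq0 pE (rel _ sP z0).
have Rres (V V' : open) (V'V : V' `<=` V) s p : R V s p -> R V' (res V'V s) (res V'V p).
  move=> [zs [-> ->]]; exists [seq (resA V'V z.1, res V'V z.2) | z <- zs].
  by rewrite !big_map !res_sum; split; apply: eq_bigr => z _; rewrite resZ ofun_res.
pose H (U : open) (s : N U) p := forall (V : open) (VU : V `<=` U) q,
  R V (res VU s) q -> res VU p = q.
have exH U (s : N U) : exists p, H U s p.
  have [||x Ux|p pE] := @sheaf_glue _ _ _ P sP U
      (fun V q => exists VU : V `<=` U, R V (res VU s) q).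
  - move=> V V' V'V q [VU] Rq; exists (subset_trans V'V VU).
    by rewrite -resK; exact: Rres.
  - move=> V q q' VU [VU1 Rq] [VU2]; rewrite (res_irr VU2 VU1); exact: Rfun.
  - have [V [VU [Vx [zs zsE]]]] := gen s Ux.
    by exists V; split => //; exists (\sum_(z <- zs) z.1 *: g V z.2), VU, zs.
  by exists p => V VU q Rq; apply: pE; exists VU.
have unH U (s : N U) p p' : H U s p -> H U s p' -> p = p'.
  move=> Hp Hp'; apply: (sheaf_eq sP) => x Ux.
  have [V [VU [Vx [zs zsE]]]] := gen s Ux; exists V, VU; split => //.
  have Rq : R V (res VU s) (\sum_(z <- zs) z.1 *: g V z.2) by exists zs.
  by rewrite (Hp V VU _ Rq) (Hp' V VU _ Rq).
(* It is enough to know the relation [R] on some neighbourhood of each point. *)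
have locH (U : open) (s : N U) p : (forall x, oset U x ->
    exists (V : open) (VU : V `<=` U), oset V x /\ R V (res VU s) (res VU p)) ->
    H U s p.
  move=> loc V VU q Rq; apply: (sheaf_eq sP) => x Vx.
  have [W [WU [Wx RW]]] := loc x (VU x Vx).
  exists (opensI V W), (opensIl _ _); split=> //.
  have := Rres _ _ (opensIl V W) _ _ Rq.
  apply: Rfun; rewrite !resK !(res_irr (subset_trans (opensIl V W) VU)
    (subset_trans (opensIr V W) WU)) -!(resK WU); exact: Rres.
have Hloc U (s : N U) p x : H U s p -> oset U x ->
    exists (V : open) (VU : V `<=` U), oset V x /\ R V (res VU s) (res VU p).
  move=> Hp Ux; have [V [VU [Vx [zs zsE]]]] := gen s Ux.
  exists V, VU; split=> //.
  have Rq : R V (res VU s) (\sum_(z <- zs) z.1 *: g V z.2) by exists zs.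
  by rewrite (Hp V VU _ Rq).
pose h U (s : N U) : P U := sval (cid (exH U s)).
have hE U s : H U s (h U s) by exact: svalP.
have hD U s t : h U (s + t) = h U s + h U t.
  apply: (unH _ (s + t)) (hE _ _) _; apply: locH => x Ux.
  have [V [VU [Vx RV]]] := Hloc _ _ _ x (hE U s) Ux.
  have [W [WU [Wx RW]]] := Hloc _ _ _ x (hE U t) Ux.
  exists (opensI V W), (subset_trans (opensIl V W) VU); split => //.
  rewrite !resD; apply: RD.
    by rewrite -!(resK VU); exact: Rres.
  rewrite !(res_irr (subset_trans (opensIl V W) VU)
    (subset_trans (opensIr V W) WU)) -!(resK WU); exact: Rres.
have hZ U (a : OA B U) s : h U (a *: s) = a *: h U s.
  apply: (unH _ (a *: s)) (hE _ _) _; apply: locH => x Ux.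
  have [V [VU [Vx RV]]] := Hloc _ _ _ x (hE U s) Ux.
  by exists V, VU; split => //; rewrite !resZ; exact: RZ.
have hr (U V : open) (VU : V `<=` U) (s : N U) : h V (res VU s) = res VU (h U s).
  apply: (unH _ (res VU s)) (hE _ _) _; apply: locH => x Vx.
  have [W [WU [Wx RW]]] := Hloc _ _ _ x (hE U s) (VU x Vx).
  exists (opensI V W), (opensIl _ _); split => //.
  by rewrite !resK !(res_irr (subset_trans (opensIl V W) VU)
    (subset_trans (opensIr V W) WU)) -!(resK WU); exact: Rres.
exists (omor_lin_of hD hZ hr); split=> [U s|h' h'E U s] /=.
  apply: (unH _ (theta U s)) (hE _ _) _ => V VU q Rq.
  apply: Rfun Rq; exists [:: (1, res VU s)].
  by rewrite !big_seq1 !scale1r !ofun_res.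
apply: (unH _ s) _ (hE U s) => V VU _ [zs [sE ->]].
rewrite -ofun_res sE ofun_sum; apply: eq_bigr => z _.
by rewrite omor_linZ h'E.
Qed.

End Criterion.

Definition local_basis (C : comAlgType K) (M : opsh X C) (W : open) n
    (e : 'I_n -> M W) : Prop :=
  forall (V : open) (VW : V `<=` W) (s : M V),
    exists! c : {ffun 'I_n -> OA C V}, s = \sum_i c i *: res VW (e i).

(** Expanding sections of M in the basis [e] turns a relation among values of [theta] into one in
    the basis [theta W (e i)], so its coefficients vanish. The same coefficients express the
    corresponding sum for any other morphism along [phi]. *)
Lemma base_change_of_basis (M : opsh X A) (N : opsh X B) (theta : omor phi M N) :
  (forall x : pts X, exists (W : open) n (e : 'I_n -> M W), [/\ oset W x,
     local_basis e & local_basis (fun i => theta W (e i))]) ->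
  is_base_change theta.
Proof.
move=> bas; apply: base_change_of_presentation.
  move=> U s x Ux; have [W [n [e [Wx be bte]]]] := bas x.
  exists (opensI U W), (opensIl _ _); split => //.
  have [c [cE _]] := bte _ (opensIr _ _) (res (opensIl U W) s).
  exists [seq (c i, res (opensIr U W) (e i)) | i <- enum 'I_n].
  by rewrite cE big_map big_enum /=; apply: eq_bigr => i _; rewrite ofun_res.
move=> P g U zs sP z0; apply: (sheaf_eq sP) => x Ux.
have [W [n [e [Wx be bte]]]] := bas x.
pose V := opensI U W; have VU : V `<=` U := opensIl _ _.
have VW : V `<=` W := opensIr _ _.
exists V, VU; split => //; rewrite res0 res_sum.
have /choice[c cE] (z : OA B U * M U) : exists c : {ffun 'I_n -> OA A V},
    res VU z.2 = \sum_i c i *: res VW (e i).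
  by have [c [cE _]] := be V VW (res VU z.2); exists c.
have key Q (f : omor phi M Q) : \sum_(z <- zs) res VU (z.1 *: f U z.2) =
    \sum_i (\sum_(z <- zs) resA VU z.1 * pushA phi (c z i)) *: res VW (f W (e i)).
  under [RHS]eq_bigr do rewrite scaler_suml; rewrite exchange_big /=.
  apply: eq_bigr => z _; rewrite resZ -ofun_res cE ofun_sum scaler_sumr.
  by apply: eq_bigr => i _; rewrite ofunZ scalerA ofun_res.
rewrite key; apply: big1 => i _.
have /= := key _ theta; rewrite -res_sum z0 res0 => e0.
have [d [_ dU]] := bte V VW 0.
have dE : d = [ffun i => \sum_(z <- zs) resA VU z.1 * pushA phi (c z i)].
  by apply: dU; rewrite {1}e0; apply: eq_bigr => j _; rewrite ffunE.
have d0 : d = [ffun=> 0].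
  by apply: dU; rewrite big1 // => j _; rewrite ffunE scale0r.
by move: dE; rewrite d0 => /ffunP /(_ i); rewrite !ffunE => <-; rewrite scale0r.
Qed.

Lemma base_change_unique (M : opsh X A) (N N' : opsh X B)
    (t : omor phi M N) (t' : omor phi M N') :
  is_sheaf N -> is_sheaf N' -> is_base_change t -> is_base_change t' ->
  exists f : omor_lin N N', (forall U, bijective (f U)) /\
    forall U s, f U (t U s) = t' U s.
Proof.
move=> sN sN' bt bt'.
have [f [fE _]] := bt N' t' sN'; have [f' [f'E _]] := bt' N t sN.
have idE (b : B) : (idfun : {lrmorphism B -> B}) b =
  (idfun : {lrmorphism B -> B}) ((idfun : {lrmorphism B -> B}) b) by [].
exists f; split=> // U; exists (f' U) => s.
  have [h [_ hU]] := bt N t sN.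
  rewrite -[LHS]/(ocomp idE f' f U s) (hU (ocomp idE f' f)).
    by rewrite -(hU (oid N)).
  by move=> V p /=; rewrite /ocomp_fun fE f'E.
have [h [_ hU]] := bt' N' t' sN'.
rewrite -[LHS]/(ocomp idE f f' U s) (hU (ocomp idE f f')).
  by rewrite -(hU (oid N')).
by move=> V p /=; rewrite /ocomp_fun f'E fE.
Qed.

End BaseChange.

(** * Functions with values in K (+) K^r *)

Section Coefficients.
Variables (K : fieldType) (X : projvar K) (r : nat).
Notation open := (opens (pts X)).
Notation O := (@OA K X K^o).
Notation A := (sqz_art K r).
Notation OAr := (@OA K X A).

Lemma sqz_eq (a b : sqz K r) : a.1 = b.1 -> a.2 = b.2 -> a = b.
Proof. by case: a b => [a u] [b v] /= -> ->. Qed.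

Lemma sqz_mulE (a b : sqz K r) :
  ((a * b).1 = a.1 * b.1) * ((a * b).2 = a.1 *: b.2 + b.1 *: a.2).
Proof. by []. Qed.

Definition coef0 (U : open) (f : OAr U) : O U := pushA (aug A) f.

Lemma coef_subproof (U : open) (k : 'I_r) (f : OAr U) :
  @regularA K X K^o U (fun x => (val f x).2 0 k).
Proof.
have /asboolP[n [g [a [rg fE]]]] := valP f; apply/asboolP.
exists n, g, (fun i => (a i).2 0 k); split=> // x.
rewrite fE (raddf_sum snd) /= summxE; apply: eq_bigr => i _; exact: mxE.
Qed.

Definition coef (U : open) (k : 'I_r) (f : OAr U) : O U := Sub _ (coef_subproof k f).

Lemma val_coef (U : open) (k : 'I_r) (f : OAr U) x : val (coef k f) x = (val f x).2 0 k.
Proof. by []. Qed.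

Lemma val_coef0 (U : open) (f : OAr U) x : val (coef0 f) x = (val f x).1.
Proof. by []. Qed.

Definition sqz_const (a : K^o) : sqz K r := (a, 0).

Lemma sqz_const_is_linear : linear sqz_const.
Proof. by move=> k a b; apply: sqz_eq => //=; rewrite scaler0 addr0. Qed.

Lemma sqz_const_is_monoid_morphism : monoid_morphism sqz_const.
Proof.
split=> // a b; apply: sqz_eq; rewrite sqz_mulE //=.
by rewrite !scaler0 addr0.
Qed.

HB.instance Definition _ := GRing.isLinear.Build K K^o (sqz K r) *:%R
  sqz_const sqz_const_is_linear.
HB.instance Definition _ := GRing.isMonoidMorphism.Build K^o (sqz K r)
  sqz_const sqz_const_is_monoid_morphism.

Definition const_mor : {lrmorphism K^o -> sqz_art K r} := sqz_const.

Definition const_ext (U : open) (f : O U) : OAr U := pushA const_mor f.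

Definition eps (k : 'I_r) : A := (0, delta_mx 0 k).

Lemma coef0D U (f g : OAr U) : coef0 (f + g) = coef0 f + coef0 g.
Proof. exact: pushAD. Qed.

Lemma coef0M U (f g : OAr U) : coef0 (f * g) = coef0 f * coef0 g.
Proof. exact: pushAM. Qed.

Lemma coef01 U : coef0 (1 : OAr U) = 1.
Proof. exact: pushA1. Qed.

Lemma coef0_res (U V : open) (VU : V `<=` U) (f : OAr U) :
  coef0 (resA VU f) = resA VU (coef0 f).
Proof. exact: OA_eq. Qed.

Lemma coefD U k (f g : OAr U) : coef k (f + g) = coef k f + coef k g.
Proof. by apply: OA_eq => x /=; rewrite mxE. Qed.

Lemma coefM U k (f g : OAr U) :
  coef k (f * g) = coef0 f * coef k g + coef0 g * coef k f.
Proof.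
by apply: OA_eq => x; rewrite OA_addE !OA_mulE !val_coef !val_coef0 OA_mulE sqz_mulE !mxE.
Qed.

Lemma coef1 U k : coef k (1 : OAr U) = 0.
Proof. by apply: OA_eq => x /=; rewrite mxE. Qed.

Lemma coef_res (U V : open) (VU : V `<=` U) k (f : OAr U) :
  coef k (resA VU f) = resA VU (coef k f).
Proof. exact: OA_eq. Qed.

Lemma coef_eq U (f g : OAr U) : coef0 f = coef0 g ->
  (forall k, coef k f = coef k g) -> f = g.
Proof.
move=> fg0 fgk; apply: OA_eq => x; apply: sqz_eq.
  by have /(congr1 (fun h => val h x)) := fg0.
by apply/rowP => k; have /(congr1 (fun h => val h x)) := fgk k.
Qed.

Lemma const_extD U (f g : O U) : const_ext (f + g) = const_ext f + const_ext g.
Proof. exact: pushAD. Qed.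

Lemma const_extM U (f g : O U) : const_ext (f * g) = const_ext f * const_ext g.
Proof. exact: pushAM. Qed.

Lemma const_ext1 U : const_ext (1 : O U) = 1.
Proof. exact: pushA1. Qed.

Lemma const_ext_res (U V : open) (VU : V `<=` U) (f : O U) :
  const_ext (resA VU f) = resA VU (const_ext f).
Proof. exact: OA_eq. Qed.

Lemma coef0_const U (f : O U) : coef0 (const_ext f) = f.
Proof. exact: OA_eq. Qed.

Lemma coef_const U k (f : O U) : coef k (const_ext f) = 0.
Proof. by apply: OA_eq => x /=; rewrite mxE. Qed.

Lemma coef0_sum U I (s : seq I) (P : pred I) (F : I -> OAr U) :
  coef0 (\sum_(i <- s | P i) F i) = \sum_(i <- s | P i) coef0 (F i).
Proof. exact: pushA_sum. Qed.

Lemma coef_sum U k I (s : seq I) (P : pred I) (F : I -> OAr U) :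
  coef k (\sum_(i <- s | P i) F i) = \sum_(i <- s | P i) coef k (F i).
Proof.
apply: (big_morph (coef k)) => [f g|]; first exact: coefD.
by apply: OA_eq => x /=; rewrite mxE.
Qed.

Lemma coef0_eps U k : coef0 (cst U (eps k)) = 0.
Proof. exact: OA_eq. Qed.

Lemma coef_eps U k l : coef l (cst U (eps k)) = (k == l)%:R.
Proof.
apply: OA_eq => x /=; rewrite mxE eqxx /= eq_sym.
by case: (k == l).
Qed.

Lemma coef_decomp U (f : OAr U) :
  f = const_ext (coef0 f) + \sum_k cst U (eps k) * const_ext (coef k f).
Proof.
apply: coef_eq => [|l].
  rewrite coef0D coef0_sum coef0_const big1 ?addr0 // => k _.
  by rewrite coef0M coef0_eps mul0r.
rewrite coefD coef_const add0r coef_sum (bigD1 l) //= big1 => [|k kl].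
  by rewrite coefM coef0_eps mul0r add0r coef0_const coef_eps eqxx mulr1 addr0.
by rewrite coefM coef0_eps mul0r add0r coef_eps (negPf kl) mulr0.
Qed.

(** The maximal ideal has square zero, so multiplication by [eps k] sees only residues. *)
Lemma eps_mul U k (f : OAr U) :
  cst U (eps k) * f = cst U (eps k) * const_ext (coef0 f).
Proof.
apply: coef_eq => [|l]; first by rewrite !coef0M coef0_const.
by rewrite !coefM coef0_eps !mul0r !add0r coef0_const.
Qed.

End Coefficients.

Section CoefficientMap.
Variables (K : fieldType) (X : projvar K) (r s : nat) (M : 'M[K]_(r, s)).

Lemma coef0_map (U : opens (pts X)) (f : OA (sqz_art K r) U) :
  coef0 (pushA (sqz_mor M) f) = coef0 f.
Proof. exact: OA_eq. Qed.

Lemma coef_map (U : opens (pts X)) (f : OA (sqz_art K r) U) l :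
  coef l (pushA (sqz_mor M) f) = \sum_k @cst K X K^o U (M k l) * coef k f.
Proof.
apply: OA_eq => x /=; rewrite mxE.
have valS (I : Type) (e : seq I) (F : I -> @OA K X K^o U) :
    val (\sum_(i <- e) F i) x = \sum_(i <- e) val (F i) x.
  exact: (big_morph (fun f : @OA K X K^o U => val f x)).
by rewrite valS; apply: eq_bigr => k _; rewrite mulrC.
Qed.

End CoefficientMap.

(** * Deformations glued from cocycles *)

Section Cocycles.
Variables (K : fieldType) (X : projvar K) (E : opsh X K^o) (W : cover X) (r : nat).
Notation open := (opens (pts X)).
Notation O := (@OA K X K^o).

(* A Cech 1-cocycle with values in the sheaf Hom(E, E^r). *)
Record cocycle := Cocycle {
  cc : forall (x y : pts X) (V : open), V `<=` W x -> V `<=` W y -> 'I_r -> E V -> E V;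
  ccL : forall x y (V : open) (hx : V `<=` W x) (hy : V `<=` W y) k (f : O V) s t,
    cc hx hy k (f *: s + t) = f *: cc hx hy k s + cc hx hy k t;
  cc_res : forall x y (V V' : open) (hx : V `<=` W x) (hy : V `<=` W y) (VV : V' `<=` V)
    (hx' : V' `<=` W x) (hy' : V' `<=` W y) k s,
    res VV (cc hx hy k s) = cc hx' hy' k (res VV s);
  ccC : forall x y z (V : open) (hx : V `<=` W x) (hy : V `<=` W y) (hz : V `<=` W z) k s,
    cc hx hy k s + cc hy hz k s = cc hx hz k s }.

Variable g : cocycle.

Lemma ccD x y (V : open) (hx : V `<=` W x) (hy : V `<=` W y) k s t :
  cc g hx hy k (s + t) = cc g hx hy k s + cc g hx hy k t.
Proof. by rewrite -{1}[s]scale1r ccL scale1r. Qed.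

Lemma cc0 x y (V : open) (hx : V `<=` W x) (hy : V `<=` W y) k : cc g hx hy k 0 = 0.
Proof. by apply: (addrI (cc g hx hy k 0)); rewrite -ccD !addr0. Qed.

Lemma ccZ x y (V : open) (hx : V `<=` W x) (hy : V `<=` W y) k (f : O V) s :
  cc g hx hy k (f *: s) = f *: cc g hx hy k s.
Proof. by rewrite -[f *: s]addr0 ccL cc0 addr0. Qed.

Lemma ccxx x (V : open) (hx hx' : V `<=` W x) k s : cc g hx hx' k s = 0.
Proof.
by rewrite (Prop_irrelevance hx' hx); apply: (addrI (cc g hx hx k s)); rewrite ccC addr0.
Qed.

(* The deformation glued from the trivial ones over the W_x: a section s of E
   with, over each W_x, the coordinates t_x of a lift of s. *)
Definition glued_pair (V : open) := (E V * (forall x, 'I_r -> E (opensI V (W x))))%type.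

(** The transition rule $t_x = t_y + g_{xy}(s)$. It is imposed on every [V'] inside both pieces, so
    that iterated intersections never have to be identified. *)
Definition glued_compat (V : open) (p : glued_pair V) := forall x y (V' : open)
  (h : V' `<=` V) (ix : V' `<=` opensI V (W x)) (iy : V' `<=` opensI V (W y))
  (hx : V' `<=` W x) (hy : V' `<=` W y) k,
  res ix (p.2 x k) = res iy (p.2 y k) + cc g hx hy k (res h p.1).

Definition glued_sec (V : open) := {p : glued_pair V | glued_compat p}.

HB.instance Definition _ V := gen_eqMixin (glued_sec V).
HB.instance Definition _ V := gen_choiceMixin (glued_sec V).

Definition gbase V (p : glued_sec V) : E V := (sval p).1.
Definition gloc V (p : glued_sec V) x k : E (opensI V (W x)) := (sval p).2 x k.

Lemma glued_eq V (p q : glued_sec V) : gbase p = gbase q ->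
  (forall x k, gloc p x k = gloc q x k) -> p = q.
Proof.
case: p q => [[s t] c] [[s' t'] c']; rewrite /gbase /gloc /= => ss tt; move: c c'.
rewrite ss (_ : t = t') => [c c'|]; first by rewrite (Prop_irrelevance c c').
by apply: functional_extensionality_dep => x; apply/funext => k.
Qed.

Lemma glocE V (p : glued_sec V) x y (V' : open)
  (h : V' `<=` V) (ix : V' `<=` opensI V (W x)) (iy : V' `<=` opensI V (W y))
  (hx : V' `<=` W x) (hy : V' `<=` W y) k :
  res ix (gloc p x k) = res iy (gloc p y k) + cc g hx hy k (res h (gbase p)).
Proof. exact: (svalP p). Qed.

Section Operations.
Variables (V : open).
Implicit Types (p q : glued_sec V) (f : @OA K X (sqz_art K r) V).

Definition glued_zero : glued_sec V.
Proof.
exists (0, fun x k => 0) => x y V' h ix iy hx hy k /=.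
by rewrite !res0 cc0 addr0.
Defined.

Definition glued_add p q : glued_sec V.
Proof.
exists (gbase p + gbase q, fun x k => gloc p x k + gloc q x k).
move=> x y V' h ix iy hx hy k /=.
by rewrite !resD ccD !(glocE _ h ix iy hx hy) addrACA.
Defined.

Definition glued_opp p : glued_sec V.
Proof.
exists (- gbase p, fun x k => - gloc p x k).
move=> x y V' h ix iy hx hy k /=.
rewrite !resN (glocE _ h ix iy hx hy) opprD; congr (_ + _).
by rewrite -[- res h _]scaleN1r ccZ scaleN1r.
Defined.

(** The product $(f_0+\sum_k f_k\epsilon_k)(s+\sum_k t_k\epsilon_k)$, whose $\epsilon_k$-part is
    $f_0t_k+f_ks$. *)
Definition glued_scale f p : glued_sec V.
Proof.
exists (coef0 f *: gbase p, fun x k => resA (opensIl V (W x)) (coef0 f) *: gloc p x k +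
  resA (opensIl V (W x)) (coef k f) *: res (opensIl V (W x)) (gbase p)).
move=> x y V' h ix iy hx hy k /=.
rewrite !resD !resZ ccZ !(glocE _ h ix iy hx hy) !resK.
rewrite !(res_irr (subset_trans _ _) h).
have rr (a b : open) (ab : b `<=` a) (bV : V' `<=` b) (aV : V' `<=` a) (u : O a) :
    resA bV (resA ab u) = resA aV u.
  by apply: OA_eq => z /=; congr (val u _); exact: val_inj.
by rewrite !(rr _ _ _ _ h) scalerDr addrAC.
Defined.

Lemma glued_addA : associative glued_add.
Proof. by move=> p q q'; apply: glued_eq => [|x k]; exact: addrA. Qed.

Lemma glued_addC : commutative glued_add.
Proof. by move=> p q; apply: glued_eq => [|x k]; exact: addrC. Qed.

Lemma glued_add0 : left_id glued_zero glued_add.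
Proof. by move=> p; apply: glued_eq => [|x k]; exact: add0r. Qed.

Lemma glued_addN : left_inverse glued_zero glued_opp glued_add.
Proof. by move=> p; apply: glued_eq => [|x k]; exact: addNr. Qed.

HB.instance Definition _ := GRing.isZmodule.Build (glued_sec V)
  glued_addA glued_addC glued_add0 glued_addN.

Lemma gbaseD p q : gbase (p + q) = gbase p + gbase q. Proof. by []. Qed.
Lemma glocD p q x k : gloc (p + q) x k = gloc p x k + gloc q x k. Proof. by []. Qed.

Lemma gbase_scale f p : gbase (glued_scale f p) = coef0 f *: gbase p.
Proof. by []. Qed.

Lemma gloc_scale f p x k : gloc (glued_scale f p) x k =
  resA (opensIl V (W x)) (coef0 f) *: gloc p x k +
  resA (opensIl V (W x)) (coef k f) *: res (opensIl V (W x)) (gbase p).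
Proof. by []. Qed.

Lemma glued_scaleA f f' p : glued_scale f (glued_scale f' p) = glued_scale (f * f') p.
Proof.
apply: glued_eq => [|x k]; first by rewrite !gbase_scale scalerA coef0M.
rewrite !gloc_scale gbase_scale coef0M coefM !resA_ring resZ.
rewrite scalerDl scalerDr !scalerA -addrA; congr (_ + (_ + _)).
by rewrite mulrC.
Qed.

Lemma glued_scale1 : left_id 1 glued_scale.
Proof.
move=> p; apply: glued_eq => [|x k]; first by rewrite gbase_scale coef01 scale1r.
by rewrite gloc_scale coef01 coef1 !resA_ring scale1r scale0r addr0.
Qed.

Lemma glued_scaleDr : right_distributive glued_scale +%R.
Proof.
move=> f p q; apply: glued_eq => [|x k].
  by rewrite gbaseD !gbase_scale gbaseD scalerDr.
by rewrite glocD !gloc_scale glocD gbaseD resD !scalerDr addrACA.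
Qed.

Lemma glued_scaleDl p : {morph glued_scale^~ p : f f' / f + f'}.
Proof.
move=> f f'; apply: glued_eq => [|x k].
  by rewrite gbaseD !gbase_scale coef0D scalerDl.
by rewrite glocD !gloc_scale coef0D coefD !resA_ring !scalerDl addrACA.
Qed.

HB.instance Definition _ := GRing.Zmodule_isLmodule.Build
  (@OA K X (sqz_art K r) V) (glued_sec V)
  glued_scaleA glued_scale1 glued_scaleDr glued_scaleDl.

Lemma gbaseZ f p : gbase (f *: p) = coef0 f *: gbase p. Proof. by []. Qed.
Lemma glocZ f p x k : gloc (f *: p) x k =
  resA (opensIl V (W x)) (coef0 f) *: gloc p x k +
  resA (opensIl V (W x)) (coef k f) *: res (opensIl V (W x)) (gbase p).
Proof. by []. Qed.

End Operations.

Lemma opensI_mono (V V' : open) x : V' `<=` V -> opensI V' (W x) `<=` opensI V (W x).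
Proof. by move=> VV y [/VV]. Qed.

Definition glued_res (V V' : open) (VV : V' `<=` V) (p : glued_sec V) : glued_sec V'.
Proof.
exists (res VV (gbase p), fun x k => res (opensI_mono VV) (gloc p x k)).
move=> x y V0 h ix iy hx hy k /=.
rewrite !resK; exact: glocE.
Defined.

Lemma gbase_res (V V' : open) (VV : V' `<=` V) (p : glued_sec V) :
  gbase (glued_res VV p) = res VV (gbase p).
Proof. by []. Qed.

Lemma gloc_res (V V' : open) (VV : V' `<=` V) (p : glued_sec V) x k :
  gloc (glued_res VV p) x k = res (opensI_mono VV) (gloc p x k).
Proof. by []. Qed.

Lemma glued_resD (V V' : open) (VV : V' `<=` V) (p q : glued_sec V) :
  glued_res VV (p + q) = glued_res VV p + glued_res VV q.
Proof.
apply: glued_eq => [|x k]; first by rewrite gbaseD !gbase_res gbaseD resD.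
by rewrite glocD !gloc_res glocD resD.
Qed.

Lemma resA_comp (A : comAlgType K) (U V V' : open) (VU : V `<=` U) (V'V : V' `<=` V)
    (V'U : V' `<=` U) (f : OA A U) : resA V'V (resA VU f) = resA V'U f.
Proof. by apply: OA_eq => z /=; congr (val f _); exact: val_inj. Qed.

Lemma glued_resZ (V V' : open) (VV : V' `<=` V) (f : @OA K X (sqz_art K r) V)
    (p : glued_sec V) :
  glued_res VV (f *: p) = resA VV f *: glued_res VV p.
Proof.
apply: glued_eq => [|x k].
  by rewrite gbase_res !gbaseZ gbase_res resZ coef0_res.
rewrite gloc_res !glocZ gloc_res gbase_res resD !resZ coef0_res coef_res !resK.
rewrite !(resA_comp _ _ (subset_trans (opensI_mono VV) (opensIl _ _))).
by rewrite (res_irr (subset_trans (opensIl V' (W x)) VV)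
  (subset_trans (opensI_mono VV) (opensIl _ _))).
Qed.

Lemma glued_res_id (V : open) (VV : V `<=` V) (p : glued_sec V) : glued_res VV p = p.
Proof.
by apply: glued_eq => [|x k]; rewrite ?gbase_res ?gloc_res res_id.
Qed.

Lemma glued_res_comp (V V' V'' : open) (VV : V' `<=` V) (VV' : V'' `<=` V')
    (VV'' : V'' `<=` V) (p : glued_sec V) :
  glued_res VV' (glued_res VV p) = glued_res VV'' p.
Proof.
by apply: glued_eq => [|x k]; rewrite ?gbase_res ?gloc_res;
  apply: res_comp.
Qed.

Definition glued : opsh X (sqz_art K r) :=
  @Opsh K X (sqz_art K r) glued_sec glued_res glued_resD glued_resZ glued_res_id
    glued_res_comp.

End Cocycles.

Section Coordinates.
Variables (K : fieldType) (X : projvar K) (E : opsh X K^o) (W : cover X) (r : nat).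
Notation open := (opens (pts X)).
Notation O := (@OA K X K^o).
Variable g : cocycle E W r.

Section OnePiece.
Variables (V : open) (x : pts X) (hx : V `<=` W x).

Lemma sub_opensI : V `<=` opensI V (W x).
Proof. by move=> y Vy; split => //; exact: hx. Qed.

(** For V inside [W x], the open sets V and [opensI V (W x)] have the same points but index
    different modules; a restriction passes from one to the other. *)
Definition gcoord k (p : glued g V) : E V := res sub_opensI (gloc p x k).

Lemma gcoordD k p q : gcoord k (p + q) = gcoord k p + gcoord k q.
Proof. by rewrite /gcoord glocD resD. Qed.

Lemma gcoord0 k : gcoord k 0 = 0.
Proof. exact: res0. Qed.

Lemma gcoordZ k (f : @OA K X (sqz_art K r) V) p :
  gcoord k (f *: p) = coef0 f *: gcoord k p + coef k f *: gbase p.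
Proof.
have rr (u : O V) : resA sub_opensI (resA (opensIl V (W x)) u) = u.
  by apply: OA_eq => z /=; congr (val u _); exact: val_inj.
by rewrite /gcoord glocZ resD !resZ !rr resK res_id.
Qed.

Lemma gcoord_sum k I (e : seq I) (P : pred I) F :
  gcoord k (\sum_(i <- e | P i) F i) = \sum_(i <- e | P i) gcoord k (F i).
Proof. exact: (big_morph _ (gcoordD k) (gcoord0 k)). Qed.

Lemma gbase_sum I (e : seq I) (P : pred I) (F : I -> glued g V) :
  gbase (\sum_(i <- e | P i) F i) = \sum_(i <- e | P i) gbase (F i).
Proof. exact: (big_morph _ (@gbaseD _ _ _ _ _ g V)). Qed.

(** Inside [W x] the coordinates b at x determine those at every y by $t_y = b + g_{yx}(s)$, and the
    cocycle identity makes these compatible. *)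
Definition glued_lift (s : E V) (b : 'I_r -> E V) : glued g V.
Proof.
exists (s, fun y k => res (opensIl V (W y)) (b k) +
  cc g (opensIr V (W y)) (subset_trans (opensIl V (W y)) hx) k (res (opensIl V (W y)) s)).
move=> y z V' h iy iz hy hz k /=.
have hx' : V' `<=` W x by exact: subset_trans h hx.
rewrite !resD !resK !(cc_res _ _ _ _ hy hx') !(cc_res _ _ _ _ hz hx') !resK.
rewrite !(res_irr (subset_trans _ _) h) -addrA; congr (_ + _).
by rewrite addrC ccC.
Defined.

Lemma gbase_lift s b : gbase (glued_lift s b) = s.
Proof. by []. Qed.

Lemma gcoord_lift s b k : gcoord k (glued_lift s b) = b k.
Proof.
by rewrite /gcoord /gloc /= resD resK res_id (cc_res _ _ _ _ hx hx) ccxx addr0.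
Qed.

End OnePiece.

Lemma gcoord_irr (V : open) x (hx hx' : V `<=` W x) k p :
  gcoord hx k p = gcoord hx' k p.
Proof. by rewrite (Prop_irrelevance hx hx'). Qed.

Lemma gcoordE (V : open) x y (hx : V `<=` W x) (hy : V `<=` W y) k p :
  gcoord hx k p = gcoord hy k p + cc g hx hy k (gbase p).
Proof.
by rewrite /gcoord (glocE p (@subset_refl _ V) _ (sub_opensI hy) hx hy) res_id.
Qed.

Lemma gcoord_res (V V' : open) (VV : V' `<=` V) x (hx : V `<=` W x) (hx' : V' `<=` W x)
    k (p : glued g V) :
  gcoord hx' k (res VV p) = res VV (gcoord hx k p).
Proof.
rewrite /gcoord /= gloc_res !resK; exact: res_irr.
Qed.

Lemma gloc_gcoord (V : open) x k (p : glued g V) :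
  gloc p x k = gcoord (opensIr V (W x)) k (res (opensIl V (W x)) p).
Proof. by rewrite /gcoord /= gloc_res resK res_id. Qed.

Lemma glued_eq_at (V : open) x (hx : V `<=` W x) (p q : glued g V) :
  gbase p = gbase q -> (forall k, gcoord hx k p = gcoord hx k q) -> p = q.
Proof.
move=> pq c; apply: glued_eq => // y k.
have hx' : opensI V (W y) `<=` W x by move=> z [/hx].
rewrite (gloc_gcoord y k p) (gloc_gcoord y k q) 2!(gcoordE (opensIr V (W y)) hx').
by rewrite 2!(gcoord_res (opensIl V (W y)) hx hx') c /= !gbase_res pq.
Qed.

Lemma glued_eq_coord (V : open) (p q : glued g V) : gbase p = gbase q ->
  (forall x (V' : open) (VV : V' `<=` V) (hx : V' `<=` W x) k,
     gcoord hx k (res VV p) = gcoord hx k (res VV q)) -> p = q.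
Proof. by move=> pq c; apply: glued_eq => // x k; rewrite !gloc_gcoord c. Qed.

(** The base sections glue in E, and so do, for each x and k, the coordinates over the part of U in
    [W x]. The transition rule for the result is local, and on each [Z i] it is that of [p i]. *)
Lemma glued_is_sheaf : is_sheaf E -> is_sheaf (glued g).
Proof.
move=> sE I U Z ZU UE.
have mem x : oset U x -> exists i, oset (Z i) x.
  by rewrite UE => -[i _ Zx]; exists i.
split=> [p q pq|p pq].
  apply: glued_eq => [|x k]; apply: (sheaf_eq sE) => y.
    move=> /mem[i Zy]; exists (Z i), (ZU i); split => //.
    by have /(congr1 (@gbase _ _ _ _ _ _ _)) := pq i.
  move=> [Uy Wy]; have [i Zy] := mem y Uy.
  exists (opensI (Z i) (W x)), (opensI_mono (ZU i)); split => //.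
  by have /(congr1 (fun p => gloc p x k)) := pq i.
have pqr i j (V : open) (hi : V `<=` Z i) (hj : V `<=` Z j) : res hi (p i) = res hj (p j).
  have h : V `<=` opensI (Z i) (Z j) by move=> y Vy; split; [exact: hi|exact: hj].
  have /(congr1 (res h)) := pq i j; rewrite !resK.
  by rewrite (res_irr _ hi) (res_irr (subset_trans _ _) hj).
have [||x Ux|s sP] := @sheaf_glue _ _ _ E sE U
    (fun V t => exists i (h : V `<=` Z i), t = gbase (res h (p i))).
- move=> V V' VV t [i [h ->]]; exists i, (subset_trans VV h).
  by rewrite -(resK h VV).
- by move=> V t t' _ [i [hi ->]] [j [hj ->]]; rewrite (pqr i j V hi hj).
- have [i Zx] := mem x Ux; exists (Z i); split => //.
  by exists (gbase (p i)), i, (@subset_refl _ _); rewrite res_id.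
have ext (x : pts X) (k : 'I_r) : exists t : E (opensI U (W x)),
    forall i (V : open) (h : V `<=` Z i) (hx : V `<=` W x) (h' : V `<=` opensI U (W x)),
    res h' t = gcoord hx k (res h (p i)).
  have [||y [Uy Wy]|t tP] := @sheaf_glue _ _ _ E sE (opensI U (W x))
    (fun V t => exists i (h : V `<=` Z i) (hx : V `<=` W x), t = gcoord hx k (res h (p i))).
  - move=> V V' VV t [i [h [hx ->]]].
    exists i, (subset_trans VV h), (subset_trans VV hx).
    by rewrite -(resK h VV) (gcoord_res _ hx).
  - move=> V t t' _ [i [hi [hx ->]]] [j [hj [hx' ->]]].
    by rewrite (pqr i j V hi hj); exact: gcoord_irr.
  - have [i Zy] := mem y Uy; exists (opensI (Z i) (W x)); split => //.
      by move=> z [/ZU].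
    by exists (gcoord (opensIr _ _) k (res (opensIl _ _) (p i))), i, (opensIl _ _), (opensIr _ _).
  by exists t => i V h hx h'; apply: tP; exists i, h, hx.
pose t x k := sval (cid (ext x k)).
have tP x k i (V : open) (h : V `<=` Z i) (hx : V `<=` W x) (h' : V `<=` opensI U (W x)) :
    res h' (t x k) = gcoord hx k (res h (p i)) by exact: (svalP (cid (ext x k))).
have sE' i (V : open) (VU : V `<=` U) (h : V `<=` Z i) : res VU s = gbase (res h (p i)).
  by apply: sP; exists i, h.
have compat : glued_compat g (s, t).
  move=> x y V h ix iy hx hy k /=; apply: (sheaf_eq sE) => z Vz.
  have [i Zz] := mem z (h z Vz).
  pose V' := opensI V (Z i); have VV : V' `<=` V := opensIl _ _.
  exists V', VV; split => //.
  have hx' : V' `<=` W x := subset_trans VV hx.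
  have hy' : V' `<=` W y := subset_trans VV hy.
  rewrite resD !resK (cc_res _ _ _ _ hx' hy') resK.
  rewrite !(tP _ _ i _ (opensIr V (Z i)) hx') !(tP _ _ i _ (opensIr V (Z i)) hy').
  by rewrite (sE' i _ _ (opensIr V (Z i))); exact: gcoordE.
exists (exist _ _ compat) => i; apply: glued_eq_coord => [|x V VZ hx k].
  by rewrite /= gbase_res /= (sE' i _ _ (@subset_refl _ _)) res_id.
rewrite resK {1}/gcoord /= gloc_res resK.
exact: tP.
Qed.

Lemma coef_surj (U : open) (f0 : O U) (f : 'I_r -> O U) :
  exists h : @OA K X (sqz_art K r) U, coef0 h = f0 /\ forall k, coef k h = f k.
Proof.
exists (const_ext r f0 + \sum_k cst U (eps K k) * const_ext r (f k)); split.
  rewrite coef0D coef0_sum coef0_const big1 ?addr0 // => k _.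
  by rewrite coef0M coef0_eps mul0r.
move=> l; rewrite coefD coef_const add0r coef_sum (bigD1 l) //= big1 => [|k kl].
  by rewrite coefM coef0_eps mul0r add0r coef0_const coef_eps eqxx mulr1 addr0.
by rewrite coefM coef0_eps mul0r add0r coef_eps (negPf kl) mulr0.
Qed.

(** The base section and each coordinate at x expand in the basis [e] of E; the coefficients
    obtained are the residue and the $\epsilon_k$-parts of the coefficients sought. *)
Lemma glued_local_basis n (V : open) (e : 'I_n -> E V) x (hx : V `<=` W x) :
  local_basis e -> local_basis (M := glued g) (fun i => glued_lift hx (e i) (fun=> 0)).
Proof.
move=> be V' VV p; have hx' : V' `<=` W x := subset_trans VV hx.
have [c0 [c0E c0U]] := be V' VV (gbase p).
have /choice[c cE] k := be V' VV (gcoord hx' k p).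
have /choice[d dE] i := coef_surj (c0 i) (fun k => c k i).
have baseE (d' : 'I_n -> @OA K X (sqz_art K r) V') :
    gbase (\sum_i d' i *: res VV (glued_lift hx (e i) (fun=> 0)) : glued g V') =
    \sum_i coef0 (d' i) *: res VV (e i).
  by rewrite gbase_sum; apply: eq_bigr => i _; rewrite gbaseZ /= gbase_res gbase_lift.
have coordE (d' : 'I_n -> @OA K X (sqz_art K r) V') k :
    gcoord hx' k (\sum_i d' i *: res VV (glued_lift hx (e i) (fun=> 0)) : glued g V') =
    \sum_i coef k (d' i) *: res VV (e i).
  rewrite gcoord_sum; apply: eq_bigr => i _.
  rewrite gcoordZ (gcoord_res _ hx) gcoord_lift res0 scaler0 add0r.
  by rewrite /= gbase_res gbase_lift.
exists [ffun i => d i]; split.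
  apply: (glued_eq_at (hx := hx')) => [|k].
    by rewrite baseE c0E; apply: eq_bigr => i _; rewrite ffunE (dE i).1.
  by rewrite coordE (cE k).1; apply: eq_bigr => i _; rewrite ffunE (dE i).2.
move=> d' pE; apply/ffunP => i; rewrite ffunE; apply: coef_eq => [|k].
  rewrite (dE i).1 (c0U [ffun i => coef0 (d' i)]) ?ffunE //.
  by rewrite pE baseE; apply: eq_bigr => j _; rewrite ffunE.
rewrite (dE i).2 ((cE k).2 [ffun i => coef k (d' i)]) ?ffunE //.
by rewrite pE coordE; apply: eq_bigr => j _; rewrite ffunE.
Qed.

Lemma local_basis_res (A : comAlgType K) (M : opsh X A) n (V V' : open) (VV : V' `<=` V)
    (e : 'I_n -> M V) : local_basis e -> local_basis (fun i => res VV (e i)).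
Proof.
move=> be V0 V0V s; have [c [cE cU]] := be V0 (subset_trans V0V VV) s.
exists c; split=> [|c' c'E].
  by rewrite cE; apply: eq_bigr => i _; rewrite resK.
by apply: cU; rewrite c'E; apply: eq_bigr => i _; rewrite resK.
Qed.

Lemma locally_free_basis (A : comAlgType K) (M : opsh X A) (x : pts X) (V : open) :
  locally_free M -> oset V x ->
  exists (V' : open) n (e : 'I_n -> M V'), [/\ oset V' x, V' `<=` V & local_basis e].
Proof.
move=> fM Vx; have [V' [n [e [V'x be]]]] := fM x.
exists (opensI V V'), n, (fun i => res (opensIr V V') (e i)).
split => //; [exact: opensIl|exact: local_basis_res].
Qed.

Lemma glued_locally_free : locally_free E -> locally_free (glued g).
Proof.
move=> fE x; have [V [n [e [Vx hx be]]]] := locally_free_basis fE (covP W x).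
by exists V, n, (fun i => glued_lift hx (e i) (fun=> 0)); split => //; exact: glued_local_basis.
Qed.

Lemma gbase_lin U (a : @OA K X (sqz_art K r) U) (p : glued g U) :
  gbase (a *: p) = pushA (aug (sqz_art K r)) a *: gbase p.
Proof. exact: gbaseZ. Qed.

Definition glued_pi : omor (aug (sqz_art K r)) (glued g) E :=
  @Omor K X (sqz_art K r) K^o (aug (sqz_art K r)) (glued g) E
    (@gbase _ _ _ _ _ g) (@gbaseD _ _ _ _ _ g) gbase_lin (@gbase_res _ _ _ _ _ g).

Lemma glued_pi_base_change : locally_free E -> is_base_change glued_pi.
Proof.
move=> fE; apply: base_change_of_basis => x.
have [V [n [e [Vx hx be]]]] := locally_free_basis fE (covP W x).
exists V, n, (fun i => glued_lift hx (e i) (fun=> 0)).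
by split => //; exact: glued_local_basis.
Qed.

Definition glued_def (sE : is_sheaf E) (fE : locally_free E) :
    deformation E (sqz_art K r) :=
  Deformation (glued_is_sheaf sE) (glued_locally_free fE) (glued_pi_base_change fE).

End Coordinates.

(** * Extension of scalars of glued deformations *)

Section GluedMap.
Variables (K : fieldType) (X : projvar K) (E : opsh X K^o) (W : cover X) (r s : nat).
Variables (M : 'M[K]_(r, s)) (g : cocycle E W r) (g' : cocycle E W s).
Notation open := (opens (pts X)).

Hypothesis g'E : forall x y (V : open) (hx : V `<=` W x) (hy : V `<=` W y) l u,
  cc g' hx hy l u = \sum_k @cst K X K^o V (M k l) *: cc g hx hy k u.

Definition glued_map_fun (V : open) (p : glued g V) : glued g' V.
Proof.
exists (gbase p, fun x l => \sum_k @cst K X K^o _ (M k l) *: gloc p x k).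
move=> x y V' h ix iy hx hy l /=.
rewrite !res_sum g'E -big_split; apply: eq_bigr => k _ /=.
by rewrite !resZ !resA_cst (glocE p h ix iy hx hy) scalerDr.
Defined.

Lemma gbase_map (V : open) (p : glued g V) : gbase (glued_map_fun p) = gbase p.
Proof. by []. Qed.

Lemma gloc_map (V : open) (p : glued g V) x l : gloc (glued_map_fun p) x l =
  \sum_k @cst K X K^o _ (M k l) *: gloc p x k.
Proof. by []. Qed.

Lemma glued_mapD V (p q : glued g V) :
  glued_map_fun (p + q) = glued_map_fun p + glued_map_fun q.
Proof.
apply: glued_eq => [|x l]; first by rewrite gbaseD !gbase_map gbaseD.
rewrite glocD !gloc_map -big_split; apply: eq_bigr => k _.
by rewrite glocD scalerDr.
Qed.

Lemma glued_mapZ V (f : @OA K X (sqz_art K r) V) (p : glued g V) :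
  glued_map_fun (f *: p) = pushA (sqz_mor M) f *: glued_map_fun p.
Proof.
apply: glued_eq => [|x l]; first by rewrite gbaseZ !gbase_map gbaseZ coef0_map.
rewrite glocZ !gloc_map coef0_map coef_map gbase_map.
have resAS (V' : open) (VV : V' `<=` V) I (e : seq I) (F : I -> @OA K X K^o V) :
    resA VV (\sum_(i <- e) F i) = \sum_(i <- e) resA VV (F i).
  apply: (big_morph (resA VV)) => [a b|]; exact: OA_eq.
rewrite resAS scaler_suml scaler_sumr -big_split; apply: eq_bigr => k _.
rewrite glocZ scalerDr !scalerA !resA_ring resA_cst.
by rewrite [_ * resA _ (coef0 f)]mulrC.
Qed.

Lemma glued_map_res (V V' : open) (VV : V' `<=` V) (p : glued g V) :
  glued_map_fun (res VV p) = res VV (glued_map_fun p).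
Proof.
apply: glued_eq => [|x l]; first by rewrite /= gbase_map !gbase_res gbase_map.
rewrite /= gloc_map !gloc_res gloc_map res_sum; apply: eq_bigr => k _.
by rewrite gloc_res resZ resA_cst.
Qed.

Definition glued_map : omor (sqz_mor M) (glued g) (glued g') :=
  @Omor K X (sqz_art K r) (sqz_art K s) (sqz_mor M) (glued g) (glued g')
    glued_map_fun glued_mapD glued_mapZ glued_map_res.

Lemma glued_map_lift (V : open) x (hx : V `<=` W x) u :
  glued_map_fun (glued_lift g hx u (fun=> 0)) = glued_lift g' hx u (fun=> 0).
Proof.
apply: (glued_eq_at (hx := hx)) => [|k]; first by rewrite gbase_map !gbase_lift.
rewrite gcoord_lift /gcoord gloc_map res_sum big1 // => l _.
rewrite resZ -[res _ _]/(gcoord hx l (glued_lift g hx u (fun=> 0))) gcoord_lift.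
exact: scaler0.
Qed.

(** The local bases made of lifts with zero coordinates are sent to local bases of the same kind. *)
Lemma glued_map_base_change : locally_free E -> is_base_change glued_map.
Proof.
move=> fE; apply: base_change_of_basis => x.
have [V [n [e [Vx hx be]]]] := locally_free_basis fE (covP W x).
exists V, n, (fun i => glued_lift g hx (e i) (fun=> 0)).
split => //; first exact: glued_local_basis.
have -> : (fun i => glued_map V (glued_lift g hx (e i) (fun=> 0))) =
    (fun i => glued_lift g' hx (e i) (fun=> 0)).
  by apply/funext => i; exact: glued_map_lift.
exact: glued_local_basis.
Qed.

Lemma glued_map_ext (sE : is_sheaf E) (fE : locally_free E) :
  @dext K (Def E) _ _ (sqz_mor M) (glued_def g sE fE) (glued_def g' sE fE).
Proof. by exists glued_map; split => //; exact: glued_map_base_change. Qed.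

End GluedMap.

(** * The structure of a deformation over K (+) K^r *)

Section ImageSheaf.
Variables (K : fieldType) (X : projvar K) (E : opsh X K^o) (r : nat).
Variable D : deformation E (sqz_art K r).
Notation open := (opens (pts X)).
Notation O := (@OA K X K^o).

(** These sections form the image sheaf of [dpi]. It serves as a test object, since [dred] says
    nothing directly about liftings. *)
Definition loc_image (V : open) (s : E V) : Prop := forall x, oset V x ->
  exists (V' : open) (VV : V' `<=` V) (p : dsh D V'), oset V' x /\ dpi D V' p = res VV s.

Definition in_image (V : open) : pred (E V) := fun s => `[< loc_image s >].

Lemma loc_image_res (V V' : open) (VV : V' `<=` V) (s : E V) :
  loc_image s -> loc_image (res VV s).
Proof.
move=> im x V'x; have [V0 [V0V [p [V0x pE]]]] := im x (VV x V'x).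
exists (opensI V' V0), (opensIl _ _), (res (opensIr _ _) p); split => //.
by rewrite ofun_res pE !resK; exact: res_irr.
Qed.

Lemma in_image_closed (V : open) : GRing.subsemimod_closed (@in_image V).
Proof.
split; first split.
- apply/asboolP => x Vx; exists V, (@subset_refl _ _), 0; split=> //.
  by rewrite ofun0 res0.
- move=> s t /asboolP ims /asboolP imt; apply/asboolP => x Vx.
  have [V1 [V1V [p [V1x pE]]]] := ims x Vx.
  have [V2 [V2V [q [V2x qE]]]] := imt x Vx.
  exists (opensI V1 V2), (subset_trans (opensIl _ _) V1V).
  exists (res (opensIl _ _) p + res (opensIr _ _) q); split=> //.
  rewrite ofunD !ofun_res pE qE resD !resK; congr (_ + _); exact: res_irr.
- move=> f s /asboolP ims; apply/asboolP => x Vx.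
  have [V1 [V1V [p [V1x pE]]]] := ims x Vx.
  exists V1, V1V, (const_ext r (resA V1V f) *: p); split=> //.
  by rewrite ofunZ resZ -pE -[pushA _ _]/(coef0 _) coef0_const.
Qed.

Definition image_sec (V : open) : Type := {s : E V | @in_image V s}.

HB.instance Definition _ (V : open) := SubChoice.copy (image_sec V) {s : E V | @in_image V s}.
HB.instance Definition _ (V : open) := GRing.SubChoice_isSubLmodule.Build
  (O V) (E V) (@in_image V) (image_sec V) (@in_image_closed V).

Lemma image_res_subproof (V V' : open) (VV : V' `<=` V) (s : image_sec V) :
  in_image (res VV (val s)).
Proof. by apply/asboolP/loc_image_res; exact/asboolP/(valP s). Qed.

Definition image_res (V V' : open) (VV : V' `<=` V) (s : image_sec V) : image_sec V' :=
  Sub _ (image_res_subproof VV s).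

Lemma image_resD (V V' : open) (VV : V' `<=` V) (s t : image_sec V) :
  image_res VV (s + t) = image_res VV s + image_res VV t.
Proof. by apply: val_inj; exact: resD. Qed.

Lemma image_resZ (V V' : open) (VV : V' `<=` V) (f : O V) (s : image_sec V) :
  image_res VV (f *: s) = resA VV f *: image_res VV s.
Proof. by apply: val_inj; exact: resZ. Qed.

Lemma image_res_id (V : open) (VV : V `<=` V) (s : image_sec V) : image_res VV s = s.
Proof. by apply: val_inj; exact: res_id. Qed.

Lemma image_res_comp (V V' V'' : open) (VV : V' `<=` V) (VV' : V'' `<=` V')
    (VV'' : V'' `<=` V) (s : image_sec V) :
  image_res VV' (image_res VV s) = image_res VV'' s.
Proof. by apply: val_inj; apply: res_comp. Qed.

Definition image_sheaf : opsh X K^o :=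
  Opsh image_resD image_resZ image_res_id image_res_comp.

Lemma image_is_sheaf : is_sheaf E -> is_sheaf image_sheaf.
Proof.
move=> sE I U Z ZU UE; have [sep glue] := sE I U Z ZU UE; split=> [s t st|s ss].
  by apply: val_inj; apply: sep => i; have /(congr1 val) := st i.
have [|t tE] := glue (fun i => val (s i)).
  by move=> i j; have /(congr1 val) := ss i j.
have imt : in_image t.
  apply/asboolP => x Ux.
  have [i _ Zx] : (\bigcup_i oset (Z i)) x by rewrite -UE.
  have /asboolP /(_ x Zx) [V [VZ [p [Vx pE]]]] := valP (s i).
  exists V, (subset_trans VZ (ZU i)), p; split=> //.
  by rewrite pE -tE resK.
by exists (Sub t imt) => i; apply: val_inj; exact: tE.
Qed.

Definition to_image_fun (V : open) (p : dsh D V) : image_sheaf V.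
Proof.
exists (dpi D V p); apply/asboolP => x Vx.
by exists V, (@subset_refl _ V), p; rewrite res_id.
Defined.

Lemma to_image_funD V (p q : dsh D V) :
  to_image_fun (p + q) = to_image_fun p + to_image_fun q.
Proof. by apply: val_inj; exact: ofunD. Qed.

Lemma to_image_funZ V (f : @OA K X (sqz_art K r) V) (p : dsh D V) :
  to_image_fun (f *: p) = pushA (aug (sqz_art K r)) f *: to_image_fun p.
Proof. by apply: val_inj; exact: ofunZ. Qed.

Lemma to_image_fun_res (V V' : open) (VV : V' `<=` V) (p : dsh D V) :
  to_image_fun (res VV p) = res VV (to_image_fun p).
Proof. by apply: val_inj; exact: ofun_res. Qed.

Definition to_image : omor (aug (sqz_art K r)) (dsh D) image_sheaf :=
  Omor to_image_funD to_image_funZ to_image_fun_res.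

Definition image_incl : omor_lin image_sheaf E.
Proof.
apply: (@omor_lin_of K X K^o image_sheaf E (fun V (s : image_sec V) => val s)) => //.
Defined.

(* The identity of E factors through the image, by uniqueness in the universal
   property of base change. *)
Lemma dpi_surj : is_sheaf E -> forall (V : open) (s : E V), loc_image s.
Proof.
move=> sE V s; have [h [hE _]] := dred (to_image) (image_is_sheaf sE).
have idE (b : K^o) : (idfun : {lrmorphism K^o -> K^o}) b =
  (idfun : {lrmorphism K^o -> K^o}) ((idfun : {lrmorphism K^o -> K^o}) b) by [].
have [k [_ kU]] := dred (dpi D) sE.
have -> : s = val (h V s).
  rewrite -[RHS]/(ocomp idE image_incl h V s) (kU (ocomp idE image_incl h)).
    by rewrite -(kU (oid E)).
  by move=> U p; rewrite /= /ocomp_fun hE.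
exact/asboolP/(valP (h V s)).
Qed.

End ImageSheaf.

Section RestrictScalars.
Variables (K : fieldType) (X : projvar K) (A B : comAlgType K).
Variables (psi : {lrmorphism A -> B}) (M : opsh X B).
Notation open := (opens (pts X)).

Definition rscal_sec (V : open) : Type := M V.

HB.instance Definition _ V := GRing.Zmodule.copy (rscal_sec V) (M V).

Definition rscal_scale V (f : OA A V) (s : rscal_sec V) : rscal_sec V :=
  pushA psi f *: (s : M V).

Lemma rscal_scaleA V (f f' : OA A V) s :
  rscal_scale f (rscal_scale f' s) = rscal_scale (f * f') s.
Proof. by rewrite /rscal_scale scalerA pushAM. Qed.

Lemma rscal_scale1 V : left_id 1 (@rscal_scale V).
Proof. by move=> s; rewrite /rscal_scale pushA1 scale1r. Qed.

Lemma rscal_scaleDr V : right_distributive (@rscal_scale V) +%R.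
Proof. by move=> f s t; exact: scalerDr. Qed.

Lemma rscal_scaleDl V s : {morph (@rscal_scale V)^~ s : f f' / f + f'}.
Proof. by move=> f f'; rewrite /rscal_scale pushAD scalerDl. Qed.

HB.instance Definition _ V := GRing.Zmodule_isLmodule.Build (OA A V) (rscal_sec V)
  (@rscal_scaleA V) (@rscal_scale1 V) (@rscal_scaleDr V) (@rscal_scaleDl V).

Definition rscal_res (V V' : open) (VV : V' `<=` V) (s : rscal_sec V) : rscal_sec V' :=
  res VV (s : M V).

Lemma rscal_resD (V V' : open) (VV : V' `<=` V) (s t : rscal_sec V) :
  rscal_res VV (s + t) = rscal_res VV s + rscal_res VV t.
Proof. exact: resD. Qed.

Lemma rscal_resZ (V V' : open) (VV : V' `<=` V) (f : OA A V) (s : rscal_sec V) :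
  rscal_res VV (f *: s) = resA VV f *: rscal_res VV s.
Proof. by rewrite [LHS]resZ -pushA_res. Qed.

Lemma rscal_res_id (V : open) (VV : V `<=` V) (s : rscal_sec V) : rscal_res VV s = s.
Proof. exact: res_id. Qed.

Lemma rscal_res_comp (V V' V'' : open) (VV : V' `<=` V) (VV' : V'' `<=` V')
    (VV'' : V'' `<=` V) (s : rscal_sec V) :
  rscal_res VV' (rscal_res VV s) = rscal_res VV'' s.
Proof. exact: res_comp. Qed.

(** The universal property of a base change to B tests only on sheaves of modules over B.
    Restricting scalars makes it applicable to D along K -> K (+) K^r, and to E along an
    augmentation. *)
Definition rscal : opsh X A := Opsh rscal_resD rscal_resZ rscal_res_id rscal_res_comp.

Lemma rscal_is_sheaf : is_sheaf M -> is_sheaf rscal.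
Proof. by []. Qed.

Lemma rscal_mor (N : opsh X A) (f : omor psi N M) :
  exists g : omor_lin N rscal, forall U s, g U s = f U s.
Proof.
by exists (@omor_lin_of K X A N rscal f (@ofunD _ _ _ _ _ _ _ f)
  (@ofunZ _ _ _ _ _ _ _ f) (@ofun_res _ _ _ _ _ _ _ f)).
Qed.

End RestrictScalars.

Section Socle.
Variables (K : fieldType) (X : projvar K) (r : nat) (M : opsh X (sqz_art K r)).
Notation open := (opens (pts X)).
Notation kres := (rscal (const_mor K r) M).

(* [a] is annihilated by the maximal ideal, so that multiplication by [a] is
   linear along the augmentation and hence factors through dpi. *)
Variables (a : sqz_art K r).
Hypothesis socle : forall V (f : @OA K X (sqz_art K r) V),
  cst V a * f = cst V a * const_ext r (coef0 f).

Definition socle_fun V (s : M V) : kres V := ascale a s.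

Lemma socle_funD V (s t : M V) : socle_fun (s + t) = socle_fun s + socle_fun t.
Proof. by rewrite /socle_fun /ascale scalerDr. Qed.

Lemma socle_funZ V (f : @OA K X (sqz_art K r) V) (s : M V) :
  socle_fun (f *: s) = pushA (aug (sqz_art K r)) f *: socle_fun s.
Proof.
rewrite /socle_fun /ascale scalerA socle mulrC -scalerA.
by rewrite -[pushA _ _]/(coef0 f).
Qed.

Lemma socle_fun_res (V V' : open) (VV : V' `<=` V) (s : M V) :
  socle_fun (res VV s) = res VV (socle_fun s).
Proof. by rewrite [RHS]resZ resA_cst. Qed.

Definition socle_mor : omor (aug (sqz_art K r)) M kres :=
  Omor socle_funD socle_funZ socle_fun_res.

End Socle.

Section Neighbourhoods.
Variables (T : topologicalType).

Lemma common_neighbourhood n (x : T) (V : opens T) (P : 'I_n -> opens T -> Prop) :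
  oset V x -> (forall k (U U' : opens T), U' `<=` U -> P k U -> P k U') ->
  (forall k, exists U : opens T, oset U x /\ P k U) ->
  exists U : opens T, [/\ oset U x, U `<=` V & forall k, P k U].
Proof.
move=> Vx mono /choice[U UP].
exists (opensI V (opens_bigcap U)); split.
- by split=> // i; exact: (UP i).1.
- by move=> y [].
- by move=> k; apply: (mono k (U k)) (UP k).2 => y [_]; exact.
Qed.

End Neighbourhoods.

Section Structure.
Variables (K : fieldType) (X : projvar K) (E : opsh X K^o) (r : nat).
Hypotheses (sE : is_sheaf E) (fE : locally_free E).
Variable D : deformation E (sqz_art K r).
Notation open := (opens (pts X)).
Notation O := (@OA K X K^o).
Notation OAr := (@OA K X (sqz_art K r)).

Lemma dpi_coef0 V (f : OAr V) (p : dsh D V) : dpi D V (f *: p) = coef0 f *: dpi D V p.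
Proof. exact: ofunZ. Qed.

Lemma dpi_surj_tuple n (V : open) (s : 'I_n -> E V) x : oset V x ->
  exists (V' : open) (VV : V' `<=` V) (p : 'I_n -> dsh D V'),
    oset V' x /\ forall i, dpi D V' (p i) = res VV (s i).
Proof.
move=> Vx.
have [||V' [V'x VV Vp]] := common_neighbourhood (P := fun i U =>
    exists (h : U `<=` V) (p : dsh D U), dpi D U p = res h (s i)) Vx.
- move=> k U U' UU [h [p pE]]; exists (subset_trans UU h), (res UU p).
  by rewrite ofun_res pE resK.
- move=> k; have [U [h [p [Ux pE]]]] := dpi_surj D sE (s k) Vx.
  by exists U; split=> //; exists h, p.
have /choice[p pE] k : exists p, dpi D V' p = res VV (s k).
  by have [h [p pE]] := Vp k; exists p; rewrite pE; exact: res_irr.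
by exists V', VV, p.
Qed.

(** Multiplication by [eps k] on D is linear along the augmentation, hence factors through [dpi] by
    the universal property, with D regarded as an O_X-module. *)
Lemma ex_iota (k : 'I_r) : exists i : forall V, E V -> dsh D V,
  [/\ forall V s t, i V (s + t) = i V s + i V t,
      forall V (f : O V) s, i V (f *: s) = const_ext r f *: i V s,
      forall (V V' : open) (VV : V' `<=` V) s, i V' (res VV s) = res VV (i V s)
    & forall V p, i V (dpi D V p) = cst V (eps K k) *: p].
Proof.
have socle V (f : OAr V) : cst V (eps K k) * f = cst V (eps K k) * const_ext r (coef0 f).
  exact: eps_mul.
have [h [hE _]] := dred (socle_mor (dsh D) socle) (rscal_is_sheaf (const_mor K r) (dsheaf D)).
exists (fun V s => h V s); split.
- by move=> V s t; rewrite ofunD.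
- by move=> V f s; rewrite omor_linZ.
- by move=> V V' VV s; rewrite ofun_res.
- by move=> V p; rewrite hE.
Qed.

Definition iota k : forall V, E V -> dsh D V := sval (cid (ex_iota k)).

Lemma iotaD k V s t : iota k (s + t : E V) = iota k s + iota k t.
Proof. by rewrite /iota; case: cid => i []. Qed.

Lemma iotaZ k V (f : O V) s : iota k (f *: s) = const_ext r f *: iota k s.
Proof. by rewrite /iota; case: cid => i []. Qed.

Lemma iota_res k (V V' : open) (VV : V' `<=` V) s : iota k (res VV s) = res VV (iota k s).
Proof. by rewrite /iota; case: cid => i []. Qed.

Lemma iota_dpi k V p : iota k (dpi D V p) = cst V (eps K k) *: p.
Proof. by rewrite /iota; case: cid => i []. Qed.

Lemma iota0 k V : iota k (0 : E V) = 0.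
Proof. by apply: (addrI (iota k (0 : E V))); rewrite -iotaD !addr0. Qed.

Lemma dpi_iota k V (s : E V) : dpi D V (iota k s) = 0.
Proof.
apply: (sheaf_eq sE) => x Vx.
have [V' [VV [p [V'x pE]]]] := dpi_surj D sE s Vx.
exists V', VV; split=> //.
by rewrite -ofun_res -iota_res -pE iota_dpi dpi_coef0 coef0_eps scale0r res0.
Qed.

Lemma scale_iota k V (f : OAr V) (s : E V) : f *: iota k s = iota k (coef0 f *: s).
Proof.
apply: (sheaf_eq (dsheaf D)) => x Vx.
have [V' [VV [p [V'x pE]]]] := dpi_surj D sE s Vx.
exists V', VV; split=> //.
rewrite resZ -!iota_res resZ -pE -coef0_res -dpi_coef0 !iota_dpi !scalerA.
by rewrite mulrC.
Qed.

(** The left map of $0\to E^r\to D\to E\to 0$; exactness is the content of [iotas_inj], [dpi_exact]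
    and [dpi_surj]. *)
Definition iotas V (t : 'I_r -> E V) : dsh D V := \sum_k iota k (t k).

Lemma iotasD V (t t' : 'I_r -> E V) : iotas (fun k => t k + t' k) = iotas t + iotas t'.
Proof. by rewrite -big_split; apply: eq_bigr => k _; exact: iotaD. Qed.

Lemma scale_iotas V (f : OAr V) (t : 'I_r -> E V) :
  f *: iotas t = iotas (fun k => coef0 f *: t k).
Proof. by rewrite scaler_sumr; apply: eq_bigr => k _; exact: scale_iota. Qed.

Lemma iotas_res (V V' : open) (VV : V' `<=` V) (t : 'I_r -> E V) :
  iotas (fun k => res VV (t k)) = res VV (iotas t).
Proof. by rewrite res_sum; apply: eq_bigr => k _; exact: iota_res. Qed.

Lemma dpi_iotas V (t : 'I_r -> E V) : dpi D V (iotas t) = 0.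
Proof. by rewrite ofun_sum big1 // => k _; exact: dpi_iota. Qed.

Lemma basis_coef_eq0 (A : comAlgType K) (M : opsh X A) n (W V : open) (e : 'I_n -> M W)
    (VW : V `<=` W) (c : 'I_n -> OA A V) : local_basis e ->
  \sum_i c i *: res VW (e i) = 0 -> forall i, c i = 0.
Proof.
move=> be c0 i; have [d [_ dU]] := be V VW 0.
have dc : d = [ffun j => c j].
  by apply: dU; rewrite -[LHS]c0; apply: eq_bigr => j _; rewrite ffunE.
have d0 : d = [ffun=> 0].
  by apply: dU; rewrite big1 // => j _; rewrite ffunE scale0r.
by move/ffunP: dc => /(_ i); rewrite d0 !ffunE.
Qed.

(* For r > 0 the socle is spanned by the [eps k]; for r = 0 it is spanned by 1. *)
Lemma dpi_basis_eq0 n (W V : open) (e : 'I_n -> dsh D W) (VW : V `<=` W)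
    (c : 'I_n -> OAr V) : local_basis e ->
  dpi D V (\sum_i c i *: res VW (e i)) = 0 -> forall i, coef0 (c i) = 0.
Proof.
move=> be pc i; have [r0|r0] := posnP r.
  have socle U (f : OAr U) : cst U (1 : sqz_art K r) * f = cst U 1 * const_ext r (coef0 f).
    rewrite !cst1 !mul1r; apply: coef_eq => [|[k kr]]; first by rewrite coef0_const.
    by exfalso; move: kr; rewrite r0.
  have [h [hE _]] := dred (socle_mor (dsh D) socle) (rscal_is_sheaf (const_mor K r) (dsheaf D)).
  have := hE V (\sum_i c i *: res VW (e i)).
  rewrite pc ofun0 /= /socle_fun /ascale cst1 scale1r => /esym c0.
  by rewrite (basis_coef_eq0 be c0) /coef0 pushA0.
(* A section killed by [dpi] is killed by $\epsilon_0$. Freeness then gives $\epsilon_0 c_i = 0$,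
   whose $\epsilon_0$-part is the residue of $c_i$. *)
have := iota_dpi (Ordinal r0) (\sum_i c i *: res VW (e i)).
rewrite pc iota0 scaler_sumr; under eq_bigr do rewrite scalerA.
move=> /esym /(basis_coef_eq0 be) /(_ i) /(congr1 (coef (Ordinal r0))).
rewrite coefM coef0_eps mul0r add0r coef_eps eqxx mulr1 => ->.
by apply: OA_eq => x /=; rewrite mxE.
Qed.

(** Lift each $t_l$ locally to $p_l=\sum_i c_{li}e_i$ in a basis of D. Then $\sum_l\epsilon_l
    c_{li}=0$ for all i, so every $c_{ki}$ has residue zero and $t_k$, the image of $p_k$,
    vanishes. *)
Lemma iotas_inj V (t : 'I_r -> E V) : iotas t = 0 -> forall k, t k = 0.
Proof.
move=> t0 k; apply: (sheaf_eq sE) => x Vx.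
have [V' [VV [p [V'x pE]]]] := dpi_surj_tuple t Vx.
have [W [n [e [Wx WV be]]]] := locally_free_basis (dfree D) V'x.
exists W, (subset_trans WV VV); split=> //; rewrite res0.
have /choice[c cE] l : exists c : {ffun 'I_n -> OAr W},
    res WV (p l) = \sum_i c i *: res (@subset_refl _ W) (e i).
  by have [c []] := be W (@subset_refl _ W) (res WV (p l)); exists c.
have : \sum_i (\sum_l cst W (eps K l) * c l i) *: res (@subset_refl _ W) (e i) = 0.
  rewrite -[RHS](res0 _ (subset_trans WV VV)) -t0 -iotas_res.
  under eq_bigr do rewrite scaler_suml.
  rewrite exchange_big; apply: eq_bigr => l _ /=.
  rewrite -resK -pE -ofun_res iota_dpi cE scaler_sumr.
  by apply: eq_bigr => i _; rewrite scalerA.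
move=> /(basis_coef_eq0 be) c0.
rewrite -resK -pE -ofun_res cE ofun_sum big1 // => i _; rewrite dpi_coef0.
have /(congr1 (coef k)) := c0 i.
rewrite coef_sum (bigD1 k) //= big1 => [|l lk].
  rewrite coefM coef0_eps mul0r add0r coef_eps eqxx mulr1 addr0 => ->.
  rewrite (_ : coef k 0 = 0) ?scale0r //.
  by apply: OA_eq => z /=; rewrite mxE.
by rewrite coefM coef0_eps mul0r add0r coef_eps (negPf lk) mulr0.
Qed.

Lemma iotas_uniq V (t t' : 'I_r -> E V) : iotas t = iotas t' -> t = t'.
Proof.
move=> tt; apply/funext => k; apply/eqP; rewrite -subr_eq0; apply/eqP.
apply: (@iotas_inj V (fun k => t k - t' k)).
rewrite (iotasD t (fun k => - t' k)) tt -(iotasD t' (fun k => - t' k)).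
by rewrite /iotas big1 // => l _; rewrite subrr iota0.
Qed.

(** Locally $p=\sum_i c_ie_i$ with residues zero, so $p=\sum_k\epsilon_k\sum_i c_{ik}e_i$ comes from
    the images in E of the inner sums. Such local preimages are unique by injectivity, hence
    glue. *)
Lemma dpi_exact V (p : dsh D V) : dpi D V p = 0 -> exists t, p = iotas t.
Proof.
move=> p0.
pose R (U : open) (t : 'I_r -> E U) := exists VU : U `<=` V, res VU p = iotas t.
have loc x : oset V x -> exists U : open, [/\ oset U x, U `<=` V & exists t, R U t].
  move=> Vx; have [W [n [e [Wx WV be]]]] := locally_free_basis (dfree D) Vx.
  exists W; split=> //.
  have [c [cE _]] := be W (@subset_refl _ W) (res WV p).
  exists (fun k => dpi D W (\sum_i const_ext r (coef k (c i)) *: e i)), WV.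
  have c0 : forall i, coef0 (c i) = 0.
    by apply: (dpi_basis_eq0 (VW := @subset_refl _ W) be); rewrite -cE ofun_res p0 res0.
  rewrite cE /iotas; under [RHS]eq_bigr do rewrite iota_dpi scaler_sumr.
  rewrite exchange_big; apply: eq_bigr => i _ /=.
  rewrite res_id {1}(coef_decomp (c i)) c0 -[const_ext r 0]addr0 scalerDl scaler_suml.
  rewrite (_ : const_ext r 0 + 0 = 0) ?scale0r ?add0r.
    by apply: eq_bigr => k _; rewrite scalerA.
  rewrite addr0; apply: coef_eq => [|k]; first by rewrite coef0_const /coef0 pushA0.
  by rewrite coef_const; apply: OA_eq => z /=; rewrite mxE.
have Rres (U U' : open) (UU : U' `<=` U) (t : 'I_r -> E U) :
    R U t -> R U' (fun k => res UU (t k)).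
  by move=> [h e]; exists (subset_trans UU h); rewrite iotas_res -e resK.
have Runi (U : open) (t t' : 'I_r -> E U) : R U t -> R U t' -> t = t'.
  move=> [h e] [h' e']; apply: iotas_uniq; rewrite -e -e'; exact: res_irr.
have /choice[T TE] (k : 'I_r) : exists T : E V, forall (U : open) (UV : U `<=` V) t,
    R U t -> res UV T = t k.
  have [||x Vx|T TE] := @sheaf_glue _ _ _ E sE V (fun U s => exists2 t, R U t & s = t k).
  - by move=> U U' UU s [t Rt ->]; exists (fun k => res UU (t k)); first exact: Rres.
  - by move=> U s s' _ [t Rt ->] [t' Rt' ->]; rewrite (Runi _ _ _ Rt Rt').
  - have [U [Ux UV [t Rt]]] := loc x Vx; exists U; split=> //.
    by exists (t k), t.
  by exists T => U UV t Rt; apply: TE; exists t.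
exists T; apply: (sheaf_eq (dsheaf D)) => x Vx.
have [U [Ux UV [t Rt]]] := loc x Vx; exists U, UV; split=> //.
rewrite -iotas_res; have [h e] := Rt; rewrite (res_irr _ h) e; congr iotas.
by apply/funext => k; rewrite (TE k U UV t Rt).
Qed.

(** An O_X-linear section of [dpi] over W; together with the exact sequence it trivializes D
    there. *)
Record splitting (W : open) := Splitting {
  spl : forall V : open, V `<=` W -> E V -> dsh D V;
  splL : forall (V : open) (h : V `<=` W) (f : O V) s t,
    spl h (f *: s + t) = const_ext r f *: spl h s + spl h t;
  spl_res : forall (V V' : open) (h : V `<=` W) (h' : V' `<=` W) (VV : V' `<=` V) s,
    spl h' (res VV s) = res VV (spl h s);
  spl_dpi : forall (V : open) (h : V `<=` W) s, dpi D V (spl h s) = s }.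

(** Lift a local basis of E and extend linearly over O_X. *)
Lemma ex_splitting x : exists W : open, oset W x /\ inhabited (splitting W).
Proof.
have [W0 [n [e0 [W0x be0]]]] := fE x.
have [W [WW [l [Wx lE]]]] := dpi_surj_tuple e0 W0x.
exists W; split=> //.
have be := local_basis_res WW be0.
pose f i := res WW (e0 i).
pose c (V : open) (h : V `<=` W) (s : E V) := sval (cid (be V h s)).
have cE (V : open) (h : V `<=` W) (s : E V) : s = \sum_i c V h s i *: res h (f i).
  exact: (svalP (cid (be V h s))).1.
have cU (V : open) (h : V `<=` W) (s : E V) (d : 'I_n -> O V) :
    s = \sum_i d i *: res h (f i) -> forall i, c V h s i = d i.
  move=> sd i; rewrite -(ffunE d); congr (fun_of_fin _ _).
  apply: (svalP (cid (be V h s))).2; rewrite sd.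
  by apply: eq_bigr => j _; rewrite ffunE.
constructor.
exists (fun V h s => \sum_i const_ext r (c V h s i) *: res h (l i)).
- move=> V h a s t; rewrite scaler_sumr -big_split; apply: eq_bigr => i _ /=.
  rewrite (cU _ _ _ (fun i => a * c V h s i + c V h t i)).
    by rewrite const_extD const_extM scalerDl scalerA.
  rewrite {1}(cE V h s) {1}(cE V h t) scaler_sumr -big_split.
  by apply: eq_bigr => j _; rewrite scalerDl scalerA.
- move=> V V' h h' VV s; rewrite res_sum; apply: eq_bigr => i _.
  rewrite resZ resK -const_ext_res (cU _ _ _ (fun i => resA VV (c V h s i))).
    by congr (_ *: _); exact: res_irr.
  rewrite {1}(cE V h s) res_sum; apply: eq_bigr => j _.
  by rewrite resZ resK; congr (_ *: _); exact: res_irr.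
- move=> V h s; rewrite ofun_sum [RHS](cE V h s); apply: eq_bigr => i _.
  by rewrite dpi_coef0 coef0_const ofun_res lE.
Qed.

End Structure.

(** * A deformation is glued from the cocycle of its local splittings *)

Section NormalForm.
Variables (K : fieldType) (X : projvar K) (E : opsh X K^o) (r : nat).
Hypotheses (sE : is_sheaf E) (fE : locally_free E).
Variable D : deformation E (sqz_art K r).
Notation open := (opens (pts X)).
Notation O := (@OA K X K^o).
Notation iotas := (iotas D).

(** The implication under the quantifier makes [kcoord] a total function; its value outside the
    kernel of [dpi] carries no meaning. *)
Lemma ex_kcoord V (p : dsh D V) : exists t, dpi D V p = 0 -> p = iotas t.
Proof.
have [/(dpi_exact sE)[t pt]|p0] := EM (dpi D V p = 0); first by exists t.
by exists (fun=> 0).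
Qed.

Definition kcoord V (p : dsh D V) : 'I_r -> E V := sval (cid (ex_kcoord p)).

Lemma kcoordE V (p : dsh D V) : dpi D V p = 0 -> p = iotas (kcoord p).
Proof. exact: (svalP (cid (ex_kcoord p))). Qed.

Lemma kcoord_uniq V (p : dsh D V) t : p = iotas t -> kcoord p = t.
Proof.
move=> pt; apply: (iotas_uniq sE (D := D)); rewrite -kcoordE //.
by rewrite pt (dpi_iotas sE).
Qed.

Lemma kcoordD V (p q : dsh D V) : dpi D V p = 0 -> dpi D V q = 0 ->
  forall k, kcoord (p + q) k = kcoord p k + kcoord q k.
Proof.
move=> p0 q0 k; rewrite (@kcoord_uniq _ _ (fun k => kcoord p k + kcoord q k)) //.
by rewrite iotasD -!kcoordE.
Qed.

Lemma kcoordZ V (f : @OA K X (sqz_art K r) V) (p : dsh D V) : dpi D V p = 0 ->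
  forall k, kcoord (f *: p) k = coef0 f *: kcoord p k.
Proof.
move=> p0 k; rewrite (@kcoord_uniq _ _ (fun k => coef0 f *: kcoord p k)) //.
by rewrite -(scale_iotas sE) -kcoordE.
Qed.

Lemma kcoord_res (V V' : open) (VV : V' `<=` V) (p : dsh D V) : dpi D V p = 0 ->
  forall k, kcoord (res VV p) k = res VV (kcoord p k).
Proof.
move=> p0 k; rewrite (@kcoord_uniq _ _ (fun k => res VV (kcoord p k))) //.
by rewrite iotas_res -kcoordE.
Qed.

Lemma split_restrict (W W' : open) : W' `<=` W -> splitting D W -> splitting D W'.
Proof.
move=> WW [s sL sr sd].
exists (fun V h => s V (subset_trans h WW)) => *; [exact: sL|exact: sr|exact: sd].
Qed.

Variables (W : cover X) (sigma : forall x, splitting D (W x)).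

Lemma splD x (V : open) (h : V `<=` W x) s t :
  spl (sigma x) h (s + t) = spl (sigma x) h s + spl (sigma x) h t.
Proof. by rewrite -{1}[s]scale1r splL const_ext1 scale1r. Qed.

Lemma dpi_splB x y (V : open) (hx : V `<=` W x) (hy : V `<=` W y) s :
  dpi D V (spl (sigma y) hy s - spl (sigma x) hx s) = 0.
Proof. by rewrite ofunB !spl_dpi subrr. Qed.

(** The order of the difference matches the transition rule: $p-\sigma_x s=(p-\sigma_y s)+(\sigma_y
    s-\sigma_x s)$ for p over s. *)
Definition split_cc x y (V : open) (hx : V `<=` W x) (hy : V `<=` W y) k (s : E V) : E V :=
  kcoord (spl (sigma y) hy s - spl (sigma x) hx s) k.

Lemma split_ccL x y (V : open) (hx : V `<=` W x) (hy : V `<=` W y) k (f : O V) s t :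
  split_cc hx hy k (f *: s + t) = f *: split_cc hx hy k s + split_cc hx hy k t.
Proof.
rewrite /split_cc !splL opprD addrACA -scalerBr.
set u := _ - _; set v := _ - _.
have u0 : dpi D V u = 0 by exact: dpi_splB.
rewrite (@kcoordD _ (const_ext r f *: u)) ?dpi_splB ?dpi_coef0 ?u0 ?scaler0 //.
by rewrite kcoordZ ?u0 // coef0_const.
Qed.

Lemma split_cc_res x y (V V' : open) (hx : V `<=` W x) (hy : V `<=` W y)
    (VV : V' `<=` V) (hx' : V' `<=` W x) (hy' : V' `<=` W y) k s :
  res VV (split_cc hx hy k s) = split_cc hx' hy' k (res VV s).
Proof.
rewrite /split_cc -kcoord_res ?dpi_splB // resB.
by rewrite (spl_res _ hx) (spl_res _ hy).
Qed.

Lemma split_ccC x y z (V : open) (hx : V `<=` W x) (hy : V `<=` W y) (hz : V `<=` W z) k s :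
  split_cc hx hy k s + split_cc hy hz k s = split_cc hx hz k s.
Proof.
rewrite /split_cc -kcoordD ?dpi_splB //; congr (kcoord _ k).
by rewrite addrC addrA subrK.
Qed.

Definition split_cocycle : cocycle E W r := Cocycle split_ccL split_cc_res split_ccC.

Definition scoord x (V : open) (h : V `<=` W x) (p : dsh D V) : 'I_r -> E V :=
  kcoord (p - spl (sigma x) h (dpi D V p)).

Lemma dpi_sub_spl x (V : open) (h : V `<=` W x) p :
  dpi D V (p - spl (sigma x) h (dpi D V p)) = 0.
Proof. by rewrite ofunB spl_dpi subrr. Qed.

Lemma scoordD x (V : open) (h : V `<=` W x) (p q : dsh D V) k :
  scoord h (p + q) k = scoord h p k + scoord h q k.
Proof.
rewrite /scoord -kcoordD ?dpi_sub_spl //; congr (kcoord _ k).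
by rewrite ofunD splD opprD addrACA.
Qed.

Lemma scoordZ x (V : open) (h : V `<=` W x) f (p : dsh D V) k :
  scoord h (f *: p) k = coef0 f *: scoord h p k + coef k f *: dpi D V p.
Proof.
have -> : scoord h (f *: p) = fun k => coef0 f *: scoord h p k + coef k f *: dpi D V p.
  apply: kcoord_uniq; rewrite iotasD -(scale_iotas sE) -kcoordE ?dpi_sub_spl //.
  rewrite scalerBr dpi_coef0; set u := dpi D V p.
  have -> : spl (sigma x) h (coef0 f *: u) = const_ext r (coef0 f) *: spl (sigma x) h u.
    have s0 : spl (sigma x) h 0 = 0.
      by apply: (addrI (spl (sigma x) h 0)); rewrite -splD !addr0.
    by rewrite -[coef0 f *: u]addr0 splL s0 addr0.
  (* [iota k u] is [eps k] times any lift of u, in particular times the one given by the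
     splitting. *)
  have -> : iotas (fun k => coef k f *: u) =
      (\sum_k cst V (eps K k) * const_ext r (coef k f)) *: spl (sigma x) h u.
    rewrite scaler_suml; apply: eq_bigr => l _.
    by rewrite iotaZ -{1}(spl_dpi (sigma x) h u) iota_dpi scalerA mulrC.
  rewrite {4}(coef_decomp f) scalerDl opprD -addrA; congr (_ + _).
  by rewrite -addrA addNr addr0.
by [].
Qed.

Lemma scoord_res x (V V' : open) (h : V `<=` W x) (h' : V' `<=` W x) (VV : V' `<=` V)
    (p : dsh D V) k :
  scoord h' (res VV p) k = res VV (scoord h p k).
Proof.
rewrite /scoord -kcoord_res ?dpi_sub_spl //; congr (kcoord _ k).
by rewrite resB ofun_res (spl_res _ h).
Qed.

Lemma scoordE x (V : open) (h : V `<=` W x) p :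
  p = spl (sigma x) h (dpi D V p) + iotas (scoord h p).
Proof. by rewrite -kcoordE ?dpi_sub_spl // addrC subrK. Qed.

Lemma scoord_cc x y (V : open) (hx : V `<=` W x) (hy : V `<=` W y) p k :
  scoord hx p k = scoord hy p k + split_cc hx hy k (dpi D V p).
Proof.
rewrite /split_cc -kcoordD ?dpi_sub_spl ?dpi_splB //; congr (kcoord _ k).
by rewrite addrA subrK.
Qed.

Definition to_glued_fun V (p : dsh D V) : glued split_cocycle V.
Proof.
exists (dpi D V p, fun x k => scoord (opensIr V (W x)) (res (opensIl V (W x)) p) k).
move=> x y V' h ix iy hx hy k /=.
rewrite -(scoord_res _ hx) -(scoord_res _ hy) !resK !(res_irr (subset_trans _ _) h).
by rewrite -ofun_res; exact: scoord_cc.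
Defined.

Lemma gbase_to V (p : dsh D V) : gbase (to_glued_fun p) = dpi D V p.
Proof. by []. Qed.

Lemma gloc_to V (p : dsh D V) x k : gloc (to_glued_fun p) x k =
  scoord (opensIr V (W x)) (res (opensIl V (W x)) p) k.
Proof. by []. Qed.

Lemma gcoord_to x (V : open) (h : V `<=` W x) (p : dsh D V) k :
  gcoord h k (to_glued_fun p) = scoord h p k.
Proof.
by rewrite /gcoord gloc_to -(scoord_res _ h) resK res_id.
Qed.

Lemma to_glued_funD V (p q : dsh D V) :
  to_glued_fun (p + q) = to_glued_fun p + to_glued_fun q.
Proof.
apply: glued_eq => [|x k]; first by rewrite gbaseD !gbase_to ofunD.
by rewrite glocD !gloc_to resD scoordD.
Qed.

Lemma to_glued_funZ V (f : @OA K X (sqz_art K r) V) (p : dsh D V) :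
  to_glued_fun (f *: p) = f *: to_glued_fun p.
Proof.
apply: glued_eq => [|x k]; first by rewrite gbaseZ !gbase_to dpi_coef0.
by rewrite glocZ !gloc_to resZ scoordZ coef0_res coef_res gbase_to ofun_res.
Qed.

Lemma to_glued_fun_res (V V' : open) (VV : V' `<=` V) (p : dsh D V) :
  to_glued_fun (res VV p) = res VV (to_glued_fun p).
Proof.
apply: glued_eq => [|x k]; first by rewrite /= gbase_res !gbase_to ofun_res.
rewrite gloc_to /= gloc_res gloc_to -(scoord_res _ (opensIr _ _)) !resK.
by congr (scoord _ _ k); exact: res_irr.
Qed.

Definition to_glued : omor_lin (dsh D) (glued split_cocycle) :=
  omor_lin_of to_glued_funD to_glued_funZ to_glued_fun_res.

Lemma to_glued_inj V : injective (to_glued V).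
Proof.
move=> p q pq; apply: (sheaf_eq (dsheaf D)) => x Vx.
exists (opensI V (W x)), (opensIl _ _); split; first by split=> //; exact: covP.
rewrite (scoordE (opensIr V (W x)) (res _ p)) [RHS](scoordE (opensIr V (W x)) (res _ q)).
have e : dpi D V p = dpi D V q by exact: (congr1 (fun p : glued split_cocycle V => gbase p) pq).
rewrite !ofun_res e; congr (_ + iotas _); apply/funext => k.
exact: (congr1 (fun p : glued split_cocycle V => gloc p x k) pq).
Qed.

Lemma to_glued_loc_surj x (V : open) (h : V `<=` W x) (q : glued split_cocycle V) :
  exists p, to_glued V p = q.
Proof.
exists (spl (sigma x) h (gbase q) + iotas (fun k => gcoord h k q)).
set p := (X in to_glued V X); have dp : dpi D V p = gbase q.
  by rewrite ofunD spl_dpi (dpi_iotas sE) addr0.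
apply: (glued_eq_at (hx := h)) => [|k]; first exact: dp.
rewrite gcoord_to /scoord dp (@kcoord_uniq _ _ (fun k => gcoord h k q)) //.
by rewrite addrAC subrr add0r.
Qed.

Lemma to_glued_surj V (q : glued split_cocycle V) : exists p, to_glued V p = q.
Proof.
pose R (U : open) p := exists UV : U `<=` V, to_glued U p = res UV q.
have loc x : oset V x -> exists U : open, [/\ oset U x, U `<=` V & exists p, R U p].
  move=> Vx; exists (opensI V (W x)); split; [by split => //; exact: covP|exact: opensIl|].
  have [p e] := to_glued_loc_surj (opensIr V (W x)) (res (opensIl V (W x)) q).
  by exists p, (opensIl _ _).
have [||//|p pE] := @sheaf_glue _ _ _ _ (dsheaf D) V R.
- move=> U U' UU p [UV e]; exists (subset_trans UU UV).
  by rewrite ofun_res e resK.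
- move=> U p p' _ [UV e] [UV' e']; apply: to_glued_inj; rewrite e e'; exact: res_irr.
exists p; apply: (sheaf_eq (glued_is_sheaf split_cocycle sE)) => x Vx.
have [U [Ux UV [p' Rp']]] := loc x Vx; exists U, UV; split => //.
by rewrite -ofun_res (pE _ UV _ Rp'); have [UV' ->] := Rp'; exact: res_irr.
Qed.

Lemma to_glued_iso : diso (d := Def E) D (glued_def split_cocycle sE fE).
Proof.
exists to_glued; split=> // V.
have /choice[q qE] := @to_glued_surj V.
by exists q => p //; apply: to_glued_inj; rewrite qE.
Qed.

End NormalForm.

Section Cover.
Variables (K : fieldType) (X : projvar K) (E : opsh X K^o) (r : nat).
Hypotheses (sE : is_sheaf E) (fE : locally_free E).

(** All refinements of W are allowed, so that several deformations can be brought to normal form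
    over one cover. *)
Lemma def_normal_form (D : deformation E (sqz_art K r)) :
  exists W : cover X, forall W' : cover X, refines W' W ->
    exists g : cocycle E W' r, diso (d := Def E) D (glued_def g sE fE).
Proof.
have /choice[W WP] := ex_splitting sE fE D.
exists (@Defs.Cover K X W (fun x => (WP x).1)) => W' W'W.
have sW' x : inhabited (splitting D (W' x)).
  have [_ [s]] := WP x; constructor; exact: split_restrict (W'W x) s.
have sW x : splitting D (W' x).
  by have := cid (let: inhabits s := sW' x in ex_intro (fun=> True) s I) => -[].
by exists (split_cocycle sE sW); exact: to_glued_iso.
Qed.

End Cover.

(** * The functor Def on the algebras K (+) K^r *)

Section BaseChangeIso.
Variables (K : fieldType) (X : projvar K) (A B : comAlgType K).
Variable phi : {lrmorphism A -> B}.

Lemma base_change_iso (M M' : opsh X A) (N N' : opsh X B) (f : omor_lin M' M)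
    (f' : omor_lin N N') (t : omor phi M N) (t' : omor phi M' N') :
  (forall U, bijective (f U)) -> (forall U, bijective (f' U)) ->
  (forall U s, t' U s = f' U (t U (f U s))) ->
  is_base_change t -> is_base_change t'.
Proof.
move=> bf bf' t'E bt P g sP.
have [fi fiE] := omor_lin_inv bf; have [fi' fi'E] := omor_lin_inv bf'.
have idr (a : A) : phi a = phi ((idfun : {lrmorphism A -> A}) a) by [].
have idb (b : B) : (idfun : {lrmorphism B -> B}) b =
  (idfun : {lrmorphism B -> B}) ((idfun : {lrmorphism B -> B}) b) by [].
have [h [hE hU]] := bt P (ocomp idr g fi) sP.
exists (ocomp idb h fi'); split=> [U s|h' h'E U s] /=.
  by rewrite /ocomp_fun t'E (fi'E U).1 hE /= /ocomp_fun (fiE U).1.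
rewrite -{1}[s](fi'E U).2 -[LHS]/(ocomp idb h' f' U (fi' U s)).
apply: (hU (ocomp idb h' f')) => V p /=.
by rewrite /ocomp_fun -[p](fiE V).2 -t'E h'E (fiE V).1.
Qed.

End BaseChangeIso.

Section DefIso.
Variables (K : fieldType) (X : projvar K) (E : opsh X K^o) (sE : is_sheaf E).
Local Notation F := (Def E).

Lemma def_iso_refl (A : artType K) (D : dob F A) : diso D D.
Proof. by exists (oid (dsh D)); split=> // U; exists id. Qed.

Lemma idfunE (A : comAlgType K) (a : A) : (idfun : {lrmorphism A -> A}) a =
  (idfun : {lrmorphism A -> A}) ((idfun : {lrmorphism A -> A}) a).
Proof. by []. Qed.

Lemma def_iso_sym (A : artType K) (D D' : dob F A) : diso D D' -> diso D' D.
Proof.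
move=> [f [bf fE]]; have [g gE] := omor_lin_inv bf; exists g; split=> [U|U s].
  by exists (f U); [exact: (gE U).2|exact: (gE U).1].
by rewrite -fE (gE U).2.
Qed.

Lemma def_iso_trans (A : artType K) (D D' D'' : dob F A) :
  diso D D' -> diso D' D'' -> diso D D''.
Proof.
move=> [f [bf fE]] [g [bg gE]]; exists (ocomp (@idfunE A) g f); split=> [U|U s] /=.
  exact: bij_comp.
by rewrite /ocomp_fun gE fE.
Qed.

Section Ext.
Variables (A B : artType K) (phi : {lrmorphism A -> B}).

Lemma def_ext_iso (D D' : dob F A) (D1 D1' : dob F B) :
  diso D D' -> dext phi D' D1 -> diso D1 D1' -> dext phi D D1'.
Proof.
move=> [f [bf fE]] [t [bt tE]] [g [bg gE]].
have idr (a : A) : phi a = phi ((idfun : {lrmorphism A -> A}) a) by [].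
have idl (a : A) : phi a = (idfun : {lrmorphism B -> B}) (phi a) by [].
exists (ocomp idl g (ocomp idr t f)); split=> [|U s] /=.
  exact: (base_change_iso (f := f) (f' := g) (t := t)).
by rewrite /ocomp_fun gE /= /ocomp_fun tE fE.
Qed.

(* The compatibility with the maps to E is an equality of morphisms D1 -> E along
   the augmentation, and follows from the universal property applied to E with
   its scalars restricted to B. *)
Lemma def_ext_uniq (D D' : dob F A) (D1 D1' : dob F B) :
  diso D D' -> dext phi D D1 -> dext phi D' D1' -> diso D1 D1'.
Proof.
move=> DD [t [bt tE]] D'1.
have [t' [bt' t'E]] := def_ext_iso DD D'1 (def_iso_refl _).
have [f [bf fE]] := base_change_unique (dsheaf D1) (dsheaf D1') bt bt'.
exists f; split=> // U s.
have [u uE] := rscal_mor (dpi D1); have [v vE] := rscal_mor (dpi D1').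
have idr (a : A) : phi a = (idfun : {lrmorphism B -> B}) (phi a) by [].
have [h [_ hU]] := bt _ (ocomp idr u t) (rscal_is_sheaf (aug B) sE).
rewrite -vE -uE -[LHS]/(ocomp (@idfunE B) v f U s) (hU (ocomp (@idfunE B) v f)).
  by rewrite (hU u).
by move=> V p; rewrite /= /ocomp_fun fE vE t'E uE tE.
Qed.

End Ext.

Section Existence.
Variables (fE : locally_free E).

Definition cocycle_map_fun (W : cover X) r s (M : 'M[K]_(r, s)) (g : cocycle E W r)
  x y (V : opens (pts X)) (hx : V `<=` W x) (hy : V `<=` W y) (l : 'I_s) (u : E V) : E V :=
  \sum_k @cst K X K^o V (M k l) *: cc g hx hy k u.

Definition cocycle_map (W : cover X) r s (M : 'M[K]_(r, s)) (g : cocycle E W r) :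
  cocycle E W s.
Proof.
exists (cocycle_map_fun M g).
- move=> x y V hx hy l f u v; rewrite /cocycle_map_fun scaler_sumr -big_split.
  by apply: eq_bigr => k _; rewrite ccL scalerDr !scalerA mulrC.
- move=> x y V V' hx hy VV hx' hy' l u; rewrite /cocycle_map_fun res_sum.
  by apply: eq_bigr => k _; rewrite resZ resA_cst (cc_res _ _ _ _ hx' hy').
- move=> x y z V hx hy hz l u; rewrite /cocycle_map_fun -big_split.
  by apply: eq_bigr => k _ /=; rewrite -scalerDr ccC.
Defined.

Lemma cocycle_mapE (W : cover X) r s (M : 'M[K]_(r, s)) (g : cocycle E W r)
    x y (V : opens (pts X)) (hx : V `<=` W x) (hy : V `<=` W y) l u :
  cc (cocycle_map M g) hx hy l u = \sum_k @cst K X K^o V (M k l) *: cc g hx hy k u.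
Proof. by []. Qed.

Lemma def_normal (r : nat) (D : dob F (sqz_art K r)) :
  exists (W : cover X) (g : cocycle E W r), diso D (glued_def g sE fE).
Proof.
have [W WP] := def_normal_form sE fE D; exists W; apply: WP => x; exact: subset_refl.
Qed.

(** The normal form replaces the construction of a tensor product: multiply the cocycle by the
    matrix. *)
Lemma def_ext_exists r s (M : 'M[K]_(r, s)) (D : dob F (sqz_art K r)) :
  exists D1 : dob F (sqz_art K s), dext (sqz_mor M) D D1.
Proof.
have [W [g Dg]] := def_normal D.
exists (glued_def (cocycle_map M g) sE fE).
apply: (def_ext_iso Dg _ (def_iso_refl _)); exact: glued_map_ext.
Qed.

(** On cocycles both routes multiply by [M *m N]; the normal form and uniqueness of extensions carry
    this over to arbitrary deformations. *)
Lemma def_ext_comp r s t (M : 'M[K]_(r, s)) (N : 'M[K]_(s, t)) D D1 D2 :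
  dext (d := F) (sqz_mor M) D D1 -> dext (d := F) (sqz_mor N) D1 D2 ->
  dext (d := F) (sqz_mor (M *m N)) D D2.
Proof.
move=> DD1 D1D2; have [W [g Dg]] := def_normal D.
pose g1 := cocycle_map M g; pose g2 := cocycle_map N g1.
have e1 : diso (d := F) (glued_def g1 sE fE) D1.
  apply: def_ext_uniq (def_iso_sym Dg) _ DD1; exact: glued_map_ext.
have e2 : diso (d := F) (glued_def g2 sE fE) D2.
  apply: def_ext_uniq e1 _ D1D2; exact: glued_map_ext.
apply: (def_ext_iso Dg _ e2).
apply: glued_map_ext => x y V hx hy l u.
rewrite cocycle_mapE; under eq_bigr do rewrite cocycle_mapE scaler_sumr.
rewrite exchange_big; apply: eq_bigr => k _ /=.
under eq_bigr do rewrite scalerA -cstM; rewrite -scaler_suml; congr (_ *: _).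
apply: OA_eq => z /=.
have valS (I : Type) (e : seq I) (G : I -> @OA K X K^o V) :
    val (\sum_(i <- e) G i) z = \sum_(i <- e) val (G i) z.
  exact: (big_morph (fun f : @OA K X K^o V => val f z)).
rewrite valS /= /cstA mxE; apply: eq_bigr => j _; exact: mulrC.
Qed.

End Existence.

End DefIso.

(** * Deformations over K (+) K^r as r-tuples of deformations over K[e] *)

Section Components.
Variables (K : fieldType) (X : projvar K) (E : opsh X K^o) (W : cover X) (r : nat).
Notation open := (opens (pts X)).

Definition cocycle_comp (g : cocycle E W r) (k : 'I_r) : cocycle E W 1.
Proof.
exists (fun x y V hx hy _ s => cc g hx hy k s).
- by move=> x y V hx hy _ f s t; exact: ccL.
- by move=> x y V V' hx hy VV hx' hy' _ s; exact: cc_res.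
- by move=> x y z V hx hy hz _ s; exact: ccC.
Defined.

Definition cocycle_tuple (g : 'I_r -> cocycle E W 1) : cocycle E W r.
Proof.
exists (fun x y V hx hy k s => cc (g k) hx hy ord0 s).
- by move=> x y V hx hy k f s t; exact: ccL.
- by move=> x y V V' hx hy VV hx' hy' k s; exact: cc_res.
- by move=> x y z V hx hy hz k s; exact: ccC.
Defined.

Lemma cocycle_compE (g : cocycle E W r) k x y (V : open) (hx : V `<=` W x)
    (hy : V `<=` W y) l u : cc (cocycle_comp g k) hx hy l u =
  \sum_j @cst K X K^o V ((delta_mx k 0 : 'M[K]_(r, 1)) j l) *: cc g hx hy j u.
Proof.
rewrite (bigD1 k) //= mxE !ord1 !eqxx cst1 scale1r big1 ?addr0 // => j jk.
by rewrite mxE (negPf jk) cst0 scale0r.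
Qed.

Definition comp_map (g : cocycle E W r) k := glued_map (cocycle_compE g k).

Lemma gloc_comp (g : cocycle E W r) k (V : open) (p : glued g V) x l :
  gloc (comp_map g k V p) x l = gloc p x k.
Proof.
rewrite [LHS](gloc_map (cocycle_compE g k)) (bigD1 k) //= mxE !ord1 !eqxx cst1 scale1r.
by rewrite big1 ?addr0 // => j jk; rewrite mxE (negPf jk) cst0 scale0r.
Qed.

Variables (g g' : cocycle E W r).
Variable f : forall k, omor_lin (glued (cocycle_comp g k)) (glued (cocycle_comp g' k)).
Hypothesis fE : forall k (V : open) p, gbase (f k V p) = gbase p.

(** The components of [p] share one base section, which every [f k] preserves; the coordinates of
    their images therefore form one section again. *)
Definition prod_fun (V : open) (p : glued g V) : glued g' V.
Proof.
exists (gbase p, fun x k => gloc (f k V (comp_map g k V p)) x ord0).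
move=> x y V' h ix iy hx hy k /=.
by rewrite (glocE _ h ix iy hx hy) fE.
Defined.

Lemma gloc_prod (V : open) (p : glued g V) x k :
  gloc (prod_fun p) x k = gloc (f k V (comp_map g k V p)) x ord0.
Proof. by []. Qed.

Lemma gbase_prod (V : open) (p : glued g V) : gbase (prod_fun p) = gbase p.
Proof. by []. Qed.

Lemma prod_funD V (p q : glued g V) : prod_fun (p + q) = prod_fun p + prod_fun q.
Proof.
apply: glued_eq => [|x k]; first by rewrite gbaseD !gbase_prod gbaseD.
by rewrite glocD !gloc_prod !ofunD glocD.
Qed.

Lemma prod_funZ V (a : @OA K X (sqz_art K r) V) (p : glued g V) :
  prod_fun (a *: p) = a *: prod_fun p.
Proof.
apply: glued_eq => [|x k]; first by rewrite gbaseZ !gbase_prod gbaseZ.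
rewrite glocZ !gloc_prod ofunZ omor_linZ glocZ fE coef0_map.
congr (_ + resA _ _ *: _); rewrite coef_map (bigD1 k) //= mxE !eqxx cst1 mul1r.
by rewrite big1 ?addr0 // => j jk; rewrite mxE (negPf jk) cst0 mul0r.
Qed.

Lemma prod_fun_res (V V' : open) (VV : V' `<=` V) (p : glued g V) :
  prod_fun (res VV p) = res VV (prod_fun p).
Proof.
apply: glued_eq => [|x k]; first by rewrite /= gbase_prod !gbase_res gbase_prod.
by rewrite gloc_prod 2!ofun_res /= !gloc_res gloc_prod.
Qed.

Definition prod_mor : omor_lin (glued g) (glued g') :=
  omor_lin_of prod_funD prod_funZ prod_fun_res.

Lemma comp_prod k (V : open) (p : glued g V) :
  comp_map g' k V (prod_mor V p) = f k V (comp_map g k V p).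
Proof.
apply: glued_eq => [|x l]; first by rewrite fE.
rewrite gloc_comp gloc_prod; congr (gloc _ x _).
by apply: val_inj; rewrite [l]ord1.
Qed.

End Components.

Section Products.
Variables (K : fieldType) (X : projvar K) (E : opsh X K^o).
Hypotheses (sE : is_sheaf E) (fE : locally_free E).
Local Notation F := (Def E).

Lemma glued_comp_ext (W : cover X) r (g : cocycle E W r) k :
  dext (d := F) (sqz_mor (delta_mx k 0 : 'M[K]_(r, 1)))
    (glued_def g sE fE) (glued_def (cocycle_comp g k) sE fE).
Proof. exact/glued_map_ext/cocycle_compE. Qed.

Lemma glued_prod_iso (W : cover X) r (g g' : cocycle E W r) :
  (forall k, diso (d := F) (glued_def (cocycle_comp g k) sE fE)
                           (glued_def (cocycle_comp g' k) sE fE)) ->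
  diso (d := F) (glued_def g sE fE) (glued_def g' sE fE).
Proof.
move=> fs.
have ex2 k : exists ff : (omor_lin (glued (cocycle_comp g k)) (glued (cocycle_comp g' k)) *
                         omor_lin (glued (cocycle_comp g' k)) (glued (cocycle_comp g k)))%type,
   [/\ forall V p, gbase (ff.1 V p) = gbase p, forall V p, gbase (ff.2 V p) = gbase p
     & forall V, cancel (ff.1 V) (ff.2 V) /\ cancel (ff.2 V) (ff.1 V)].
  have [f [bf fE']] := fs k; have [f' f'E] := omor_lin_inv bf.
  exists (f, f'); split; [exact: fE'| |exact: f'E].
  by move=> V p /=; have /esym := fE' V (f' V p); rewrite (f'E V).2.
pose ff k := sval (cid (ex2 k)).
have ffP k : [/\ forall V p, gbase ((ff k).1 V p) = gbase p,
    forall V p, gbase ((ff k).2 V p) = gbase p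
     & forall V, cancel ((ff k).1 V) ((ff k).2 V) /\ cancel ((ff k).2 V) ((ff k).1 V)].
  exact: (svalP (cid (ex2 k))).
have f1 k (V : opens (pts X)) p : gbase ((ff k).1 V p) = gbase p by case: (ffP k).
have f2 k (V : opens (pts X)) p : gbase ((ff k).2 V p) = gbase p by case: (ffP k).
pose u := prod_mor f1; pose v := prod_mor f2.
have uv V : cancel (u V) (v V).
  move=> p; apply: glued_eq => // x k.
  rewrite gloc_prod comp_prod; have [_ _ /(_ V)[-> _]] := ffP k.
  exact: gloc_comp.
have vu V : cancel (v V) (u V).
  move=> p; apply: glued_eq => // x k.
  rewrite gloc_prod comp_prod; have [_ _ /(_ V)[_ ->]] := ffP k.
  exact: gloc_comp.
by exists u; split=> // V; exists (v V).
Qed.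

(** Over a common cover, isomorphisms between the components of two cocycles assemble to one between
    the glued deformations. With [def_prod_surj] this is the bijectivity on which the addition of
    tangent vectors rests. *)
Lemma def_prod_inj r (D D' : dob F (sqz_art K r)) :
  (forall k : 'I_r, exists D1 D1', [/\ dext (sqz_mor (delta_mx k 0 : 'M[K]_(r, 1))) D D1,
     dext (sqz_mor (delta_mx k 0 : 'M[K]_(r, 1))) D' D1' & diso D1 D1']) ->
  diso D D'.
Proof.
move=> DD; have [W1 W1P] := def_normal_form sE fE D.
have [W2 W2P] := def_normal_form sE fE D'.
have [g Dg] := W1P _ (@coverIl _ _ W1 W2).
have [g' Dg'] := W2P _ (@coverIr _ _ W1 W2).
apply: (def_iso_trans Dg); apply: def_iso_trans (def_iso_sym Dg').
apply: glued_prod_iso => k.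
have [D1 [D1' [e1 e1' i1]]] := DD k.
apply: (@def_iso_trans _ _ _ _ _ D1).
  by apply: def_ext_uniq (def_iso_sym Dg) _ e1; [exact: sE|exact: glued_comp_ext].
apply: def_iso_trans i1 _.
by apply: def_ext_uniq Dg' e1' _; [exact: sE|exact: glued_comp_ext].
Qed.

(** Over a common cover the r cocycles are placed side by side. *)
Lemma def_prod_surj r (D : 'I_r -> dob F (sqz_art K 1)) :
  exists D', forall k, dext (sqz_mor (delta_mx k 0 : 'M[K]_(r, 1))) D' (D k).
Proof.
have /choice[W WP] k := def_normal_form sE fE (D k).
pose W' : cover X := @Defs.Cover K X (fun x => opens_bigcap (fun k => W k x))
  (fun x k => covP (W k) x).
have /choice[g gP] k : exists g : cocycle E W' 1, diso (D k) (glued_def g sE fE).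
  by apply: WP => x y; exact.
exists (glued_def (cocycle_tuple g) sE fE) => k.
apply: (def_ext_iso (def_iso_refl _) _ (def_iso_sym (gP k))).
apply: glued_map_ext => x y V hx hy l u.
rewrite (bigD1 k) //= mxE !ord1 !eqxx cst1 scale1r big1 ?addr0 // => j jk.
by rewrite mxE (negPf jk) cst0 scale0r.
Qed.

End Products.

(** * The tangent space of Def *)

Section TangentSpace.
Variables (K : fieldType) (X : projvar K) (E : opsh X K^o).
Hypotheses (sE : is_sheaf E) (fE : locally_free E).
Local Notation F := (Def E).
Local Notation ob r := (dob F (sqz_art K r)).
Local Notation ext M D D1 := (dext (d := F) (sqz_mor M) D D1).
Local Notation iso D D' := (diso (d := F) D D').
Local Notation tan0 := (@tan_zero K F).
Local Notation cls D := (iso_class (F := F) D).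
Local Notation "A ~~ B" := (same_class A B) (at level 70).

Let tr := @def_iso_trans K X E.
Let sy := @def_iso_sym K X E.
Let rf := @def_iso_refl K X E.

(** Extend [D1] along N by existence; composition and uniqueness identify the result with [D2]. *)
Lemma ext_factor r s t (M : 'M[K]_(r, s)) (N : 'M[K]_(s, t)) (D : ob r) (D1 : ob s)
    (D2 : ob t) : ext M D D1 -> ext (M *m N) D D2 -> ext N D1 D2.
Proof.
move=> e e'; have [Y eY] := def_ext_exists sE fE N D1.
apply: (def_ext_iso (rf _) eY).
exact: (def_ext_uniq sE (rf D) (def_ext_comp sE fE e eY) e').
Qed.

Lemma ext_cols r r' s (A : 'M[K]_(r, s)) (B : 'M[K]_(r', s)) (D : ob r) (D' : ob r')
    (Y Y' : ob s) : ext A D Y -> ext B D' Y' ->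
  (forall k, exists Z Z' : ob 1, [/\ ext (A *m delta_mx k 0) D Z,
     ext (B *m delta_mx k 0) D' Z' & iso Z Z']) -> iso Y Y'.
Proof.
move=> eA eB cols; apply: (def_prod_inj sE fE) => k.
have [Z [Z' [eZ eZ' ZZ]]] := cols k.
by exists Z, Z'; split => //; [exact: (ext_factor eA eZ)|exact: (ext_factor eB eZ')].
Qed.

Lemma cls_iso A (D D' : dob F A) : iso D D' -> cls D ~~ cls D'.
Proof. by move=> DD D0; split; apply: tr; [apply: sy|]. Qed.

Lemma fmap_cls (A B : artType K) (phi : {lrmorphism A -> B}) (D : dob F A) (D1 : dob F B)
    (C : dob F A -> Prop) :
  C ~~ cls D -> dext phi D D1 -> fmap phi C ~~ cls D1.
Proof.
move=> CD e D'; split=> [[D0 [D0' [/CD DD0 e0 i0]]]|i].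
  exact: (tr (def_ext_uniq sE DD0 e e0) i0).
by exists D, D1; split=> //; apply/CD; exact: rf.
Qed.

Lemma same_class_sym A (C C' : dob F A -> Prop) : C ~~ C' -> C' ~~ C.
Proof. by move=> CC D; split=> /CC. Qed.

Lemma same_class_refl A (C : dob F A -> Prop) : C ~~ C.
Proof. by []. Qed.

Lemma same_class_trans A (C C' C'' : dob F A -> Prop) : C ~~ C' -> C' ~~ C'' -> C ~~ C''.
Proof. by move=> h h' D; split=> [/h/h'|/h'/h]. Qed.

Lemma cls_inj A (D D' : dob F A) : cls D ~~ cls D' -> iso D D'.
Proof. by move=> h; apply/h; exact: rf. Qed.

(** The zero matrix factors through $K^0$, and over K all deformations are isomorphic, by
    [def_prod_inj] with no components. *)
Lemma tan_zero_ext r (D : ob r) (D1 : ob 1) :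
  ext (0 : 'M_(r, 1)) D D1 -> tan0 ~~ cls D1.
Proof.
move=> e D'.
have [D0 e0] := def_ext_exists sE fE (0 : 'M_(r, 0)) D.
have [Y eY] := def_ext_exists sE fE (0 : 'M_(0, 1)) D0.
have e0Y := def_ext_comp sE fE e0 eY; rewrite mulmx0 in e0Y.
have D1Y : iso D1 Y by exact: (def_ext_uniq sE (rf D) e e0Y).
split=> [[Z [Z1 [_ eZ iZ]]]|i].
  apply: (tr D1Y); apply: (tr _ iZ); apply: (def_ext_uniq sE _ eY eZ).
  by apply: (def_prod_inj sE fE) => -[].
by exists D0, Y; split=> //; exact: (tr (sy D1Y) i).
Qed.

Lemma tan_zeroP r (D : ob r) (D1 : ob 1) :
  ext (0 : 'M_(r, 1)) D D1 -> forall Q, tan0 Q <-> iso D1 Q.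
Proof. by move=> e Q; exact: tan_zero_ext e Q. Qed.

Lemma tan_zero_cls (Q : ob 1) : tan0 Q -> tan0 ~~ cls Q.
Proof.
move=> zQ; have [Y eY] := def_ext_exists sE fE (0 : 'M_(1, 1)) Q.
apply: (same_class_trans (tan_zero_ext eY) _); apply: cls_iso.
by apply/(tan_zeroP eY).
Qed.

Lemma tan_zero_mul (a : K) r (c : 'cV[K]_r) (D : ob r) Q Q' :
  ext c D Q -> tan0 Q -> ext (a *: c) D Q' -> tan0 Q'.
Proof.
move=> e zQ e'.
have eQ : ext (a%:M) Q Q' by apply: (ext_factor e _); rewrite mul_mx_scalar.
have [Y eY] := def_ext_exists sE fE (0 : 'M_(1, 1)) Q.
have QY : iso Y Q by apply/(tan_zeroP eY).
have [Z eZ] := def_ext_exists sE fE a%:M Y.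
have e0 := def_ext_comp sE fE eY eZ; rewrite mul0mx in e0.
by apply/(tan_zeroP e0); exact: (def_ext_uniq sE QY eZ eQ).
Qed.

(** The matrix with columns u and w. Extending D along it gives the deformation over K[e1,e2]
    through which [tan_add] adds the tangent vectors of D along u and w. *)
Definition pair_mx r (u w : 'cV[K]_r) : 'M[K]_(r, 2) :=
  u *m delta_mx 0 0 + w *m delta_mx 0 1.

Lemma pair_mx_proj r (u w : 'cV[K]_r) : [/\ pair_mx u w *m proj1_mx K = u,
  pair_mx u w *m proj2_mx K = w & pair_mx u w *m sum_mx K = u + w].
Proof.
have dE (j : 'I_2) (P : 'M[K]_(2, 1)) :
    (delta_mx 0 j : 'M[K]_(1, 2)) *m P = (P j 0)%:M.
  by apply/matrixP => a b; rewrite !ord1 -rowE !mxE.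
by split; rewrite mulmxDl -!mulmxA !dE !mul_mx_scalar !mxE /= ?scale1r ?scale0r ?addr0 ?add0r.
Qed.

Lemma proj1_mxE : proj1_mx K = delta_mx 0 0.
Proof. by apply/matrixP => i j; rewrite !mxE !ord1 eqxx andbT. Qed.

Lemma proj2_mxE : proj2_mx K = delta_mx 1 0.
Proof. by apply/matrixP => i j; rewrite !mxE !ord1 eqxx andbT. Qed.

Lemma pair_iso (D D' : ob 2) Q1 Q2 Q1' Q2' :
  ext (proj1_mx K) D Q1 -> ext (proj2_mx K) D Q2 ->
  ext (proj1_mx K) D' Q1' -> ext (proj2_mx K) D' Q2' ->
  iso Q1 Q1' -> iso Q2 Q2' -> iso D D'.
Proof.
rewrite proj1_mxE proj2_mxE => e1 e2 e1' e2' i1 i2.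
apply: (def_prod_inj sE fE) => -[[|[|//]] k2].
  by exists Q1, Q1'; rewrite (_ : Ordinal k2 = 0) //; exact: val_inj.
by exists Q2, Q2'; rewrite (_ : Ordinal k2 = 1) //; exact: val_inj.
Qed.

Lemma tan_add_ext (D : ob 2) (Q1 Q2 Q : ob 1) (C1 C2 : ob 1 -> Prop) :
  ext (proj1_mx K) D Q1 -> ext (proj2_mx K) D Q2 -> ext (sum_mx K) D Q ->
  C1 ~~ cls Q1 -> C2 ~~ cls Q2 -> tan_add C1 C2 ~~ cls Q.
Proof.
move=> e1 e2 e h1 h2 D'; split=> [[D0 [D0' [[c1 c2] e0 i0]]]|i].
  have [Z1 eZ1] := def_ext_exists sE fE (proj1_mx K) D0.
  have [Z2 eZ2] := def_ext_exists sE fE (proj2_mx K) D0.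
  have i1 : iso Q1 Z1.
    apply: cls_inj; apply: (same_class_trans (same_class_sym h1) _).
    apply: (same_class_trans (same_class_sym c1) _).
    exact: (fmap_cls (same_class_refl _) eZ1).
  have i2 : iso Q2 Z2.
    apply: cls_inj; apply: (same_class_trans (same_class_sym h2) _).
    apply: (same_class_trans (same_class_sym c2) _).
    exact: (fmap_cls (same_class_refl _) eZ2).
  apply: (tr _ i0); apply: (def_ext_uniq sE _ e e0).
  exact: (pair_iso e1 e2 eZ1 eZ2 i1 i2).
exists D, Q; split=> //; split.
  by apply: (same_class_trans _ (same_class_sym h1)); exact: (fmap_cls (same_class_refl _) e1).
by apply: (same_class_trans _ (same_class_sym h2)); exact: (fmap_cls (same_class_refl _) e2).
Qed.

(** On row vectors this drops the i-th coordinate. It separates one vector from a family: the head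
    of a linear combination, or the last vector adjoined. *)
Definition skip_mx r (i : 'I_r.+1) : 'M[K]_(r.+1, r) :=
  \matrix_(k, j) (k == lift i j)%:R.

Lemma skip_mx_delta r (i : 'I_r.+1) (k : 'I_r) :
  skip_mx i *m delta_mx k 0 = delta_mx (lift i k) (0 : 'I_1).
Proof.
by rewrite -colE; apply/matrixP => a b; rewrite !mxE !ord1 eqxx andbT.
Qed.

Lemma skip_mx_col r (i : 'I_r.+1) (c : 'I_r.+1 -> K) :
  \col_k c k = delta_mx i 0 *m (c i)%:M + skip_mx i *m \col_k c (lift i k).
Proof.
apply/matrixP => a b; rewrite mul_mx_scalar !mxE !ord1 eqxx andbT.
case: (unliftP i a) => [j|] ->.
  rewrite eq_sym (negPf (neq_lift i j)) mulr0 add0r (bigD1 j) //= !mxE eqxx mul1r.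
  rewrite big1 ?addr0 // => l lj; rewrite !mxE.
  by rewrite (inj_eq lift_inj) eq_sym (negPf lj) mul0r.
rewrite eqxx mulr1 big1 ?addr0 // => l _; rewrite !mxE.
by rewrite (negPf (neq_lift i l)) mul0r.
Qed.

(* If D over K (+) K^r induces the classes v_k along the coordinate projections,
   the raw operations of the tangent space on the v_k are read off D. *)
Lemma lincomb_ext r (D : ob r) (P : 'I_r -> ob 1) (v : 'I_r -> ob 1 -> Prop) :
  (forall k, ext (delta_mx k 0 : 'M_(r, 1)) D (P k)) ->
  (forall k, v k ~~ cls (P k)) ->
  forall (c : 'I_r -> K) Q, ext (\col_k c k) D Q ->
    lincomb (V := tangent F) c v ~~ cls Q.
Proof.
elim: r D P v => [|r IH] D P v eP vP c Q eQ.
  rewrite /lincomb big_ord0; apply: (tan_zero_ext (D := D)).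
  by rewrite (_ : 0 = \col_k c k) //; apply/matrixP => -[].
rewrite /lincomb big_ord_recl.
have [D' eD'] := def_ext_exists sE fE (skip_mx ord0) D.
have eP' k : ext (delta_mx k 0 : 'M_(r, 1)) D' (P (lift ord0 k)).
  by apply: (ext_factor eD' _); rewrite skip_mx_delta.
have [Q2 eQ2] := def_ext_exists sE fE (\col_k c (lift ord0 k)) D'.
have h2 := IH D' _ (fun k => v (lift ord0 k)) eP' (fun k => vP _) _ _ eQ2.
have [Q1 eQ1] := def_ext_exists sE fE (c ord0)%:M (P ord0).
have h1 := fmap_cls (vP ord0) eQ1.
have eD1 := def_ext_comp sE fE (eP ord0) eQ1.
have eD2 := def_ext_comp sE fE eD' eQ2.
have [D2 eD] := def_ext_exists sE fE
  (pair_mx (delta_mx ord0 0 *m (c ord0)%:M) (skip_mx ord0 *m \col_k c (lift ord0 k))) D.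
have [p1 p2 p3] := pair_mx_proj (delta_mx ord0 0 *m (c ord0)%:M)
  (skip_mx ord0 *m \col_k c (lift ord0 k)).
apply: (@tan_add_ext D2 Q1 Q2 Q _ _ _ _ _ h1 h2).
- by apply: (ext_factor eD _); rewrite p1.
- by apply: (ext_factor eD _); rewrite p2.
- by apply: (ext_factor eD _); rewrite p3 -skip_mx_col.
Qed.

(** Linear independence of the r tangent vectors induced by D, free of the raw operations. *)
Definition independent r (D : ob r) : Prop :=
  forall (c : 'cV[K]_r) Q, ext c D Q -> tan0 Q -> c = 0.

Lemma col_fun r (c : 'cV[K]_r) : c = \col_k c k 0.
Proof. by apply/matrixP => i j; rewrite mxE ord1. Qed.

(** Adding a zero vector changes nothing: since the vector along u is zero, the extensions along
    [pair_mx u w] and [pair_mx 0 w] have isomorphic projections. *)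
Lemma ext_translate r (D : ob r) (u w : 'cV[K]_r) Q Q1 Q2 :
  ext u D Q -> tan0 Q -> ext w D Q1 -> ext (u + w) D Q2 -> iso Q1 Q2.
Proof.
move=> eu zQ ew euw.
have [Y eY] := def_ext_exists sE fE (pair_mx u w) D.
have [Y' eY'] := def_ext_exists sE fE (pair_mx 0 w) D.
have [p1 p2 p3] := pair_mx_proj u w.
have [q1 q2 q3] := pair_mx_proj 0 w; rewrite add0r in q3.
have [Z eZ] := def_ext_exists sE fE (0 : 'cV_r) D.
have ZQ : iso Z Q by apply/(tan_zeroP eZ).
have YY : iso Y' Y.
  apply: (@pair_iso Y' Y Z Q1 Q Q1 _ _ _ _ ZQ (rf _)).
  - by apply: (ext_factor eY' _); rewrite q1.
  - by apply: (ext_factor eY' _); rewrite q2.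
  - by apply: (ext_factor eY _); rewrite p1.
  - by apply: (ext_factor eY _); rewrite p2.
apply: (def_ext_uniq (phi := sqz_mor (sum_mx K)) sE YY).
  by apply: (ext_factor eY' _); rewrite q3.
by apply: (ext_factor eY _); rewrite p3.
Qed.

Lemma independent_of_dim d : has_dim (tangent F) d -> exists D : ob d, independent D.
Proof.
move=> [v [vin vfree _]].
have /choice[P PP] k : exists P : ob 1, v k ~~ cls P by have [P] := vin k; exists P.
have [D eD] := def_prod_surj sE fE P; exists D => c Q; rewrite {1}(col_fun c) => eQ zQ.
apply/matrixP => i j; rewrite ord1 mxE.
apply: (vfree (fun k => c k 0)).
apply: (same_class_trans (lincomb_ext eD PP eQ) _).
exact/same_class_sym/tan_zero_cls.
Qed.

(** A maximal independent family is a basis: adjoining any class Q creates a relation, which can be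
    solved for Q. *)
Lemma dim_of_independent d (D : ob d) : independent D ->
  ~ (exists D' : ob d.+1, independent D') -> has_dim (tangent F) d.
Proof.
move=> iD maxD.
have /choice[P eP] k := def_ext_exists sE fE (delta_mx k 0 : 'M_(d, 1)) D.
exists (fun k => cls (P k)); split.
- by move=> k; exists (P k).
- move=> c c0 k; have [Q eQ] := def_ext_exists sE fE (\col_k c k) D.
  have := lincomb_ext eP (fun k => same_class_refl _) eQ => lQ.
  have zQ : tan0 Q by apply/c0/lQ; exact: rf.
  by have /matrixP/(_ k 0) := iD _ _ eQ zQ; rewrite !mxE.
move=> w [Q wQ].
pose P' k := if unlift ord_max k is Some j then P j else Q.
have [D' eD'] := def_prod_surj sE fE P'.
have DD' : ext (skip_mx ord_max) D' D.
  have [Y eY] := def_ext_exists sE fE (skip_mx ord_max) D'.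
  apply: (def_ext_iso (rf _) eY); apply: (def_prod_inj sE fE) => k.
  exists (P k), (P k); split; [|exact: eP|exact: rf].
  apply: (ext_factor eY _); rewrite skip_mx_delta.
  by have := eD' (lift ord_max k); rewrite /P' liftK.
have [c [Q0 [ec zQ0 c0]]] : exists c Q0, [/\ ext c D' Q0, tan0 Q0 & c != 0].
  apply: contrapT => nc; apply: maxD; exists D' => c Q0 ec zQ0.
  by apply: contrapT => /eqP c0; apply: nc; exists c, Q0.
pose a := c ord_max 0; pose c' : 'cV_d := \col_k c (lift ord_max k) 0.
have cE : c = a *: delta_mx ord_max 0 + skip_mx ord_max *m c'.
  by rewrite {1}(col_fun c) (skip_mx_col ord_max) mul_mx_scalar.
(* With coefficient 0 at Q, the relation would be one among the vectors of D. *)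
have a0 : a != 0.
  apply: contra_neq c0 => a0; rewrite cE a0 scale0r add0r.
  rewrite (iD c' Q0) ?mulmx0 //.
  by apply: (ext_factor DD' _); move: ec; rewrite cE a0 scale0r add0r.
pose b : 'cV_d := - a^-1 *: c'.
have [Z eZ] := def_ext_exists sE fE (a^-1 *: c) D'.
have zZ := tan_zero_mul ec zQ0 eZ.
have [Q1 eQ1] := def_ext_exists sE fE b D.
have eQ1' := def_ext_comp sE fE DD' eQ1.
have Q1Q : iso Q1 Q.
  (* The relation divided by a, plus the combination b of the old vectors, is the last coordinate
     vector, along which D' induces Q. *)
  apply: (ext_translate eZ zZ eQ1').
  have -> : a^-1 *: c + skip_mx ord_max *m b = delta_mx ord_max 0.
    rewrite cE /b -scalemxAr scaleNr scalerDr addrK scalerA.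
    by rewrite mulVf // scale1r.
  by have := eD' ord_max; rewrite /P' unlift_none.
exists (fun k => b k 0); apply: (same_class_trans wQ _).
apply: (same_class_trans (cls_iso (sy Q1Q)) _); apply: same_class_sym.
apply: (lincomb_ext eP (fun k => same_class_refl _)).
by rewrite -col_fun.
Qed.

(** The largest length of an independent family is a dimension. The bound is given for every
    dimension because [edim] selects an unspecified one. *)
Lemma tangent_dim_bound N : (forall d (D : ob d), independent D -> (d <= N)%N) ->
  exists2 d, has_dim (tangent F) d &
    forall d', has_dim (tangent F) d' -> (d' <= N)%N.
Proof.
move=> bd.
pose Pd d := `[< exists D : ob d, independent D >].
have ex0 : exists d, Pd d.
  have [D _] := def_prod_surj sE fE (r := 0) (fun k => match k with Ordinal _ h =>
    match notF h with end end).
  by exists 0%N; apply/asboolP; exists D => c Q _ _; apply/matrixP => -[].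
have ubd d : Pd d -> (d <= N)%N by move=> /asboolP[D iD]; exact: bd iD.
have [d /asboolP[D iD] maxd] := ex_maxnP ex0 ubd.
exists d.
  apply: (dim_of_independent iD) => -[D' iD'].
  by have := maxd d.+1; rewrite ltnn => h; have : false by apply: h; apply/asboolP; exists D'.
by move=> d' /independent_of_dim[D' /bd].
Qed.

End TangentSpace.

(** * Sections and their obstructions *)

Section Pairs.
Variables (K : fieldType) (X : projvar K) (E : opsh X K^o).
Hypotheses (sE : is_sheaf E) (fE : locally_free E).
Variables (U : vectType K) (i : U -> gsec E).
Hypothesis i_linear : forall (a : K) (u v : U),
  i (a *: u + v) = ascale (a : K^o) (i u) + i v.
Local Notation F := (Def E).
Local Notation G := (PairDef i).
Local Notation "A ~~ B" := (same_class A B) (at level 70).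
Local Notation m := (\dim {:U}).
Local Notation u_ j := ((vbasis {:U})`_j).

Lemma emb0 : i 0 = 0.
Proof.
apply: (addrI (i 0)); have := i_linear 1 0 0.
by rewrite scale1r addr0 /ascale cst1 scale1r addr0 => <-.
Qed.

Lemma emb_sum n (a : 'I_n -> K) (u : 'I_n -> U) :
  i (\sum_j a j *: u j) = \sum_j ascale (a j : K^o) (i (u j)).
Proof.
have iD x y : i (x + y) = i x + i y.
  by rewrite -{1}[x]scale1r i_linear /ascale cst1 scale1r.
rewrite (big_morph i iD emb0); apply: eq_bigr => j _.
by rewrite -[a j *: u j]addr0 i_linear emb0 addr0.
Qed.

Section Lifts.
Variables (A : artType K) (D : deformation E A) (t : 'I_m -> gsec (dsh D)).
Hypothesis tE : forall j, dpi D _ (t j) = i (u_ j).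

Definition lifts_i (w : tensU U A) : gsec (dsh D) := \sum_j ascale (w 0 j) (t j).

Lemma lifts_iD v w : lifts_i (v + w) = lifts_i v + lifts_i w.
Proof.
rewrite /lifts_i -big_split; apply: eq_bigr => j _ /=.
by rewrite mxE /ascale cstD scalerDl.
Qed.

Lemma lifts_iZ a w : lifts_i (a *: w) = ascale a (lifts_i w).
Proof.
rewrite /lifts_i /ascale scaler_sumr; apply: eq_bigr => j _.
by rewrite mxE cstM scalerA.
Qed.

Lemma lifts_red w : dpi D _ (lifts_i w) = i (tensU_red w).
Proof.
rewrite /tensU_red emb_sum ofun_sum; apply: eq_bigr => j _.
by rewrite ofunZ tE pushA_cst.
Qed.

(** The A-linear map $U\otimes A\to H^0$ is free to be prescribed on the basis: a pair is made from
    one lift per basis section. *)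
Definition pair_of_lifts : pair_deformation i A := PairDeformation lifts_iD lifts_iZ lifts_red.

End Lifts.

Lemma pd_i_sum (A : artType K) (D : pair_deformation i A) w :
  pd_i D w = \sum_j ascale (w 0 j) (pd_i D (delta_mx 0 j)).
Proof.
rewrite {1}(row_sum_delta w).
have pd0 : pd_i D 0 = 0 by apply: (addrI (pd_i D 0)); rewrite -pd_iD !addr0.
rewrite (big_morph _ (pd_iD D) pd0).
by apply: eq_bigr => j _; rewrite pd_iZ.
Qed.

Lemma pair_ext_exists r s (M : 'M[K]_(r, s)) (D : dob G (sqz_art K r)) :
  exists D1 : dob G (sqz_art K s), dext (sqz_mor M) D D1.
Proof.
have [D1 [t [bt tE]]] := def_ext_exists sE fE M (pd_def D).
pose l j := t _ (pd_i D (delta_mx 0 j)).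
have lE j : dpi D1 _ (l j) = i (u_ j).
  rewrite tE pd_red /tensU_red; congr i.
  rewrite (bigD1 j) //= mxE !eqxx rmorph1 scale1r big1 ?addr0 // => k kj.
  by rewrite mxE (negPf kj) andbF rmorph0 scale0r.
exists (pair_of_lifts lE), t; split=> // w.
rewrite pd_i_sum ofun_sum; apply: eq_bigr => j _.
by rewrite ofunZ pushA_cst mxE.
Qed.

Lemma pair_iso_refl A (D : dob G A) : diso D D.
Proof.
exists (oid (dsh D)), idfun; split => //; last by exists id.
by split=> // V; exists id.
Qed.

Lemma forget_iso A (D D' : dob G A) : diso D D' -> diso (d := F) (pd_def D) (pd_def D').
Proof. by move=> [f [psi [fi _ _]]]; exists f. Qed.

Lemma forget_ext (A B : artType K) (phi : {lrmorphism A -> B}) (D : dob G A) (D1 : dob G B) :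
  dext phi D D1 -> dext (d := F) phi (pd_def D) (pd_def D1).
Proof. by move=> [t [te _]]; exists t. Qed.

Lemma same_class_mem (C : dob F (sqz_art K 1) -> Prop) Y Z :
  C ~~ iso_class Y -> C Z -> C ~~ iso_class Z.
Proof.
move=> CY CZ; apply: (same_class_trans CY); apply: cls_iso; exact/CY.
Qed.

(** In t_Def(E) a combination is a single isomorphism class, so one member determines it; this lets
    the induction match the two summands after forgetting. For pairs only membership is followed. *)
Lemma forget_lincomb n (P : 'I_n -> dob G (sqz_art K 1)) v :
  (forall k, v k ~~ iso_class (P k)) ->
  forall (c : 'I_n -> K) Q, lincomb (V := tangent G) c v Q ->
  lincomb (V := tangent F) c (fun k => iso_class (F := F) (pd_def (P k))) (pd_def Q).
Proof.
elim: n P v => [|n IH] P v vP c Q.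
  rewrite /lincomb !big_ord0 => -[D [D1 [_ e DQ]]].
  by exists (pd_def D), (pd_def D1); split=> //; [exact: forget_ext|exact: forget_iso].
rewrite /lincomb !big_ord_recl => -[D2 [D1 [[c1 c2] e DQ]]].
have [Z1 e1] := pair_ext_exists (proj1_mx K) D2.
have [Z2 e2] := pair_ext_exists (proj2_mx K) D2.
have /c1 [D [D' [vD eD iD']]] : fmap (sqz_mor (proj1_mx K)) (iso_class D2) Z1.
  by exists D2, Z1; split => //; exact: pair_iso_refl.
have /c2 /(IH (fun k => P (lift ord0 k)) _ (fun k => vP _) (fun k => c _)) l2 :
    fmap (sqz_mor (proj2_mx K)) (iso_class D2) Z2.
  by exists D2, Z2; split => //; exact: pair_iso_refl.
exists (pd_def D2), (pd_def D1); split; [split|exact: forget_ext|exact: forget_iso].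
  apply: (same_class_trans (fmap_cls sE (same_class_refl _) (forget_ext e1))).
  apply: same_class_sym.
  have [Y eY] := def_ext_exists sE fE (c ord0)%:M (pd_def (P ord0)).
  apply: (same_class_mem (fmap_cls sE (same_class_refl _) eY)).
  exists (pd_def D), (pd_def D'); split.
  - by apply: forget_iso; apply/vP.
  - exact: forget_ext.
  - exact: forget_iso.
apply: (same_class_trans (fmap_cls sE (same_class_refl _) (forget_ext e2))).
apply: same_class_sym.
have [V eV] := def_prod_surj sE fE (fun k => pd_def (P (lift ord0 k))).
have [Y eY] := def_ext_exists sE fE (\col_k c (lift ord0 k)) V.
exact: same_class_mem (lincomb_ext sE fE eV (fun k => same_class_refl _) eY) l2.
Qed.

End Pairs.

(** * Lifting sections and their Cech obstructions *)

Section GluedSection.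
Variables (K : fieldType) (X : projvar K) (E : opsh X K^o) (r : nat).
Hypothesis sE : is_sheaf E.
Variables (W W' : cover X) (g : cocycle E W r) (W'W : refines W' W).
Notation open := (opens (pts X)).

(** Over [W' x] take the lift of u with coordinates $b_x$; the hypothesis $g_{xy}(u)=b_x-b_y$ is the
    transition rule, so these lifts glue. *)
Lemma glued_gsec (u : gsec E) (b : forall x, 'I_r -> E (W' x)) :
  (forall x y (V : open) (hx : V `<=` W' x) (hy : V `<=` W' y) (hu : V `<=` opens_full (pts X)) k,
     cc g (subset_trans hx (@W'W x)) (subset_trans hy (@W'W y)) k (res hu u) =
     res hx (b x k) - res hy (b y k)) ->
  exists T : gsec (glued g), gbase T = u.
Proof.
move=> bP.
pose R (V : open) (p : glued g V) := exists (hV : V `<=` opens_full (pts X)) y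
  (hy : V `<=` W' y),
  p = glued_lift g (subset_trans hy (@W'W y)) (res hV u) (fun k => res hy (b y k)).
have [||x _|T TE] := @sheaf_glue _ _ _ _ (glued_is_sheaf g sE) (opens_full (pts X)) R.
- move=> V V' VV _ [hV [y [hy ->]]].
  exists (subset_trans VV hV), y, (subset_trans VV hy).
  have hW := subset_trans hy (@W'W y).
  apply: (glued_eq_at (hx := subset_trans (subset_trans VV hy) (@W'W y))) => [|k].
    by rewrite /= gbase_res !gbase_lift resK.
  by rewrite (gcoord_res _ (subset_trans hy (@W'W y))) !gcoord_lift resK.
- move=> V _ _ VU [hV [y [hy ->]]] [hV' [y' [hy' ->]]].
  apply: (glued_eq_at (hx := subset_trans hy (@W'W y))) => [|k].
    by rewrite !gbase_lift; exact: res_irr.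
  rewrite gcoord_lift (gcoordE _ (subset_trans hy' (@W'W y'))) gcoord_lift gbase_lift.
  by rewrite bP addrC subrK.
- exists (W' x); split; [exact: covP|by []|].
  pose h : W' x `<=` opens_full (pts X) := fun _ _ => I.
  exists (glued_lift g (subset_trans (@subset_refl _ _) (@W'W x)) (res h u)
    (fun k => res (@subset_refl _ _) (b x k))).
  by exists h, x, (@subset_refl _ _).
exists T; apply: (sheaf_eq sE) => x _.
pose h : W' x `<=` opens_full (pts X) := fun _ _ => I.
exists (W' x), h; split; first exact: covP.
have := TE (W' x) h _ (ex_intro _ h (ex_intro _ x (ex_intro _ (@subset_refl _ _) erefl))).
by move=> /(congr1 (@gbase _ _ _ _ _ _ _)); rewrite gbase_lift.
Qed.

End GluedSection.

Lemma res_ascale (K : fieldType) (X : projvar K) (A : comAlgType K) (M : opsh X A)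
    (U V : opens (pts X)) (VU : V `<=` U) (a : A) (s : M U) :
  res VU (ascale a s) = ascale a (res VU s).
Proof. by rewrite /ascale resZ resA_cst. Qed.

Section CechLincomb.
Variables (K : fieldType) (X : projvar K) (E : opsh X K^o) (p : nat).

(** Each raw addition passes to an intersection of covers; on a refinement of the final cover it
    becomes an ordinary sum of restrictions. *)
Lemma lincomb_cech n (a : 'I_n -> K) (B : 'I_n -> cech_elt E p) (V : cover X)
    (h : refines V (ccov (lincomb (V := cohomology E p) a B))) :
  exists hB : forall l, refines V (ccov (B l)), forall s,
    cres h (ccoch (lincomb (V := cohomology E p) a B)) s =
    \sum_l ascale (a l : K^o) (cres (hB l) (ccoch (B l)) s).
Proof.
elim: n a B V h => [|n IH] a B V; rewrite /lincomb ?big_ord0 ?big_ord_recl.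
  move=> h; have hB (l : 'I_0) : refines V (ccov (B l)) by case: l.
  exists hB => s; by rewrite big_ord0 /cres res0.
move=> h; have h0 : refines V (ccov (B ord0)) by move=> x y /h[].
have h' : refines V (ccov (lincomb (V := cohomology E p)
    (fun l => a (lift ord0 l)) (fun l => B (lift ord0 l)))) by move=> x y /h[].
have [hB hBE] := IH _ _ V h'.
have hB' l : refines V (ccov (B l)).
  by case: (unliftP ord0 l) => [l'|] ->; [exact: hB|exact: h0].
exists hB' => s; rewrite big_ord_recl /cres /= resD !resK.
rewrite {1}/ascale resZ resA_cst -/(ascale _ _); congr (ascale _ _ + _).
  exact: res_irr.
rewrite (res_irr _ (@capU_refines _ _ _ _ h' p s)); rewrite -[LHS]/(cres h' _ s) hBE.
by apply: eq_bigr => l _; congr ascale; exact: res_irr.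
Qed.

End CechLincomb.

Section Obstruction.
Variables (K : fieldType) (X : projvar K) (E : opsh X K^o).
Notation open := (opens (pts X)).
Variables (W : cover X) (d : nat) (g : cocycle E W d) (u : gsec E).

Lemma capU_proj (V : cover X) n (s : 'I_n.+1 -> pts X) j : capU V s `<=` V (s j).
Proof. by move=> y; apply. Qed.
Arguments capU_proj V [n] s j [_] _.

Lemma sub_full (V : open) : V `<=` opens_full (pts X).
Proof. by []. Qed.
Arguments sub_full V [_] _.

Lemma cc_idx x x' y y' (V : open) (hx : V `<=` W x) (hx' : V `<=` W x')
    (hy : V `<=` W y) (hy' : V `<=` W y') k s : x = x' -> y = y' ->
  cc g hx hy k s = cc g hx' hy' k s.
Proof.
move=> ex ey; move: hx' hy'; rewrite -ex -ey => hx' hy'.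
by rewrite (Prop_irrelevance hx hx') (Prop_irrelevance hy hy').
Qed.

Definition obstruction (k : 'I_d) : cech_elt E 1 := @CechElt K X E 1 W
  (fun s => cc g (capU_proj W s ord0) (capU_proj W s ord_max) k (res (sub_full _) u)).

(** The differential is $c_{12}-c_{02}+c_{01}$, which vanishes by [ccC]. *)
Lemma obstruction_in k : vin (r := cohomology E 1) (obstruction k).
Proof.
move=> s; rewrite /cdiff !big_ord_recl big_ord0 addr0 /=.
pose c (a b : 'I_3) := cc g (capU_proj W s a) (capU_proj W s b) k (res (sub_full _) u).
have cE (j a b : 'I_3) : lift j ord0 = a -> lift j ord_max = b ->
    res (@capU_face _ _ W _ s j) (ccoch (obstruction k) (s \o lift j)) = c a b.
  move=> ja jb; have fa := capU_proj W s (lift j ord0).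
  have fb := capU_proj W s (lift j ord_max).
  rewrite /= (cc_res _ _ _ _ fa fb) resK.
  rewrite /c (res_irr _ (sub_full (capU W s))).
  by apply: cc_idx; rewrite ?ja ?jb.
rewrite (cE _ (inord 1) (inord 2)); try by apply: val_inj; rewrite /= inordK.
rewrite (cE _ (inord 0) (inord 2)); try by apply: val_inj; rewrite /= inordK.
rewrite (cE _ (inord 0) (inord 1)); try by apply: val_inj; rewrite /= inordK.
rewrite /bump /= expr0 scale1r expr1 scaleN1r -signr_odd /= expr0 scale1r.
rewrite /c addrCA [X in _ + X]addrC. by rewrite ccC addNr.
Qed.

(* Restricting an equation between 1-cochains to a smaller open set turns a
   coboundary into a difference of sections attached to the two points. *)
Lemma cdiff1 (V : cover X) (b : cochain E V 0) (s : 'I_2 -> pts X) (U : open)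
    (h : U `<=` capU V s) (h0 : U `<=` capU V (p := 0) (fun=> s ord0))
    (h1 : U `<=` capU V (p := 0) (fun=> s ord_max)) :
  res h (cdiff b s) = res h1 (b (fun=> s ord_max)) - res h0 (b (fun=> s ord0)).
Proof.
have bE (t t' : 'I_1 -> pts X) (ht : U `<=` capU V t) (ht' : U `<=` capU V t') :
    t = t' -> res ht (b t) = res ht' (b t').
  by move=> tt; move: ht'; rewrite -tt => ht'; exact: res_irr.
rewrite /cdiff !big_ord_recl big_ord0 addr0 /= expr0 scale1r expr1 scaleN1r.
rewrite resB !resK; congr (_ - _); apply: bE; apply/funext => j; congr s;
  by apply: val_inj; rewrite /= (ord1 j).
Qed.

(** The combination of the obstructions has class $\sum_l(\sum_k c_ka_{kl})B_l=0$; the cochains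
    witnessing the given equalities combine to one that bounds it. *)
Lemma obstruction_kill h (B : 'I_h -> cech_elt E 1) (a : 'I_d -> 'I_h -> K) (c : 'I_d -> K) :
  (forall k, cech_eq (obstruction k) (lincomb (V := cohomology E 1) (a k) B)) ->
  (forall l, \sum_k c k * a k l = 0) ->
  exists (W' : cover X) (W'W : refines W' W) (b : forall x, E (W' x)),
  forall x y (V : open) (hx : V `<=` W' x) (hy : V `<=` W' y) (hu : V `<=` opens_full (pts X)),
     \sum_k @cst K X K^o V (c k) *:
       cc g (subset_trans hx (@W'W x)) (subset_trans hy (@W'W y)) k (res hu u) =
     res hx (b x) - res hy (b y).
Proof.
move=> zB ca.
pose pt (x y : pts X) : 'I_2 -> pts X := fun j => if j == ord0 then x else y.
have ex k : exists Vb : {V : cover X & forall x, E (V x)},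
    refines (projT1 Vb) W /\ forall x y (U : open)
      (hx : U `<=` projT1 Vb x) (hy : U `<=` projT1 Vb y) (wx : U `<=` W x) (wy : U `<=` W y),
    exists hB : forall l, U `<=` capU (ccov (B l)) (pt x y),
    cc g wx wy k (res (sub_full U) u) = res hy (projT2 Vb y) - res hx (projT2 Vb x) +
      \sum_l ascale (a k l : K^o) (res (hB l) (ccoch (B l) (pt x y))).
  have [V [VW [VL [b bE]]]] := zB k.
  have hc x : V x `<=` capU V (p := 0) (fun=> x) by move=> y Vy j.
  exists (existT _ V (fun x => res (hc x) (b (fun=> x)))); split=> //= x y U hx hy wx wy.
  have hs : U `<=` capU V (pt x y).
    by move=> z Uz j; rewrite /pt; case: ifP => _; [exact: hx|exact: hy].
  have [hB hBE] := lincomb_cech VL.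
  exists (fun l => subset_trans hs (@capU_refines _ _ _ _ (hB l) 1 (pt x y))).
  have := congr1 (res hs) (bE (pt x y)); rewrite hBE resB => /eqP; rewrite subr_eq => /eqP e.
  have hx' : U `<=` capU V (p := 0) (fun=> pt x y ord0) by move=> z Uz j; exact: hx.
  have hy' : U `<=` capU V (p := 0) (fun=> pt x y ord_max) by move=> z Uz j; exact: hy.
  rewrite (cdiff1 _ _ hx' hy') in e; rewrite !resK.
  rewrite (res_irr _ hx') (res_irr (subset_trans hy (hc y)) hy').
  have eS : res hs (\sum_l ascale (a k l : K^o) (cres (hB l) (ccoch (B l)) (pt x y))) =
      \sum_l ascale (a k l : K^o) (res (subset_trans hs (@capU_refines _ _ _ _ (hB l) 1 (pt x y)))
        (ccoch (B l) (pt x y))).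
    rewrite res_sum; apply: eq_bigr => l _; rewrite -resK; exact: res_ascale.
  rewrite -eS -e; rewrite /cres resK /= (cc_res _ _ _ _ wx wy) resK.
  by congr (cc g _ _ k _); exact: res_irr.
have /choice[Vb VbP] := ex.
pose V k := projT1 (Vb k); pose b k x : E (V k x) := projT2 (Vb k) x.
pose W' : cover X := @Defs.Cover K X
  (fun x => opensI (W x) (opens_bigcap (fun k => V k x)))
  (fun x => conj (covP W x) (fun k => covP (V k) x)).
have W'W : refines W' W by move=> x y [].
have W'V k : refines W' (V k) by move=> x y [_]; apply.
(* The sign is reversed because the Cech differential is $b_y-b_x$, while the conclusion has
   $b_x-b_y$. *)
exists W', W'W, (fun x => - \sum_k @cst K X K^o _ (c k) *: res (@W'V k x) (b k x)).
move=> x y U hx hy hu; rewrite (Prop_irrelevance hu (sub_full U)).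
have bE k := (VbP k).2 x y U (subset_trans hx (@W'V k x)) (subset_trans hy (@W'V k y))
  (subset_trans hx (@W'W x)) (subset_trans hy (@W'W y)).
(* Each k comes with its own inclusions [hB]. [Bl] does not depend on k, which permits exchanging
   the sums; the default 0 is not met in [bE']. *)
pose Bl l : E U := if pselect (U `<=` capU (ccov (B l)) (pt x y)) is left hl
  then res hl (ccoch (B l) (pt x y)) else 0.
have bE' k : cc g (subset_trans hx (@W'W x)) (subset_trans hy (@W'W y)) k (res (sub_full U) u) =
    res (subset_trans hy (@W'V k y)) (b k y) - res (subset_trans hx (@W'V k x)) (b k x) +
      \sum_l ascale (a k l : K^o) (Bl l).
  have [hB ->] := bE k; congr (_ + _); apply: eq_bigr => l _; congr ascale.
  by rewrite /Bl; case: pselect => [hl|/(_ (hB l))//]; exact: res_irr.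
under eq_bigr do rewrite bE' scalerDr.
rewrite big_split /= [X in _ + X](_ : _ = 0) ?addr0.
  rewrite !resN opprK !res_sum addrC -sumrB; apply: eq_bigr => k _.
  by rewrite scalerBr !resZ !resA_cst !resK.
under eq_bigr do rewrite scaler_sumr.
rewrite exchange_big big1 // => l _.
under eq_bigr do rewrite scalerA -cstM; rewrite -scaler_suml.
have -> : \sum_k @cst K X K^o U (c k * a k l) = cst U (\sum_k c k * a k l : K^o).
  by apply/esym/(big_morph (@cst K X K^o U)) => [p q|]; [exact: cstD|exact: cst0].
by rewrite ca cst0 scale0r.
Qed.

End Obstruction.

(** * The dimension estimate *)

Section Bound.
Variables (K : fieldType) (X : projvar K) (E : opsh X K^o).
Hypotheses (sE : is_sheaf E) (fE : locally_free E).
Variables (U : vectType K) (i : U -> gsec E).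
Hypothesis i_linear : forall (a : K) (u v : U),
  i (a *: u + v) = ascale (a : K^o) (i u) + i v.
Local Notation F := (Def E).
Local Notation G := (PairDef i).
Local Notation ob r := (dob F (sqz_art K r)).
Local Notation ext M D D1 := (dext (d := F) (sqz_mor M) D D1).
Local Notation iso D D' := (diso (d := F) D D').
Local Notation "A ~~ B" := (same_class A B) (at level 70).
Local Notation m := (\dim {:U}).
Local Notation u_ j := ((vbasis {:U})`_j).

Lemma lift_of_obstruction (W : cover X) d (g : cocycle E W d) h
    (B : 'I_h -> cech_elt E 1) (a : 'I_m -> 'I_d -> 'I_h -> K) (c : 'cV[K]_d) :
  (forall (j : 'I_m) k, cech_eq (obstruction g (i (u_ j)) k)
     (lincomb (V := cohomology E 1) (a j k) B)) ->
  (forall j l, \sum_k c k 0 * a j k l = 0) ->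
  exists P : dob G (sqz_art K 1), pd_def P = glued_def (cocycle_map c g) sE fE.
Proof.
move=> zB ca.
have lift (j : 'I_m) : exists T : gsec (glued (cocycle_map c g)), gbase T = i (u_ j).
  have [W' [W'W [b bP]]] := obstruction_kill (zB j) (ca j).
  apply: (glued_gsec sE (W'W := W'W) (b := fun x _ => b x)) => x y V hx hy hu k.
  by rewrite cocycle_mapE -(bP x y V hx hy hu) (ord1 k).
have /choice[t tE] := lift.
by exists (@pair_of_lifts _ _ _ _ i i_linear _ (glued_def (cocycle_map c g) sE fE) t tE).
Qed.

(* The combinations of the components of D whose obstructions vanish form a space
   of dimension greater than n if d > n + m h; they lift to pairs, hence are
   combinations of the images of a basis of t_Def(E,U), and some nontrivial
   one of them is zero. *)
Lemma dim_bound n h d (D : ob d) :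
  has_dim (tangent G) n -> ((0 < m)%N -> has_dim (cohomology E 1) h) ->
  independent D -> (d <= n + m * h)%N.
Proof.
move=> [v [v_in _ vspan]] hdim iD; rewrite leqNgt; apply/negP => lt.
have /choice[P vP] k : exists P : dob G (sqz_art K 1), v k ~~ iso_class P.
  by have [P] := v_in k; exists P.
have [W [g Dg]] := def_normal sE fE D.
(* For m = 0 nothing is known about $H^1$ and [B] is a mere filler. *)
have [B BP] : exists B : 'I_h -> cech_elt E 1, (0 < m)%N ->
    forall w, vin (r := cohomology E 1) w -> exists c, veq w (lincomb (V := cohomology E 1) c B).
  have [m0|m0] := posnP m; first by exists (fun=> vzero (cohomology E 1)).
  by have [B [_ _ Bs]] := hdim m0; exists B.
have /choice[a aP] (jk : 'I_m * 'I_d) : exists a : 'I_h -> K,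
    cech_eq (obstruction g (i (u_ jk.1)) jk.2) (lincomb (V := cohomology E 1) a B).
  apply: BP; first exact: leq_ltn_trans (ltn_ord jk.1).
  exact: obstruction_in.
(* Row k lists the coordinates of the obstructions of the k-th component on all m basis sections; a
   row vector killed by A is a combination to which they all lift. *)
pose A : 'M[K]_(d, m * h) := \matrix_k mxvec (\matrix_(j, l) a (j, k) l).
pose R := row_base (kermx A).
have RA : R *m A = 0 by apply/sub_kermxP; rewrite eq_row_base.
have nR : (n < \rank (kermx A))%N.
  rewrite mxrank_ker ltn_subRL addnC; apply: leq_ltn_trans lt.
  by rewrite leq_add2l rank_leq_col.
(* [gam] holds the coordinates, in the basis of t_Def(E,U), of a pair over the combination of D
   given by row b of R. *)
have ex (b : 'I_(\rank (kermx A))) : exists gam : 'I_n -> K,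
    forall Y Z : ob 1, ext (row b R)^T D Y ->
    (forall V : ob n, (forall k, ext (delta_mx k 0 : 'M_(n, 1)) V (pd_def (P k))) ->
       ext (\col_k gam k) V Z -> iso Y Z).
  have [Q QE] : exists Q : dob G (sqz_art K 1), 
      pd_def Q = glued_def (cocycle_map (row b R)^T g) sE fE.
    apply: (lift_of_obstruction (B := B) (a := fun j k => a (j, k))).
      by move=> j k; exact: (aP (j, k)).
    move=> j l.
    have /(congr1 (fun M : 'M_(_, _) => M b (mxvec_index j l))) := RA.
    rewrite !mxE => e; rewrite -[RHS]e; apply: eq_bigr => k _.
    by rewrite !mxE mxvecE mxE.
  have [gam gamE] : exists gam, veq (r := tangent G) (iso_class Q) (lincomb (V := tangent G) gam v).
    by apply: vspan; exists Q.
  exists gam => Y Z eY V eV eZ.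
  have lQ : lincomb (V := tangent G) gam v Q by apply/gamE; exact: pair_iso_refl.
  have := forget_lincomb sE fE i_linear vP lQ.
  move/(lincomb_ext sE fE eV (fun k => same_class_refl _) eZ) => ZQ.
  apply: def_iso_trans (def_iso_sym ZQ); rewrite QE.
  by apply: (def_ext_uniq sE Dg eY); exact: glued_map_ext.
have /choice[gam gamP] := ex.
have [V eV] := def_prod_surj sE fE (fun k => pd_def (P k)).
pose Gam : 'M[K]_(\rank (kermx A), n) := \matrix_(b, k) gam b k.
(* [Gam] has more than n rows and only n columns, so its rows satisfy a nontrivial relation. *)
have [x x0 xG] : exists2 x : 'rV_(\rank (kermx A)), x != 0 & x *m Gam = 0.
  have : kermx Gam != 0.
    rewrite -mxrank_eq0 mxrank_ker subn_eq0 -ltnNge.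
    exact: leq_ltn_trans (rank_leq_col _) nR.
  move=> /rowV0Pn[x /sub_kermxP xG x0]; by exists x.
have [Y eY] := def_ext_exists sE fE R^T D.
have [Y' eY'] := def_ext_exists sE fE Gam^T V.
have YY : iso Y Y'.
  apply: (ext_cols sE fE eY eY') => b.
  have [Z eZ] := def_ext_exists sE fE (R^T *m (delta_mx b 0 : 'cV_ _)) D.
  have [Z' eZ'] := def_ext_exists sE fE (Gam^T *m (delta_mx b 0 : 'cV_ _)) V.
  exists Z, Z'; split=> //; apply: (gamP b Z Z' _ V eV).
    by rewrite tr_row colE.
  rewrite (_ : \col_k gam b k = Gam^T *m delta_mx b 0) //.
  by rewrite -colE; apply/matrixP => p q; rewrite !mxE.
have [Q eQ] := def_ext_exists sE fE x^T Y.
have [Q' eQ'] := def_ext_exists sE fE x^T Y'.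
have QQ : iso Q Q' by exact: (def_ext_uniq sE YY eQ eQ').
have eV0 := def_ext_comp sE fE eY' eQ'; rewrite -trmx_mul xG trmx0 in eV0.
(* The relation x makes the combination of the images of the basis zero, hence also the combination
   [x *m R] of D; independence and freeness of R contradict x being nonzero. *)
have zQ : @tan_zero K F Q by apply/(tan_zeroP sE fE eV0); exact: def_iso_sym.
have := iD _ _ (def_ext_comp sE fE eY eQ) zQ.
rewrite -trmx_mul => /(congr1 trmx); rewrite trmxK trmx0 => xR.
move/negP: x0; apply; apply/eqP.
have fR : row_free R by exact: row_base_free.
by apply: (row_free_inj fR); rewrite xR mul0mx.
Qed.

End Bound.

Section ExtendedDimension.
Variables (K : fieldType) (V : rawspace K).

Lemma edim_finite : (exists n, has_dim V n) ->
  exists2 n, has_dim V n & edim V = (n%:Z%:E)%E.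
Proof.
move=> ex; rewrite /edim asboolT //; exists (xget 0%N (has_dim V)) => //.
by have [n hn] := ex; exact: (xgetPex 0%N ex).
Qed.

Lemma edim_infinite : ~ (exists n, has_dim V n) -> edim V = +oo%E.
Proof. by move=> nex; rewrite /edim asboolF. Qed.

End ExtendedDimension.

Theorem corollary3p6 (K : closedFieldType) (charK : [pchar K] =i pred0)
    (X : projvar K) (smoothX : smooth X)
    (H1O : is_zero_space (cohomology (structure_sheaf X) 1))
    (H2O : is_zero_space (cohomology (structure_sheaf X) 2))
    (E : opsh X K^o) (sheafE : is_sheaf E) (freeE : locally_free E)
    (U : vectType K) (i : U -> gsec E)
    (i_linear : forall (a : K) (u v : U),
       i (a *: u + v) = ascale (a : K^o) (i u) + i v)
    (i_inj : injective i)
    (m : nat) (dimU : \dim {:U} = m) :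
  (edim (tangent (PairDef i)) >=
   edim (tangent (Def E)) - m%:Z%:E * edim (cohomology E 1))%E.
Proof.
have [[n hn]|/edim_infinite -> //] := EM (exists n, has_dim (tangent (PairDef i)) n);
  last exact: leey.
have {hn} [{}n hn ->] : exists2 k, has_dim (tangent (PairDef i)) k &
    edim (tangent (PairDef i)) = (k%:Z%:E)%E by apply: edim_finite; exists n.
(* The guard on h lets the case m = 0 go through without any knowledge of $H^1$. *)
have bound h : ((0 < m)%N -> has_dim (cohomology E 1) h) ->
    exists2 d, edim (tangent (Def E)) = (d%:Z%:E)%E & (d <= n + m * h)%N.
  move=> hh; have [d hd le] := tangent_dim_bound sheafE freeE (N := n + m * h)
    (fun d D iD => ltac:(rewrite -dimU; apply: (dim_bound sheafE freeE i_linear hn _ iD);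
      rewrite dimU; exact: hh)).
  have [|d' hd' ->] := @edim_finite _ (tangent (Def E)); first by exists d.
  by exists d'; [|exact: le].
have [m0|m0] := posnP m.
  have [|d -> dn] := bound 0%N; first by rewrite m0.
  by rewrite m0 mul0e sube0 lee_fin lez_nat (leq_trans dn) // m0 mul0n addn0.
have [[h hh]|/edim_infinite ->] := EM (exists h, has_dim (cohomology E 1) h).
  have [|{hh}h hh ->] := @edim_finite _ (cohomology E 1); first by exists h.
  have [|d -> dn] := bound h; first by [].
  rewrite -EFinM -EFinB lee_fin Num.Theory.lerBlDr -PoszM -PoszD lez_nat.
  exact: dn.
(* The right-hand side is -oo, also when t_Def(E) is infinite-dimensional, since +oo - +oo is -oo
   here. *)
rewrite gt0_muley ?lte_fin ?ltz_nat //.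
by rewrite addeC /=; exact: leNye.
Qed.
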